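(* Let $\mathcal U,\mathcal Y$ be Hilbert spaces, let $S\in\mathcal S(\mathcal U,\mathcal Y)$, put $\widetilde S(z):=S(\overline z)^*$, and let $\mathcal D(S)$ be the associated two-component de Branges-Rovnyak space. Then: (1) $\mathcal D(S)$ is a linear space, indeed a reproducing kernel Hilbert space (of $\mathcal Y\oplus\mathcal U$-valued functions on $\mathbb D$) with reproducing kernel $$\widehat K_S(z,w)=\begin{bmatrix}K_S(z,w)&\frac{S(z)-S(\overline w)}{z-\overline w}\\[2pt] \frac{\widetilde S(z)-\widetilde S(\overline w)}{z-\overline w}&K_{\widetilde S}(z,w)\end{bmatrix}.$$ (2)\&(3) $\mathcal D(S)$ is invariant under the transformation $$\widehat R_0\colon\begin{bmatrix}f(z)\\ g(z)\end{bmatrix}\mapsto\begin{bmatrix}[f(z)-f(0)]/z\\ zg(z)-\widetilde S(z)f(0)\end{bmatrix},$$ with adjoint (on $\mathcal D(S)$) given by $$(\widehat R_0)^*\colon\begin{bmatrix}f(z)\\ g(z)\end{bmatrix}\mapsto\begin{bmatrix}zf(z)-S(z)g(0)\\ [g(z)-g(0)]/z\end{bmatrix}.$$ Moreover, for all $\begin{bmatrix}f\\ g\end{bmatrix}\in\mathcal D(S)$, $$\Big\|\widehat R_0\begin{bmatrix}f\\ g\end{bmatrix}\Big\|^2_{\mathcal D(S)}=\Big\|\begin{bmatrix}f\\ g\end{bmatrix}\Big\|^2_{\mathcal D(S)}-\|f(0)\|^2_{\mathcal Y},\qquad \Big\|(\widehat R_0)^*\begin{bmatrix}f\\ g\end{bmatrix}\Big\|^2_{\mathcal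 D(S)}=\Big\|\begin{bmatrix}f\\ g\end{bmatrix}\Big\|^2_{\mathcal D(S)}-\|g(0)\|^2_{\mathcal U}.$$ (4) Let $\widehat{\mathbf U}_S=\begin{bmatrix}\widehat A_S&\widehat B_S\\ \widehat C_S&\widehat D_S\end{bmatrix}\colon\begin{bmatrix}\mathcal D(S)\\ \mathcal U\end{bmatrix}\to\begin{bmatrix}\mathcal D(S)\\ \mathcal Y\end{bmatrix}$, where $$\widehat A_S=\widehat R_0|_{\mathcal D(S)},\quad \widehat B_S\colon u\mapsto\begin{bmatrix}\frac{S(z)-S(0)}{z}u\\ K_{\widetilde S}(z,0)u\end{bmatrix},\quad \widehat C_S\colon\begin{bmatrix}f\\ g\end{bmatrix}\mapsto f(0),\quad \widehat D_S=S(0).$$ Then $\widehat{\mathbf U}_S$ is unitary, and $S(z)=\widehat D_S+z\widehat C_S(I-z\widehat A_S)^{-1}\widehat B_S$ for $z\in\mathbb D$. (5) An operator $T$ on a Hilbert space $\mathcal X$ is unitarily equivalent to an operator of the form $\widehat R_0$ on a space $\mathcal D(S)$ for some contractive operator-valued analytic function $S$ on $\mathbb D$ if and only if $T$ is a completely non-unitary contraction, i.e., $\|T\|\le1$ and $$\Big(\bigcap_{n\ge0}\{x\colon\|T^{*n}x\|=\|x\|\}\Big)\cap\Big(\bigcap_{n\ge0}\{x\colon\|T^nx\|=\|x\|\}\Big)=\{0\}.$$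
   Context: $H^2(\mathcal Y)$ is the Hardy space of analytic $\mathcal Y$-valued functions on the open unit disk $\mathbb D$ with square-summable Taylor coefficients. The Schur class $\mathcal S(\mathcal U,\mathcal Y)$ is the set of analytic functions on $\mathbb D$ with values contractive operators from $\mathcal U$ to $\mathcal Y$. For $S\in\mathcal S(\mathcal U,\mathcal Y)$, $$\mathcal H(S)=\Big\{f\in H^2(\mathcal Y)\colon \|f\|^2_{\mathcal H(S)}:=\sup_{g\in H^2(\mathcal U)}\{\|f+Sg\|^2_{H^2(\mathcal Y)}-\|g\|^2_{H^2(\mathcal U)}\}<\infty\Big\},\qquad K_S(z,w)=\frac{I-S(z)S(w)^*}{1-z\overline w},$$ and $K_{\widetilde S}(z,w)=\frac{I-\widetilde S(z)\widetilde S(w)^*}{1-z\overline w}$. Difference quotients at coinciding points are understood as derivatives. $\mathcal D(S)$ is the space of all pairs $\begin{bmatrix}f\\ g\end{bmatrix}$ with $f\in H^2(\mathcal Y)$ and $g(z)=\sum_{n\ge0}a_nz^n\in H^2(\mathcal U)$ such that the numbers $$N_n:=\|z^nf(z)-S(z)(a_0z^{n-1}+\cdots+a_{n-1})\|^2_{\mathcal H(S)}+\|a_0\|^2+\cdots+\|a_{n-1}\|^2\qquad(n=0,1,2,\dots)$$ are uniformly bounded (in particular each function $z^nf(z)-S(z)(a_0z^{n-1}+\cdots+a_{n-1})$ is required to lie in $\mathcal H(S)$). The sequence $N_n$ is monotone, hence convergent, and $\Big\|\begin{bmatrix}f\\ g\end{bmatrix}\Big\|^2_{\mathcal D(S)}:=\lim_{n\to\infty}N_n$.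 A Hilbert space $\mathcal H$ of $\mathcal E$-valued functions on $\Omega$ is a reproducing kernel Hilbert space with kernel $K\colon\Omega\times\Omega\to\mathcal L(\mathcal E)$ if $K(\cdot,\zeta)e\in\mathcal H$ and $\langle f,K(\cdot,\zeta)e\rangle_{\mathcal H}=\langle f(\zeta),e\rangle_{\mathcal E}$ for all $f\in\mathcal H,\zeta\in\Omega,e\in\mathcal E$. *)

(* Defs.v *)
From HB Require Import structures.
From mathcomp Require Import all_boot all_order all_algebra.
From mathcomp Require Import complex.
From mathcomp Require Import all_classical all_reals all_analysis.

Set Implicit Arguments.
Unset Strict Implicit.
Unset Printing Implicit Defensive.

Import Order.TTheory GRing.Theory Num.Theory.
Import numFieldNormedType.Exports.

Local Open Scope classical_set_scope.
Local Open Scope complex_scope.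
Local Open Scope ring_scope.

(* The inner product is linear in its first argument and conjugate-linear in
   the second. *)
HB.mixin Record CompleteNormedModule_isHilbert (R : realType) (V : Type)
    of CompleteNormedModule R[i] V := {
  inner : {dot V for (@Num.conj R[i])};
  inner_norm : forall x : V, inner x x = `|x| ^+ 2
}.

#[short(type="hilbertType")]
HB.structure Definition Hilbert (R : realType) :=
  {V of CompleteNormedModule_isHilbert R V & CompleteNormedModule R[i] V}.

(* Hilbert spaces carried by a subset [H] of a complex vector space, with the
   inner product [ip] (only its values on [H] are relevant).                 *)
Section HilbertOn.
Variable R : realType.
Implicit Types V W : lmodType R[i].

Definition ipnorm V (ip : V -> V -> R[i]) (x : V) : R :=
  Num.sqrt (complex.Re (ip x x)).

Definition subspace V (H : set V) : Prop :=
  H 0 /\ forall (a : R[i]) x y, H x -> H y -> H (a *: x + y).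

Definition hilbert_on V (H : set V) (ip : V -> V -> R[i]) : Prop :=
  [/\ subspace H,
      forall (a : R[i]) x y z, H x -> H y -> H z ->
        ip (a *: x + y) z = a * ip x z + ip y z,
      forall x y, H x -> H y -> ip y x = (ip x y)^*,
      forall x, H x -> x != 0 -> 0 < ip x x
    & forall u : nat -> V, (forall n, H (u n)) ->
        (forall e : R, 0 < e -> exists N, forall m n,
           (N <= m)%N -> (N <= n)%N -> ipnorm ip (u m - u n) < e) ->
        exists2 l, H l & (fun n => ipnorm ip (u n - l)) @ \oo --> (0 : R)].

Definition linear_on V W (H : set V) (A : V -> W) : Prop :=
  forall (a : R[i]) x y, H x -> H y -> A (a *: x + y) = a *: A x + A y.

Definition bounded_on V W (H : set V) (ipV : V -> V -> R[i])
    (ipW : W -> W -> R[i]) (A : V -> W) : Prop :=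
  linear_on H A /\
  exists M : R, forall x, H x -> ipnorm ipW (A x) <= M * ipnorm ipV x.

(* [B] is the adjoint of the operator [A] on the Hilbert space [H]. *)
Definition adjoint_on V (H : set V) (ip : V -> V -> R[i]) (A B : V -> V) :
    Prop :=
  [/\ forall x, H x -> H (A x),
      forall x, H x -> H (B x)
    & forall x y, H x -> H y -> ip (A x) y = ip x (B y)].

Definition unitary_on V W (H : set V) (ipV : V -> V -> R[i])
    (K : set W) (ipW : W -> W -> R[i]) (A : V -> W) : Prop :=
  [/\ linear_on H A, A @` H = K
    & forall x y, H x -> H y -> ipW (A x) (A y) = ipV x y].

Definition invertible_on V (H : set V) (ip : V -> V -> R[i]) (A : V -> V) :
    Prop :=
  [/\ bounded_on H ip ip A, set_bij H H A
    & bounded_on H ip ip ('pinv_(fun=> 0) H A)].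

Definition dsum_ip V W (ipV : V -> V -> R[i]) (ipW : W -> W -> R[i])
    (p q : V * W) : R[i] := ipV p.1 q.1 + ipW p.2 q.2.

(* [H] is a reproducing kernel Hilbert space of functions on [Omega] with
   values in the Hilbert space [(E, ipE)].                                   *)
Definition is_rkhs (Omega : Type) (E : lmodType R[i]) (ipE : E -> E -> R[i])
    (K : Omega -> Omega -> E -> E)
    (H : set (Omega -> E)) (ip : (Omega -> E) -> (Omega -> E) -> R[i]) : Prop :=
  [/\ hilbert_on setT ipE, hilbert_on H ip,
      forall z w, bounded_on setT ipE ipE (K z w),
      forall w e, H (fun z => K z w e)
    & forall f w e, H f -> ip f (fun z => K z w e) = ipE (f w) e].

End HilbertOn.

Section Operators.
Variables (R : realType) (U Y : hilbertType R).

Definition hnorm (x : U) : R := ipnorm inner x.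

Definition bounded_op (A : U -> Y) : Prop := bounded_on setT inner inner A.

Definition contractive_op (A : U -> Y) : Prop :=
  linear_on setT A /\ forall u, `|A u| <= `|u|.

(* The adjoint, picked by its defining property; it exists and is unique for
   bounded [A] by the Riesz representation theorem.                          *)
Definition adj (A : U -> Y) : Y -> U :=
  xget (fun=> 0) [set B | forall u y, inner (A u) y = inner u (B y)].

End Operators.

Section Disk.
Variable R : realType.

Record disk := Disk { disk_val :> R[i]; disk_valP : `|disk_val| < 1 }.

HB.instance Definition _ := [isSub for disk_val].

Lemma disk0_subproof : `|0 : R[i]| < 1. Proof. by rewrite normr0. Qed.
Definition disk0 : disk := Disk disk0_subproof.

Lemma diskJ_subproof (z : disk) : `|(z : R[i])^*| < 1.
Proof. by rewrite norm_conjC disk_valP. Qed.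
Definition diskJ (z : disk) : disk := Disk (diskJ_subproof z).

Variable V : normedModType R[i].
Implicit Type f : disk -> V.

(* Functions on the disk are analytic when they are the sum, on the whole disk,
   of a power series centered at 0.                                          *)
Definition has_taylor f (a : nat -> V) : Prop :=
  forall z : disk, series (fun k => (z : R[i]) ^+ k *: a k) @ \oo --> f z.

Definition analytic f : Prop := exists a, has_taylor f a.

(* The (unique) sequence of Taylor coefficients at 0 of an analytic [f]. *)
Definition taylor f : nat -> V := xget (fun=> 0) [set a | has_taylor f a].

Definition extend0 f (z : R[i]) : V := oapp f 0 (insub z).

(* The complex derivative; it does not depend on how [f] is extended beyond
   the open disk.                                                            *)
Definition disk_derive f (z : disk) : V :=
  'D_1 (extend0 f : R[i]^o -> V) (z : R[i]^o).

Definition diffq f (z w : disk) : V :=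
  if (z : R[i]) == w then disk_derive f z
  else ((z : R[i]) - (w : R[i]))^-1 *: (f z - f w).

End Disk.

Section Schur.
Variables (R : realType) (U Y : hilbertType R).
Implicit Type S : disk R -> U -> Y.

(* The power series with operator coefficients converges in operator norm at
   every point of the disk.                                                  *)
Definition op_analytic S : Prop :=
  exists2 Sn : nat -> U -> Y, (forall n, bounded_op (Sn n)) &
  forall (z : disk R) (e : R), 0 < e -> \forall n \near \oo, forall u,
    hnorm (S z u - \sum_(k < n) (z : R[i]) ^+ k *: Sn k u) <= e * hnorm u.

Definition schur S : Prop := (forall z, contractive_op (S z)) /\ op_analytic S.

Definition tilde S : disk R -> Y -> U := fun z => adj (S (diskJ z)).

(* (S(z) - S(w)) / (z - w) *)
Definition op_diffq S (z w : disk R) (u : U) : Y := diffq (fun t => S t u) z w.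

(* (I - S(z) S(w)^* ) / (1 - z w^* ) *)
Definition dBRker S (z w : disk R) (y : Y) : Y :=
  (1 - (z : R[i]) * (w : R[i])^*)^-1 *: (y - S z (adj (S w) y)).

End Schur.

Section Hardy.
Variables (R : realType) (Y : hilbertType R).
Implicit Type f : disk R -> Y.

Definition H2norm2 f : \bar R :=
  (\sum_(0 <= k <oo) (hnorm (taylor f k) ^+ 2)%:E)%E.

Definition H2 : set (disk R -> Y) :=
  [set f | analytic f /\ (H2norm2 f < +oo)%E].

End Hardy.

Section DeBrangesRovnyak.
Variables (R : realType) (U Y : hilbertType R) (S : disk R -> U -> Y).

Definition HSnorm2 (f : disk R -> Y) : \bar R :=
  ereal_sup [set (H2norm2 (fun z => f z + S z (g z))%R - H2norm2 g)%E
            | g in @H2 R U].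

Definition HS : set (disk R -> Y) := [set f | H2 f /\ (HSnorm2 f < +oo)%E].

(* The pair [f; g] is the function h : z |-> (f z, g z). *)
Notation pairfun := (disk R -> Y * U)%type.
Implicit Types h k : pairfun.

Definition comp1 h : disk R -> Y := fun z => (h z).1.
Definition comp2 h : disk R -> U := fun z => (h z).2.

(* z^n f(z) - S(z) (a_0 z^(n-1) + ... + a_(n-1)) *)
Definition DSshift h (n : nat) : disk R -> Y := fun z =>
  (z : R[i]) ^+ n *: comp1 h z
  - S z (\sum_(k < n) (z : R[i]) ^+ (n.-1 - k) *: taylor (comp2 h) k).

Definition DSN h (n : nat) : \bar R :=
  (HSnorm2 (DSshift h n)
   + (\sum_(k < n) hnorm (taylor (comp2 h) k) ^+ 2)%R%:E)%E.

Definition DS : set pairfun :=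
  [set h | [/\ H2 (comp1 h), H2 (comp2 h)
             & exists M : R, forall n, HS (DSshift h n) /\ (DSN h n <= M%:E)%E]].

Definition DSnorm2 h : R := fine (limn (DSN h)).

(* The polarization of DSnorm2: the only inner product that can induce it. *)
Definition DSip h k : R[i] :=
  4^-1 * \sum_(j < 4) 'i ^+ j * (DSnorm2 (h + 'i ^+ j *: k))%:C.

Definition DSker (z w : disk R) (e : Y * U) : Y * U :=
  (dBRker S z w e.1 + op_diffq S z (diskJ w) e.2,
   op_diffq (tilde S) z (diskJ w) e.1 + dBRker (tilde S) z w e.2).

Definition R0 h : pairfun := fun z =>
  (diffq (comp1 h) z (disk0 R),
   (z : R[i]) *: comp2 h z - tilde S z (comp1 h (disk0 R))).

Definition R0adj h : pairfun := fun z =>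
  ((z : R[i]) *: comp1 h z - S z (comp2 h (disk0 R)),
   diffq (comp2 h) z (disk0 R)).

Definition DS_B (u : U) : pairfun := fun z =>
  (op_diffq S z (disk0 R) u, dBRker (tilde S) z (disk0 R) u).

Definition DS_C h : Y := comp1 h (disk0 R).

Definition DS_D (u : U) : Y := S (disk0 R) u.

Definition DS_U (p : pairfun * U) : pairfun * Y :=
  (R0 p.1 + DS_B p.2, DS_C p.1 + DS_D p.2).

End DeBrangesRovnyak.

Section Contractions.
Variables (R : realType) (X : hilbertType R).

Definition cnu_contraction (T : X -> X) : Prop :=
  (forall x, `|T x| <= `|x|) /\
  (\bigcap_n [set x | `|iter n (adj T) x| = `|x|])
    `&` (\bigcap_n [set x | `|iter n T x| = `|x|]) = [set 0].

End Contractions.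

(* Main.v *)
(** A pair [(f, g)] is a bilateral sequence: the coefficients of [f] at the
    positions [k >= 0], those of [g] at [-1, -2, ...].  Let [Pi] be the Laurent
    operator on finitely supported sequences with symbol [[I, S], [S^*, I]], and
    [B v] the form [<Pi v, v>].  It is nonnegative because the truncated Toeplitz
    operators of [S] are contractions, and the norm of [D(S)] turns out to be
    [sup_v (2 Re <z, v> - B v)], the dual norm of [B].  Since [Pi v] ranges over
    a dense set, polarization of this supremum is linear; thus [D(S)] is a closed
    subspace of a Hilbert space of sequences on which the bilateral shift is
    unitary.  There [R0], [R0^*], [B_S] and [C_S^*] are the shift and its inverse
    corrected by [Pi] of point masses, whence the norm identities and the unitarity
    of the colligation.  The kernel comes from solving [x - conj w R0^* x = C_S^* y]
    and [x - conj w R0 x = B_S u] pointwise.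

    For (5), [S] is the transfer function of the Julia operator
    [[T, B], [C, -T^*]] with [C^2 = I - T^* T] and [B^2 = I - T T^*]; the map
    [x |-> (sum_k C T^k x z^k, sum_k B T^*k x z^k)] intertwines [T] and [R0], its
    adjoint is a section of it, and it is injective exactly when [T] is completely
    non-unitary. *)
Require Import Defs.
From HB Require Import structures.
From mathcomp Require Import all_boot all_order all_algebra.
From mathcomp Require Import complex.
From mathcomp Require Import all_classical all_reals all_analysis.
From mathcomp Require cyclic cyclotomic separable.
From mathcomp Require Import ring lra zify.

Set Implicit Arguments.
Unset Strict Implicit.
Unset Printing Implicit Defensive.

Import Order.TTheory GRing.Theory Num.Theory.
Import numFieldNormedType.Exports.

Local Open Scope classical_set_scope.
Local Open Scope complex_scope.
Local Open Scope ring_scope.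

(** The given norm is a limit of suprema with no visible parallelogram law, and [DSip] is merely its
    polarization, so even the linearity of [DSip] is at stake. The dual norm undoes the nesting: in
    [zquad_mklist] the first entries of the test sequence occur in a single negative square; once
    that square is optimized away, the second entries, measured from those of the point, play the
    role of the test function [g] in the norm of H(S), while [n] is just minus the left end of the
    support. Since test sequences are finitely supported, no boundary values of [S], no square root
    of the Laurent operator and no completion enter. A pair occupies complementary half-lines, and a
    shift spoils this at one position only. The columns of the Laurent operator belong to the space,
    so subtracting one of them repairs that position without leaving the space; its other entries
    are the terms with [S] and [tilde S] in the formulas. In (5) the embedding is at first only
    known to be contractive, by an energy balance along trajectories. That its adjoint is a section
    is read off coefficient by coefficient, and injectivity then makes it unitary. *)

Section Modulus.
Variable R : realType.
Implicit Types (a b : R[i]) (x y : R).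

(** The norm of [R[i]] takes its values in [R[i]]; a real-valued modulus keeps the estimates in [R],
    within reach of [lra] and [nra]. *)
Definition cmod a : R := complex.Re `|a|.

Lemma cmodE a : `|a| = (cmod a)%:C. Proof. by rewrite /cmod normc_def. Qed.

Lemma cmod_ge0 a : 0 <= cmod a.
Proof. by have := normr_ge0 a; rewrite cmodE lecR. Qed.

Lemma cmodM a b : cmod (a * b) = cmod a * cmod b.
Proof.
by have /complexI : (cmod (a * b))%:C = (cmod a * cmod b)%:C
  by rewrite rmorphM /= -!cmodE normrM.
Qed.

Lemma cmodX a n : cmod (a ^+ n) = cmod a ^+ n.
Proof.
elim: n => [|n IH]; last by rewrite !exprS cmodM IH.
by apply: complexI; rewrite -cmodE normr1.
Qed.

Lemma cmod_le_add a b : cmod (a + b) <= cmod a + cmod b.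
Proof. by rewrite -lecR rmorphD /= -!cmodE ler_normD. Qed.

Lemma cmod0 : cmod 0 = 0.
Proof. by apply: complexI; rewrite -cmodE normr0. Qed.

Lemma cmod1 : cmod 1 = 1.
Proof. by apply: complexI; rewrite -cmodE normr1. Qed.

Lemma cmodN a : cmod (- a) = cmod a.
Proof. by rewrite /cmod normrN. Qed.

Lemma cmodJ a : cmod a^* = cmod a.
Proof. by rewrite /cmod norm_conjC. Qed.

Lemma cmodV a : cmod a^-1 = (cmod a)^-1.
Proof.
by apply: complexI; rewrite -cmodE normfV cmodE -[LHS]/(_^-1) fmorphV.
Qed.

Lemma cmodR x : cmod x%:C = `|x|.
Proof. by rewrite /cmod normc_def /= expr0n addr0 sqrtr_sqr. Qed.

Lemma cmod_eq0 a : (cmod a == 0) = (a == 0).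
Proof.
by rewrite -(normr_eq0 a) cmodE -(inj_eq (@complexI R)).
Qed.

Lemma cmod_gt0 a : (0 < cmod a) = (a != 0).
Proof. by rewrite lt_def cmod_ge0 cmod_eq0 andbT. Qed.

Lemma mulJ_cmod a : a * a^* = (cmod a ^+ 2)%:C.
Proof. by rewrite -normCK cmodE rmorphXn. Qed.

Lemma ReD a b : complex.Re (a + b) = complex.Re a + complex.Re b.
Proof. by case: a b => [? ?] [? ?]. Qed.

Lemma ReN a : complex.Re (- a) = - complex.Re a.
Proof. by case: a. Qed.

Lemma ReB a b : complex.Re (a - b) = complex.Re a - complex.Re b.
Proof. by rewrite ReD ReN. Qed.

Lemma ReJ a : complex.Re a^* = complex.Re a.
Proof. by case: a. Qed.

Lemma ReZ x a : complex.Re (x%:C * a) = x * complex.Re a.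
Proof. by case: a => u v /=; rewrite mul0r subr0. Qed.

Lemma Re_sum (I : Type) (r : seq I) (P : pred I) (F : I -> R[i]) :
  complex.Re (\sum_(i <- r | P i) F i) = \sum_(i <- r | P i) complex.Re (F i).
Proof. by apply: (big_morph _ ReD). Qed.

Lemma le_of_eq x y : x = y -> x <= y.
Proof. by move=> ->. Qed.

Lemma Re_le_cmod a : complex.Re a <= cmod a.
Proof. by apply: le_trans (ler_norm _) _; rewrite -lecR -cmodE normc_ge_Re. Qed.

Lemma conjRC x : (x%:C)^* = x%:C :> R[i].
Proof. by apply/eqP; rewrite eq_complex /= oppr0 !eqxx. Qed.

Lemma addJ a : a + a^* = (2 * complex.Re a)%:C.
Proof. by rewrite (addcJ a) rmorphM /= rmorph_nat. Qed.

Lemma cmod_i : cmod 'i = 1.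
Proof. by apply: complexI; rewrite -cmodE normCi. Qed.

Lemma imC : 'i = Complex 0 1 :> R[i].
Proof. by []. Qed.

Lemma complex_ReIm a : a = (complex.Re a)%:C + 'i * (complex.Re (- 'i * a))%:C.
Proof.
rewrite imC; case: a => x y; apply/eqP; rewrite eq_complex /=.
by apply/andP; split; apply/eqP => /=; ring.
Qed.

(** Rotating by such a [b] upgrades a bound on a real part to a bound on the modulus. *)
Lemma cmod_rot a : exists2 b : R[i], cmod b = 1 & b * a = (cmod a)%:C.
Proof.
have [->|a0] := eqVneq a 0.
  by exists 1; rewrite ?cmod1// cmod0 mulr0.
exists (a^* / (cmod a)%:C).
  rewrite cmodM cmodV cmodJ cmodR ger0_norm ?cmod_ge0//.
  by rewrite divff// cmod_eq0.
rewrite mulrAC [_^* * _]mulrC mulJ_cmod rmorphXn /= expr2 -mulrA divff ?mulr1//.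
by rewrite -cmodE normr_eq0.
Qed.

End Modulus.

(** * Real sequences tending to zero *)

Section NullSequences.
Variable R : realType.
Implicit Types u v : nat -> R.

Lemma cvg0Ml (c : R) u : u @ \oo --> (0 : R) -> (fun n => c * u n) @ \oo --> (0 : R).
Proof. by move=> h; rewrite -[X in _ --> X](mulr0 c); apply: cvgMr. Qed.

Lemma cvg0D u v : u @ \oo --> (0 : R) -> v @ \oo --> (0 : R) ->
  (fun n => u n + v n) @ \oo --> (0 : R).
Proof. by move=> cu cv; rewrite -[X in _ --> X](addr0 0); exact: cvgD. Qed.

Lemma squeeze0 u v : (forall n, 0 <= u n <= v n) -> v @ \oo --> (0 : R) -> u @ \oo --> (0 : R).
Proof.
move=> uv cv; apply: (@squeeze_cvgr _ _ _ _ (cst 0) v) => //; last exact: cvg_cst.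
by near=> n; exact: uv.
Unshelve. all: by end_near. Qed.

End NullSequences.

(** * Inner product geometry on a Hilbert space carried by a subset *)

Section HilbertOnTheory.
Variables (R : realType) (V : lmodType R[i]) (H : set V) (ip : V -> V -> R[i]).
Hypothesis hH : hilbert_on H ip.
Implicit Types (x y z : V) (a b : R[i]).
Local Notation N := (ipnorm ip).

Lemma sub0 : H 0. Proof. by case: hH => -[]. Qed.

Lemma subDZ a x y : H x -> H y -> H (a *: x + y).
Proof. by case: hH => -[_ h] _ _ _ _; exact: h. Qed.

Lemma subZ a x : H x -> H (a *: x).
Proof. by move=> hx; rewrite -[_ *: _]addr0; apply: subDZ => //; exact: sub0. Qed.

Lemma subD x y : H x -> H y -> H (x + y).
Proof. by move=> hx hy; rewrite -[x]scale1r; exact: subDZ. Qed.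

Lemma subN x : H x -> H (- x).
Proof. by move=> hx; rewrite -scaleN1r; exact: subZ. Qed.

Lemma subB x y : H x -> H y -> H (x - y).
Proof. by move=> hx hy; apply: subD => //; exact: subN. Qed.

Lemma sub_sum (I : Type) (r : seq I) (P : pred I) (F : I -> V) :
  (forall i, H (F i)) -> H (\sum_(i <- r | P i) F i).
Proof. by move=> hF; apply: big_ind => //; [exact: sub0|exact: subD]. Qed.

Lemma ipDZl a x y z : H x -> H y -> H z -> ip (a *: x + y) z = a * ip x z + ip y z.
Proof. by case: hH => _ h _ _ _; exact: h. Qed.

Lemma ipJ x y : H x -> H y -> (ip x y)^* = ip y x.
Proof. by move=> hx hy; case: hH => _ _ h _ _; rewrite [RHS]h. Qed.

Lemma ipDl x y z : H x -> H y -> H z -> ip (x + y) z = ip x z + ip y z.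
Proof. by move=> hx hy hz; rewrite -[x]scale1r ipDZl// mul1r scale1r. Qed.

Lemma ip0l z : H z -> ip 0 z = 0.
Proof.
move=> hz; have := ipDl sub0 sub0 hz; rewrite addr0 => /eqP.
by rewrite -subr_eq subrr => /eqP.
Qed.

Lemma ipZl a x z : H x -> H z -> ip (a *: x) z = a * ip x z.
Proof.
by move=> hx hz; rewrite -[a *: x]addr0 ipDZl ?ip0l ?addr0//; exact: sub0.
Qed.

Lemma ipNl x z : H x -> H z -> ip (- x) z = - ip x z.
Proof. by move=> hx hz; rewrite -scaleN1r ipZl// mulN1r. Qed.

Lemma ipBl x y z : H x -> H y -> H z -> ip (x - y) z = ip x z - ip y z.
Proof. by move=> hx hy hz; rewrite ipDl ?ipNl//; exact: subN. Qed.

Lemma ipDr x y z : H x -> H y -> H z -> ip z (x + y) = ip z x + ip z y.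
Proof.
by move=> hx hy hz; rewrite -(ipJ (subD hx hy) hz) ipDl// rmorphD /= !ipJ.
Qed.

Lemma ip0r z : H z -> ip z 0 = 0.
Proof. by move=> hz; rewrite -(ipJ sub0 hz) ip0l// rmorph0. Qed.

Lemma ipZr a x z : H x -> H z -> ip z (a *: x) = a^* * ip z x.
Proof.
by move=> hx hz; rewrite -(ipJ (subZ a hx) hz) ipZl// rmorphM /= ipJ.
Qed.

Lemma ipNr x z : H x -> H z -> ip z (- x) = - ip z x.
Proof. by move=> hx hz; rewrite -(ipJ (subN hx) hz) ipNl// rmorphN /= ipJ. Qed.

Lemma ipBr x y z : H x -> H y -> H z -> ip z (x - y) = ip z x - ip z y.
Proof. by move=> hx hy hz; rewrite ipDr ?ipNr//; exact: subN. Qed.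

Lemma ip_ge0 x : H x -> 0 <= ip x x.
Proof.
have [->|x0 hx] := eqVneq x 0; first by move=> h; rewrite ip0l.
by case: hH => _ _ _ h _; apply: ltW; exact: h.
Qed.

Lemma ip_self x : H x -> ip x x = (N x ^+ 2)%:C.
Proof.
move=> hx; have := ip_ge0 hx; rewrite /ipnorm.
by case: (ip x x) => u v; rewrite lecE /= => /andP[/eqP-> u0]; rewrite sqr_sqrtr.
Qed.

Lemma ipn_ge0 x : 0 <= N x. Proof. exact: sqrtr_ge0. Qed.

Lemma ipn_def x (r : R) : 0 <= r -> H x -> ip x x = (r ^+ 2)%:C -> N x = r.
Proof. by move=> r0 hx h; rewrite /ipnorm h /= sqrtr_sqr ger0_norm. Qed.

Lemma ipnZ a x : H x -> N (a *: x) = cmod a * N x.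
Proof.
move=> hx; apply: ipn_def; [|exact: subZ|].
  by rewrite mulr_ge0 ?cmod_ge0 ?ipn_ge0.
rewrite ipZl ?ipZr ?ip_self//; last exact: subZ.
by rewrite mulrA mulJ_cmod exprMn [in RHS]rmorphM.
Qed.

Lemma ipn0 : N 0 = 0.
Proof. by rewrite /ipnorm ip0l ?sqrtr0//; exact: sub0. Qed.

Lemma ipn_eq0 x : H x -> N x = 0 -> x = 0.
Proof.
move=> hx h; apply/eqP; apply: contraT => x0.
case: hH => _ _ _ /(_ x hx x0) + _.
by rewrite ip_self// h expr0n ltxx.
Qed.

Lemma ipnN x : H x -> N (- x) = N x.
Proof. by move=> hx; rewrite -scaleN1r ipnZ// cmodN cmod1 mul1r. Qed.

Lemma ipn_distC x y : H x -> H y -> N (x - y) = N (y - x).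
Proof. by move=> hx hy; rewrite -ipnN ?opprB//; exact: subB. Qed.

Lemma ipn2D x y : H x -> H y ->
  N (x + y) ^+ 2 = N x ^+ 2 + N y ^+ 2 + 2 * complex.Re (ip x y).
Proof.
move=> hx hy; apply: complexI; rewrite -ip_self; last exact: subD.
rewrite ipDl ?ipDr//; try exact: subD.
rewrite !ip_self// -[ip y x]ipJ// !rmorphD /= -addJ.
ring.
Qed.

Lemma ipn2B x y : H x -> H y ->
  N (x - y) ^+ 2 = N x ^+ 2 + N y ^+ 2 - 2 * complex.Re (ip x y).
Proof.
by move=> hx hy; rewrite ipn2D ?ipnN ?ipNr ?ReN ?mulrN//; exact: subN.
Qed.

Lemma ip_CS x y : H x -> H y -> cmod (ip x y) <= N x * N y.
Proof.
move=> hx hy; have [b b1 bE] := cmod_rot (ip x y).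
have hbx : H (b *: x) by exact: subZ.
have ipb : complex.Re (ip (b *: x) y) = cmod (ip x y) by rewrite ipZl// bE.
have [x0|x0] := eqVneq (N x) 0.
  by rewrite (ipn_eq0 hx x0) ip0l// cmod0 ipn0 mul0r.
have [y0|y0] := eqVneq (N y) 0.
  by rewrite (ipn_eq0 hy y0) ip0r// cmod0 ipn0 mulr0.
have Nx : 0 < N x by rewrite lt_def x0 ipn_ge0.
have Ny : 0 < N y by rewrite lt_def y0 ipn_ge0.
(* The squared norm of [N y b x - N x y] equals [2 N x N y (N x N y - |<x, y>|)]. *)
have := ipn2B (subZ (N y)%:C hbx) (subZ (N x)%:C hy).
rewrite !ipnZ ?cmodR ?b1 ?mul1r//.
rewrite ipZl ?ipZr ?conjRC ?ReZ ?ipb//; last exact: subZ.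
rewrite !ger0_norm ?ipn_ge0// => h.
have : 0 <= N ((N y)%:C *: (b *: x) - (N x)%:C *: y) ^+ 2 by rewrite sqr_ge0.
rewrite h => h2.
have h3 : 0 <= 2 * (N x * N y) * (N x * N y - cmod (ip x y)).
  by apply: le_trans h2 _; apply: le_of_eq; ring.
rewrite pmulr_rge0 ?subr_ge0// in h3; by rewrite !mulr_gt0.
Qed.

Lemma ipnD x y : H x -> H y -> N (x + y) <= N x + N y.
Proof.
move=> hx hy; rewrite -(@ler_pXn2r _ 2) ?nnegrE ?addr_ge0 ?ipn_ge0//.
rewrite ipn2D// sqrrD.
have := le_trans (Re_le_cmod (ip x y)) (ip_CS hx hy).
lra.
Qed.

Lemma ipnB x y : H x -> H y -> N (x - y) <= N x + N y.
Proof. by move=> hx hy; rewrite -(ipnN hy) ipnD//; exact: subN. Qed.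

Lemma ipn_dist x y : H x -> H y -> N x <= N y + N (x - y).
Proof. by move=> hx hy; rewrite -[in leLHS](subrKC y x) ipnD//; exact: subB. Qed.

Lemma ipn_sum (r : seq nat) (F : nat -> V) :
  (forall i, H (F i)) -> N (\sum_(i <- r) F i) <= \sum_(i <- r) N (F i).
Proof.
move=> hF; elim: r => [|i r IH]; first by rewrite !big_nil ipn0.
rewrite !big_cons; apply: le_trans (ipnD _ _) _ => //; first exact: sub_sum.
by rewrite lerD2l.
Qed.

(** The increments of [u] are majorized by those of a bounded monotone real sequence, so the Cauchy
    property passes from [b] to [u]. Power series, Neumann series and the square-root iteration all
    converge by this. *)
Lemma ip_complete_incr (u : nat -> V) (b : nat -> R) (M : R) :
  (forall n, H (u n)) -> (forall n, N (u n.+1 - u n) <= b n.+1 - b n) ->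
  (forall n, b n <= M) ->
  exists2 l, H l & (fun n => N (u n - l)) @ \oo --> (0 : R).
Proof.
move=> hu hb hM; case: hH => _ _ _ _; apply => // e e0.
have b_nd : nondecreasing_seq b.
  apply/nondecreasing_seqP => n; rewrite -subr_ge0.
  by apply: le_trans (hb n); exact: ipn_ge0.
have dist n k : N (u (n + k)%N - u n) <= b (n + k)%N - b n.
  elim: k => [|k IH]; first by rewrite addn0 !subrr ipn0.
  rewrite addnS -(subrKA (u (n + k)%N)) -(subrKA (b (n + k)%N)).
  apply: le_trans (ipnD _ _) _; [exact: subB|exact: subB|].
  exact: lerD.
have cb : cvgn b.
  by apply: nondecreasing_is_cvgn => //; exists M => _ [n _ <-].
have lim_ge n : b n <= limn b by exact: nondecreasing_cvgn_le.
have [|K _ hK] := (@cvgrPdist_lt _ _ _ _ _ b (limn b)).1 cb (e / 2).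
  by rewrite divr_gt0.
exists K => m n Km Kn.
have key k : (K <= k)%N -> N (u k - u K) < e / 2.
  move=> Kk; have := dist K (k - K)%N; rewrite subnKC// => /le_lt_trans; apply.
  have := hK K (leqnn K); rewrite /= ger0_norm ?subr_ge0//.
  by apply: le_lt_trans; rewrite lerD2r.
rewrite -(subrKA (u K)) (splitr e); apply: le_lt_trans (ipnD _ _) _.
- exact: subB.
- exact: subB.
- by rewrite ltrD// ?key// ipn_distC// key.
Qed.

Lemma ip_limit_unique (u : nat -> V) l l' : (forall n, H (u n)) -> H l -> H l' ->
  (fun n => N (u n - l)) @ \oo --> (0 : R) ->
  (fun n => N (u n - l')) @ \oo --> (0 : R) -> l = l'.
Proof.
move=> hu hl hl' cl cl'; apply/eqP; rewrite -subr_eq0; apply/eqP.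
apply: ipn_eq0; first exact: subB.
apply/eqP; rewrite eq_le ipn_ge0 andbT.
have h : (fun n => N (u n - l) + N (u n - l')) @ \oo --> (0 + 0 : R) by exact: cvgD.
rewrite addr0 in h; apply: (cvgr_to_ge h); near=> n.
rewrite -(subrKA (u n)); apply: le_trans (ipnD _ _) _; [exact: subB|exact: subB|].
by rewrite ipn_distC.
Unshelve. all: by end_near. Qed.

End HilbertOnTheory.

(** * Solving [x - z A x = h] for a contraction [A] and [|z| < 1] *)

Section Neumann.
Variables (R : realType) (V : lmodType R[i]) (H : set V) (ip : V -> V -> R[i]).
Hypothesis hH : hilbert_on H ip.
Variables (A : V -> V) (z : R[i]).
Hypotheses (AH : forall x, H x -> H (A x)) (A_lin : linear_on H A).
Hypotheses (A_contr : forall x, H x -> ipnorm ip (A x) <= ipnorm ip x).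
Hypothesis z1 : cmod z < 1.
Local Notation N := (ipnorm ip).

Let zA x : V := z *: A x.

Let zAH x : H x -> H (zA x).
Proof. by move=> hx; apply: (subZ hH); exact: AH. Qed.

Lemma linear_onB x y : H x -> H y -> A (x - y) = A x - A y.
Proof.
move=> hx hy; have -> : x - y = (- 1) *: y + x by rewrite scaleN1r addrC.
by rewrite A_lin// scaleN1r addrC.
Qed.

Let zAB x y : H x -> H y -> zA x - zA y = zA (x - y).
Proof. by move=> hx hy; rewrite /zA linear_onB// scalerBr. Qed.

Let NzA x : H x -> N (zA x) <= cmod z * N x.
Proof.
move=> hx; rewrite (ipnZ hH); last exact: AH.
by rewrite ler_wpM2l ?cmod_ge0// A_contr.
Qed.

Lemma resolvent_lower_bound x : H x -> (1 - cmod z) * N x <= N (x - z *: A x).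
Proof.
move=> hx; have := ipn_dist hH hx (zAH hx); have := NzA hx; rewrite /zA.
nra.
Qed.

Lemma neumann h : H h -> exists2 x, H x & x - z *: A x = h.
Proof.
(* Picard iteration; its iterates are the partial sums of the Neumann series. *)
move=> hh; pose u n := iter n (fun x => h + zA x) 0.
have hu n : H (u n).
  by elim: n => [|n IH] /=; [exact: (sub0 hH)|apply: (subD hH) => //; exact: zAH].
have du n : N (u n.+1 - u n) <= N h * cmod z ^+ n.
  elim: n => [|n IH] /=.
    rewrite subr0 expr0 mulr1; have -> : zA 0 = 0.
      by rewrite -(subrr (0 : V)) -zAB ?subrr//; exact: (sub0 hH).
    by rewrite addr0.
  have -> : h + zA (u n.+1) - (h + zA (u n)) = zA (u n.+1 - u n).
    by rewrite -zAB// opprD addrACA subrr add0r.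
  apply: le_trans (NzA _) _; first exact: (subB hH).
  by rewrite exprS mulrCA ler_wpM2l ?cmod_ge0.
pose q := cmod z; have q0 : 0 <= q by exact: cmod_ge0.
have q1 : 1 - q != 0 by rewrite gt_eqF// subr_gt0.
have hb n : N h * q ^+ n = N h * (1 - q ^+ n.+1) / (1 - q) - N h * (1 - q ^+ n) / (1 - q).
  by rewrite exprS; field.
(* The majorant is the closed form of the partial sums of the geometric series [N h * q ^+ k]. *)
have [||l hl cl] := ip_complete_incr hH (b := fun n => N h * (1 - q ^+ n) / (1 - q))
    (M := N h / (1 - q)) hu.
- by move=> n; rewrite -hb.
- move=> n; rewrite ler_pM2r ?invr_gt0 ?subr_gt0//.
  by rewrite ler_piMr ?ipn_ge0// gerBl exprn_ge0.
exists l => //; have hl2 : H (h + zA l) by apply: (subD hH) => //; exact: zAH.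
suff e : l = h + zA l by rewrite {1}e addrK.
apply: (ip_limit_unique hH (fun n => hu n.+1)) => //.
  by move: cl; rewrite -(cvg_shiftS (fun n => N (u n - l))).
apply: squeeze0 cl => n; rewrite ipn_ge0/=.
have -> : h + zA (u n) - (h + zA l) = zA (u n - l) by rewrite -zAB// opprD addrACA subrr add0r.
apply: le_trans (NzA _) _; first exact: (subB hH).
by rewrite ler_piMl ?ipn_ge0// ltW.
Qed.

End Neumann.

(** * Hilbert spaces given as types, and the Riesz representation theorem *)

Section HilbertTypeTheory.
Variables (R : realType) (X : hilbertType R).
Implicit Types (x y : X) (a : R[i]).

Lemma inner_lin a x y z : inner (a *: x + y) z = a * inner x z + inner y z :> R[i].
Proof. by rewrite linearPl. Qed.

Lemma inner_conj x y : inner y x = (inner x y)^* :> R[i].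
Proof. by rewrite hermC expr0 mul1r. Qed.

Lemma normE_hnorm x : `|x| = (hnorm x)%:C :> R[i].
Proof.
have [r r0 E] : exists2 r : R, 0 <= r & `|x| = r%:C.
  have := normr_ge0 x; case: `|x| => u v; rewrite lecE /= => /andP[/eqP-> u0].
  by exists u.
by rewrite E /hnorm /ipnorm inner_norm E -rmorphXn /= sqrtr_sqr ger0_norm.
Qed.

Lemma cvg_hnorm (u : nat -> X) (l : X) :
  (u @ \oo --> l) <-> ((fun n => hnorm (u n - l)) @ \oo --> (0 : R)).
Proof.
split=> [/cvgrPdist_lt h|/cvgrPdist_lt h].
  apply/cvgrPdist_lt => e e0.
  have e0' : 0 < e%:C by rewrite ltcR.
  near=> n; rewrite sub0r normrN ger0_norm ?sqrtr_ge0//.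
  rewrite -ltcR -normE_hnorm distrC; near: n.
  exact: h.
apply/cvgrPdist_lt => e e0; have [r r0 E] : exists2 r : R, 0 < r & e = r%:C.
  move: e0; case: e => a b; rewrite ltcE /= => /andP[/eqP-> a0]; by exists a.
near=> n; rewrite distrC normE_hnorm E ltcR.
have : `|0 - hnorm (u n - l)| < r by near: n; exact: h.
by rewrite sub0r normrN ger0_norm ?sqrtr_ge0.
Unshelve. all: by end_near. Qed.

Lemma hilbert_onT : hilbert_on setT (@inner R X).
Proof.
split => //.
- by move=> a x y z _ _ _; exact: inner_lin.
- by move=> x y _ _; exact: inner_conj.
- by move=> x _ x0; rewrite inner_norm exprn_gt0// normr_gt0.
- move=> u _ hC.
  have : cvgn u.
    apply/cauchy_cvgP; apply: cauchy_exP => e e0.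
    have [r r0 E] : exists2 r : R, 0 < r & e = r%:C.
      by move: e0; case: e => a b; rewrite ltcE /= => /andP[/eqP-> a0]; exists a.
    have [K hK] := hC r r0; exists (u K); exists K => // n /= Kn.
    by rewrite -ball_normE /= E normE_hnorm ltcR; exact: hK.
  by move=> cu; exists (limn u) => //; apply/cvg_hnorm.
Qed.

Let hX := hilbert_onT.
Local Notation ip := (@inner R X).

Lemma inDl x y z : ip (x + y) z = ip x z + ip y z. Proof. exact: (ipDl hX). Qed.
Lemma inBl x y z : ip (x - y) z = ip x z - ip y z. Proof. exact: (ipBl hX). Qed.
Lemma inZl a x z : ip (a *: x) z = a * ip x z. Proof. exact: (ipZl hX). Qed.
Lemma inNl x z : ip (- x) z = - ip x z. Proof. exact: (ipNl hX). Qed.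
Lemma in0l z : ip 0 z = 0. Proof. exact: (ip0l hX). Qed.
Lemma inDr x y z : ip z (x + y) = ip z x + ip z y. Proof. exact: (ipDr hX). Qed.
Lemma inBr x y z : ip z (x - y) = ip z x - ip z y. Proof. exact: (ipBr hX). Qed.
Lemma inZr a x z : ip z (a *: x) = a^* * ip z x. Proof. exact: (ipZr hX). Qed.
Lemma inNr x z : ip z (- x) = - ip z x. Proof. exact: (ipNr hX). Qed.
Lemma in0r z : ip z 0 = 0. Proof. exact: (ip0r hX). Qed.
Lemma in_self x : ip x x = (hnorm x ^+ 2)%:C. Proof. exact: (ip_self hX). Qed.
Lemma hn_ge0 x : 0 <= hnorm x. Proof. exact: ipn_ge0. Qed.
Lemma hn0 : hnorm (0 : X) = 0. Proof. exact: (ipn0 hX). Qed.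
Lemma hn_eq0 x : hnorm x = 0 -> x = 0. Proof. exact: (ipn_eq0 hX). Qed.
Lemma hnZ a x : hnorm (a *: x) = cmod a * hnorm x. Proof. exact: (ipnZ hX). Qed.
Lemma hnN x : hnorm (- x) = hnorm x. Proof. exact: (ipnN hX). Qed.
Lemma hn_distC x y : hnorm (x - y) = hnorm (y - x). Proof. exact: (ipn_distC hX). Qed.
Lemma hnD x y : hnorm (x + y) <= hnorm x + hnorm y. Proof. exact: (ipnD hX). Qed.
Lemma hnB x y : hnorm (x - y) <= hnorm x + hnorm y. Proof. exact: (ipnB hX). Qed.
Lemma hn_dist x y : hnorm x <= hnorm y + hnorm (x - y). Proof. exact: (ipn_dist hX). Qed.
Lemma in_CS x y : cmod (ip x y) <= hnorm x * hnorm y. Proof. exact: (ip_CS hX). Qed.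

Lemma hn2D x y :
  hnorm (x + y) ^+ 2 = hnorm x ^+ 2 + hnorm y ^+ 2 + 2 * complex.Re (ip x y).
Proof. exact: (ipn2D hX). Qed.

Lemma hn2B x y :
  hnorm (x - y) ^+ 2 = hnorm x ^+ 2 + hnorm y ^+ 2 - 2 * complex.Re (ip x y).
Proof. exact: (ipn2B hX). Qed.

Lemma hn_sum (r : seq nat) (F : nat -> X) :
  hnorm (\sum_(i <- r) F i) <= \sum_(i <- r) hnorm (F i).
Proof. exact: (ipn_sum hX). Qed.

Lemma in_suml (I : Type) (r : seq I) (P : pred I) (F : I -> X) y :
  ip (\sum_(i <- r | P i) F i) y = \sum_(i <- r | P i) ip (F i) y.
Proof. by apply: (big_morph (fun x => ip x y)) => [u v|]; rewrite ?inDl ?in0l. Qed.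

Lemma in_sumr (I : Type) (r : seq I) (P : pred I) (F : I -> X) y :
  ip y (\sum_(i <- r | P i) F i) = \sum_(i <- r | P i) ip y (F i).
Proof. by apply: (big_morph (ip y)) => [u v|]; rewrite ?inDr ?in0r. Qed.

Lemma in_ext x y : (forall z, ip z x = ip z y) -> x = y.
Proof.
move=> h; apply/eqP; rewrite -subr_eq0; apply/eqP; apply: hn_eq0.
apply/eqP; rewrite -sqrf_eq0; apply/eqP; apply: complexI.
by rewrite -in_self inBr h subrr.
Qed.

(* Minimize [|x|^2 - 2 Re phi x]: by the parallelogram law a minimizing
   sequence converges, and its limit represents [phi]. *)
Lemma riesz (phi : X -> R[i]) (M : R) :
  (forall a x y, phi (a *: x + y) = a * phi x + phi y) ->
  (forall x, cmod (phi x) <= M * hnorm x) ->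
  exists g, forall x, phi x = ip x g.
Proof.
move=> phi_lin phi_bd.
have phiD x y : phi (x + y) = phi x + phi y by rewrite -[x]scale1r phi_lin mul1r scale1r.
have phi0 : phi 0 = 0.
  by have /eqP := phiD 0 0; rewrite addr0 -subr_eq subrr => /eqP.
have phiZ a x : phi (a *: x) = a * phi x by rewrite -[a *: x]addr0 phi_lin phi0 addr0.
pose J x := hnorm x ^+ 2 - 2 * complex.Re (phi x).
have J_ge x : - M ^+ 2 <= J x.
  have := sqr_ge0 (hnorm x - M).
  have := le_trans (Re_le_cmod _) (phi_bd x).
  rewrite /J; nra.
pose m := inf (range J).
have hJ : has_inf (range J).
  by split; [exists (J 0), 0|exists (- M ^+ 2) => _ [x _ <-]].
have m_le x : m <= J x by apply: (@ge_inf _ (range J)); [case: hJ|exists x].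
have [u hu] : exists u : nat -> X, forall n, J (u n) < m + n.+1%:R^-1.
  suff /choice [u hu] : forall n, exists x, J x < m + n.+1%:R^-1 by exists u.
  move=> n; have [|_ [x _ <-] hx] := @inf_adherent _ (range J) n.+1%:R^-1 _ hJ.
    by rewrite invr_gt0.
  by exists x.
have para x y : hnorm (x - y) ^+ 2 <= 2 * (J x - m) + 2 * (J y - m).
  have := m_le ((2^-1)%:C *: (x + y)).
  rewrite /J hnZ phiZ ReZ cmodR ger0_norm ?invr_ge0// exprMn hn2B hn2D phiD ReD.
  lra.
have Cu e : 0 < e -> exists K, forall m n, (K <= m)%N -> (K <= n)%N ->
    hnorm (u m - u n) < e.
  move=> e0; have e4 : 0 < e ^+ 2 / 4 by rewrite divr_gt0// exprn_gt0.
  have [K hK] := ltr_add_invr e4.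
  exists K => i j Ki Kj; rewrite -(@ltr_pXn2r _ 2) ?nnegrE ?hn_ge0 ?ltW//.
  apply: le_lt_trans (para _ _) _.
  have small k : (K <= k)%N -> J (u k) - m < e ^+ 2 / 4.
    move=> Kk; have := hu k.
    have : k.+1%:R^-1 <= K.+1%:R^-1 :> R by rewrite lef_pV2 ?posrE// ler_nat.
    move: hK; rewrite add0r; set p := k.+1%:R^-1; set q := K.+1%:R^-1; move: p q (J (u k)).
    by move=> p q t; lra.
  by have := small i Ki; have := small j Kj; lra.
have [l _ cl] : exists2 l : X, setT l & (fun n => hnorm (u n - l)) @ \oo --> (0 : R).
  by case: hX => _ _ _ _; apply.
exists l => x.
(* From [m <= J (u n + y)] as [n] grows. The left side is real-linear and the right side quadratic
   in [y], so small rotated multiples of [x] force the functional to vanish. *)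
have var y : 2 * complex.Re (phi y - ip y l) <= hnorm y ^+ 2.
  have step n : 2 * complex.Re (phi y - ip y l)
      <= hnorm y ^+ 2 + (2 * (hnorm (u n - l) * hnorm y) + n.+1%:R^-1).
    rewrite (ReB (phi y)); have := m_le (u n + y); rewrite /J hn2D phiD ReD.
    have := hu n; rewrite /J; set p := n.+1%:R^-1; move: p => p.
    have := le_trans (Re_le_cmod _) (in_CS (u n - l) y).
    have -> : complex.Re (ip y l) = complex.Re (ip l y) by rewrite (inner_conj l y) ReJ.
    rewrite inBl ReB.
    lra.
  have lim : (fun n => hnorm y ^+ 2 + (2 * (hnorm (u n - l) * hnorm y) + n.+1%:R^-1))
      @ \oo --> hnorm y ^+ 2 + (2 * (0 * hnorm y) + 0).
    apply: cvgD; first exact: cvg_cst.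
    apply: cvgD; last exact: cvg_harmonic.
    by apply: cvgMr; apply: cvgMl.
  rewrite mul0r mulr0 !addr0 in lim.
  by apply: (cvgr_to_ge lim); near=> n; exact: step.
apply/eqP; rewrite -subr_eq0 -cmod_eq0.
have [b b1 bE] := cmod_rot (phi x - ip x l).
set c := cmod _ in bE *.
have c0 : 0 <= c by exact: cmod_ge0.
(* Almost the optimal multiple [c / |x|^2]; the added 1 avoids a case distinction on [x = 0]. *)
pose t := c / (hnorm x ^+ 2 + 1).
have d0 : 0 < hnorm x ^+ 2 + 1 by rewrite ltr_pwDr// sqr_ge0.
have := var (t%:C *: (b *: x)).
rewrite !hnZ cmodR b1 mul1r phiZ phiZ !inZl -!mulrBr bE -rmorphM /= exprMn real_normK ?num_real//.
have -> : hnorm x ^+ 2 = (hnorm x ^+ 2 + 1) - 1 by ring.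
rewrite /t; move: (hnorm x ^+ 2 + 1) d0 => d d0 h.
have : c ^+ 2 * (d + 1) / d ^+ 2 <= 0.
  rewrite -subr_ge0 in h; rewrite -oppr_ge0; apply: le_trans h _.
  by apply: le_of_eq; field; rewrite gt_eqF.
rewrite -mulrA pmulr_lle0 ?divr_gt0 ?exprn_gt0 ?addr_gt0// => h2.
by rewrite -sqrf_eq0 eq_le h2 sqr_ge0.
Unshelve. all: by end_near. Qed.

End HilbertTypeTheory.

(** * Everywhere defined linear maps *)

Section LinearMaps.
Variables (R : realType) (V W : lmodType R[i]) (A : V -> W).
Hypothesis A_lin : linear_on setT A.

Lemma linD x y : A (x + y) = A x + A y.
Proof. by rewrite -[x]scale1r A_lin// !scale1r. Qed.

Lemma lin0 : A 0 = 0.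
Proof. by have /eqP := linD 0 0; rewrite addr0 -subr_eq subrr => /eqP. Qed.

Lemma linZ a x : A (a *: x) = a *: A x.
Proof. by rewrite -[a *: x]addr0 A_lin// lin0 addr0. Qed.

Lemma linN x : A (- x) = - A x.
Proof. by rewrite -scaleN1r linZ scaleN1r. Qed.

Lemma linB x y : A (x - y) = A x - A y.
Proof. by rewrite linD linN. Qed.

Lemma lin_sum (I : Type) (r : seq I) (P : pred I) (F : I -> V) :
  A (\sum_(i <- r | P i) F i) = \sum_(i <- r | P i) A (F i).
Proof. by apply: (big_morph A linD lin0). Qed.

End LinearMaps.

(** * Adjoints of bounded operators *)

Section Adjoints.
Variables (R : realType) (U Y : hilbertType R).
Implicit Types (A : U -> Y).

Lemma contractive_hnorm A u : contractive_op A -> hnorm (A u) <= hnorm u.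
Proof. by case=> _ /(_ u); rewrite !normE_hnorm lecR. Qed.

Lemma contractive_bounded A : contractive_op A -> bounded_op A.
Proof.
by move=> hA; split; [case: hA|exists 1 => u _; rewrite mul1r; exact: contractive_hnorm].
Qed.

Lemma adjP A : bounded_op A ->
  forall u y, inner (A u) y = inner u (adj A y) :> R[i].
Proof.
move=> [A_lin [M hM]].
have /choice [B hB] : forall y, exists v, forall u, @inner R Y (A u) y = @inner R U u v.
  move=> y; apply: (@riesz _ _ _ (`|M| * hnorm y)) => [a u v|u].
    by rewrite A_lin// inner_lin.
  apply: le_trans (in_CS _ _) _; rewrite mulrAC ler_wpM2r ?hn_ge0//.
  by apply: le_trans (hM u I) _; rewrite ler_wpM2r ?hn_ge0// ler_norm.
by have := xgetPex (fun=> 0) (ex_intro _ B (fun u y => hB y u)).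
Qed.

Lemma adj_unique A B : bounded_op A ->
  (forall u y, inner (A u) y = inner u (B y) :> R[i]) -> adj A = B.
Proof.
by move=> hA hB; apply/funext => y; apply: in_ext => u; rewrite -adjP// hB.
Qed.

Lemma adjP' A : bounded_op A ->
  forall u y, inner (adj A y) u = inner y (A u) :> R[i].
Proof. by move=> hA u y; rewrite inner_conj -adjP// -inner_conj. Qed.

Lemma adj_linear A : bounded_op A -> linear_on setT (adj A).
Proof.
move=> hA a x y _ _; apply: in_ext => u.
by rewrite inDr inZr -!adjP// inDr inZr.
Qed.

Lemma adj_bound A M : bounded_op A -> 0 <= M -> (forall u, hnorm (A u) <= M * hnorm u) ->
  forall y, hnorm (adj A y) <= M * hnorm y.
Proof.
move=> hA M0 hM y; have [->|n0] := eqVneq (hnorm (adj A y)) 0.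
  by rewrite mulr_ge0 ?hn_ge0.
have n1 : 0 < hnorm (adj A y) by rewrite lt_def n0 hn_ge0.
rewrite -(ler_pM2l n1) -expr2.
have -> : hnorm (adj A y) ^+ 2 = complex.Re (@inner R Y (A (adj A y)) y).
  by rewrite adjP// in_self.
apply: le_trans (Re_le_cmod _) (le_trans (in_CS _ _) _).
by rewrite mulrA ler_wpM2r ?hn_ge0// mulrC.
Qed.

Lemma adj_contr A y : contractive_op A -> hnorm (adj A y) <= hnorm y.
Proof.
move=> hA; rewrite -[leRHS]mul1r; apply: adj_bound => //.
  exact: contractive_bounded.
by move=> u; rewrite mul1r contractive_hnorm.
Qed.

Lemma adj_bounded A : bounded_op A -> bounded_op (adj A).
Proof.
move=> hA; split; first exact: adj_linear.
case: (hA) => _ [M hM]; exists `|M| => y _; apply: adj_bound => // u.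
by apply: le_trans (hM u I) _; rewrite ler_wpM2r ?hn_ge0// ler_norm.
Qed.

End Adjoints.

Lemma adjK (R : realType) (U Y : hilbertType R) (A : U -> Y) :
  bounded_op A -> adj (adj A) = A.
Proof.
by move=> hA; apply: adj_unique; [exact: adj_bounded|move=> u y; exact: adjP'].
Qed.

(** * The Hilbert direct sum of the two coefficient spaces *)

Section DirectSum.
Variables (R : realType) (U Y : hilbertType R).
Local Notation ip := (dsum_ip (@inner R Y) (@inner R U)).

Lemma dsum_hnorm (p : Y * U) :
  ipnorm ip p = Num.sqrt (hnorm p.1 ^+ 2 + hnorm p.2 ^+ 2).
Proof. by rewrite /ipnorm /dsum_ip !in_self -rmorphD. Qed.

Lemma hnorm_fst_le (p : Y * U) : hnorm p.1 <= ipnorm ip p.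
Proof.
rewrite dsum_hnorm -[leLHS]ger0_norm ?hn_ge0// -sqrtr_sqr ler_sqrt ?lerDl ?sqr_ge0//.
by rewrite addr_ge0 ?sqr_ge0.
Qed.

Lemma hnorm_snd_le (p : Y * U) : hnorm p.2 <= ipnorm ip p.
Proof.
rewrite dsum_hnorm -[leLHS]ger0_norm ?hn_ge0// -sqrtr_sqr ler_sqrt ?lerDr ?sqr_ge0//.
by rewrite addr_ge0 ?sqr_ge0.
Qed.

Lemma dsum_le (p : Y * U) : ipnorm ip p <= hnorm p.1 + hnorm p.2.
Proof.
rewrite dsum_hnorm -[leRHS]ger0_norm ?addr_ge0 ?hn_ge0// -sqrtr_sqr.
rewrite ler_sqrt ?sqr_ge0// sqrrD.
have := mulr_ge0 (hn_ge0 p.1) (hn_ge0 p.2); lra.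
Qed.

Lemma dsum_hilbert : hilbert_on setT ip.
Proof.
split => //.
- by move=> a x y z _ _ _; rewrite /dsum_ip /= !inner_lin; ring.
- by move=> x y _ _; rewrite /dsum_ip rmorphD /= -!inner_conj.
- move=> [y u] _; rewrite -pair_eqE /= negb_and /dsum_ip /= !in_self -rmorphD /= ltcR.
  have h (X : hilbertType R) (x : X) : x != 0 -> 0 < hnorm x ^+ 2.
    move=> x0; rewrite exprn_gt0// lt_def hn_ge0 andbT.
    by apply: contra x0 => /eqP /hn_eq0 ->.
  by case/orP => /h h1; [rewrite ltr_pwDl// sqr_ge0|rewrite ltr_wpDl// sqr_ge0].
- move=> u _ hC.
  have [l _ cl] : exists2 l : Y, setT l & (fun n => hnorm ((u n).1 - l)) @ \oo --> (0 : R).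
    case: (hilbert_onT Y) => _ _ _ _; apply => // e /hC[K hK]; exists K => m n Km Kn.
    exact: le_lt_trans (hnorm_fst_le (u m - u n)) (hK m n Km Kn).
  have [l' _ cl'] : exists2 l : U, setT l & (fun n => hnorm ((u n).2 - l)) @ \oo --> (0 : R).
    case: (hilbert_onT U) => _ _ _ _; apply => // e /hC[K hK]; exists K => m n Km Kn.
    exact: le_lt_trans (hnorm_snd_le (u m - u n)) (hK m n Km Kn).
  exists (l, l') => //.
  apply: squeeze0 (cvg0D cl cl') => n.
  by rewrite sqrtr_ge0/=; exact: (dsum_le (u n - (l, l'))).
Qed.

End DirectSum.

(** * Vector-valued power series: growth of coefficients and Lipschitz bounds *)

Section PowerSeries.
Variables (R : realType) (X : hilbertType R).
Implicit Types (f g : disk R -> X) (a b : nat -> X) (z w : disk R).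

Definition psum a (z : R[i]) n : X := \sum_(k < n) z ^+ k *: a k.

Lemma has_taylorP f a : has_taylor f a <->
  forall z, (fun n => hnorm (psum a z n - f z)) @ \oo --> (0 : R).
Proof.
have E z : series (fun k => (z : R[i]) ^+ k *: a k) = psum a z.
  by apply/funext => n; rewrite /series /= big_mkord.
by split=> h z; move: (h z); rewrite E => /cvg_hnorm.
Qed.

Lemma disk_cmod z : cmod z < 1.
Proof. by rewrite -ltcR -cmodE disk_valP. Qed.

Lemma psumS a (z : R[i]) n : psum a z n.+1 = a 0%N + z *: psum (fun k => a k.+1) z n.
Proof.
rewrite /psum big_ord_recl expr0 scale1r scaler_sumr; congr (_ + _).
by apply: eq_bigr => i _; rewrite exprS scalerA.
Qed.

Lemma psum0 a n : psum a 0 n.+1 = a 0%N.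
Proof. by rewrite psumS scale0r addr0. Qed.

Lemma taylor_at0 f a : has_taylor f a -> f (disk0 R) = a 0%N.
Proof.
move/has_taylorP => /(_ (disk0 R)); rewrite -cvg_shiftS => h.
apply/esym/eqP; rewrite -subr_eq0; apply/eqP; apply: hn_eq0.
apply/eqP; rewrite eq_le hn_ge0 andbT.
by apply: (cvgr_to_ge h); near=> n; rewrite /= psum0.
Unshelve. all: by end_near. Qed.

Lemma bounded_of_eventually (b : nat -> R) (M : R) (K : nat) :
  (forall n, 0 <= b n) -> (forall n, (K <= n)%N -> b n <= M) ->
  exists2 c, 0 <= c & forall n, b n <= c.
Proof.
move=> b0 hM; exists (`|M| + \sum_(k < K) b k).
  by rewrite addr_ge0// sumr_ge0.
move=> n; have [Kn|nK] := leqP K n.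
  apply: le_trans (hM n Kn) (le_trans (ler_norm _) _).
  by rewrite lerDl sumr_ge0.
apply: (@le_trans _ _ (\sum_(k < K) b k)); last by rewrite lerDr.
by rewrite (bigD1 (Ordinal nK))//= lerDl sumr_ge0.
Qed.

Lemma cvg0_near (b : nat -> R) e : b @ \oo --> (0 : R) -> 0 < e ->
  exists K, forall n, (K <= n)%N -> b n < e.
Proof.
move=> /cvgrPdist_lt h e0; have [K _ hK] := h _ e0; exists K => n /hK.
by rewrite sub0r normrN /=; exact/le_lt_trans/ler_norm.
Qed.

Lemma taylor_geo_bound f a (r : R) : has_taylor f a -> 0 <= r < 1 ->
  exists2 c, 0 <= c & forall k, hnorm (a k) * r ^+ k <= c.
Proof.
move=> /has_taylorP hf /andP[r0 r1].
have zP : `|r%:C| < 1 by rewrite cmodE cmodR ltcR ger0_norm.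
have [K hK] := cvg0_near (hf (Disk zP)) ltr01.
(* From [K] on the partial sums are within 1 of the limit, so two consecutive ones differ by at most
   2. *)
apply: (@bounded_of_eventually _ 2 K) => [n|n Kn].
  by rewrite mulr_ge0 ?hn_ge0 ?exprn_ge0.
have -> : hnorm (a n) * r ^+ n = hnorm (psum a r%:C n.+1 - psum a r%:C n).
  rewrite {1}/psum big_ord_recr /= addrAC subrr add0r hnZ cmodX cmodR.
  by rewrite ger0_norm// mulrC.
rewrite -(subrKA (f (Disk zP))); apply: le_trans (hnD _ _) _.
rewrite [hnorm (f _ - _)]hn_distC.
have := hK n.+1 (leq_trans Kn (leqnSn n)); have := hK n Kn; rewrite /=; lra.
Qed.

(** Multiplied by [(1 - q) ^+ 2], the sum becomes 1 minus a nonnegative remainder. *)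
Lemma sum_succ_geo (q : R) n : 0 <= q < 1 ->
  \sum_(k < n) k.+1%:R * q ^+ k <= (1 - q) ^- 2.
Proof.
move=> /andP[q0 q1]; have d0 : 0 < (1 - q) ^+ 2 by rewrite exprn_gt0// subr_gt0.
rewrite -(ler_pM2r d0) mulVf ?gt_eqF//.
have -> : (\sum_(k < n) k.+1%:R * q ^+ k) * (1 - q) ^+ 2
    = 1 - (n.+1%:R * q ^+ n - n%:R * q ^+ n.+1).
  elim: n => [|n IH]; first by rewrite big_ord0 expr0 mul0r; ring.
  by rewrite big_ord_recr /= mulrDl IH !exprS -!natr1; ring.
rewrite gerBl subr_ge0; apply: ler_pM; rewrite ?mulr_ge0 ?exprn_ge0 ?ler_nat//.
by rewrite exprS ler_piMl ?exprn_ge0// ltW.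
Qed.

Lemma cmod_subXX_le (z w : R[i]) (r : R) n : cmod z <= r -> cmod w <= r ->
  cmod (z ^+ n.+1 - w ^+ n.+1) <= cmod (z - w) * (n.+1%:R * r ^+ n).
Proof.
move=> hz hw; rewrite subrXX cmodM ler_wpM2l ?cmod_ge0//.
have h (I : Type) (s : seq I) (F : I -> R[i]) (G : I -> R) :
    (forall i, cmod (F i) <= G i) -> cmod (\sum_(i <- s) F i) <= \sum_(i <- s) G i.
  move=> hF; elim: s => [|i s IH]; first by rewrite !big_nil cmod0.
  by rewrite !big_cons; apply: le_trans (cmod_le_add _ _) (lerD _ _).
have -> : n.+1%:R * r ^+ n = \sum_(i < n.+1) r ^+ n.
  by rewrite sumr_const card_ord mulr_natl.
apply: h => i; rewrite cmodM !cmodX -[X in r ^+ X](subnK (_ : i <= n)%N); last first.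
  by rewrite -ltnS.
by rewrite exprD /= ?subn1; apply: ler_pM; rewrite ?exprn_ge0 ?cmod_ge0// lerXn2r ?nnegrE ?cmod_ge0// (le_trans (cmod_ge0 z)).
Qed.

(** The coefficients decay geometrically at some radius [s > r], and the difference of the powers of
    [z] and [w] costs only a factor linear in the exponent. Continuity and complex differentiability
    of power series are both drawn from this estimate. *)
Lemma taylor_lipschitz f a (r : R) : has_taylor f a -> 0 <= r < 1 ->
  exists2 c, 0 <= c & forall z w, cmod z <= r -> cmod w <= r ->
    hnorm (f z - f w) <= c * cmod ((z : R[i]) - (w : R[i])).
Proof.
move=> hf /andP[r0 r1].
have [s rs s_lt1] : exists2 s : R, r < s & s < 1 by exists ((1 + r) / 2); lra.
have s0 : 0 < s by exact: le_lt_trans rs.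
have s1 : 0 <= s < 1 by rewrite ltW.
have [c c0 hc] := taylor_geo_bound hf s1.
have q1 : 0 <= r / s < 1.
  by rewrite divr_ge0 ?(ltW s0)//= ltr_pdivrMr// mul1r.
set C := c / s * (1 - r / s) ^- 2.
have C0 : 0 <= C.
  apply: mulr_ge0; first by rewrite divr_ge0 ?(ltW s0).
  by rewrite invr_ge0 exprn_ge0// subr_ge0 ltW//; case/andP: q1.
exists C => // z w hz hw.
have part n : hnorm (psum a z n.+1 - psum a w n.+1) <= C * cmod ((z : R[i]) - (w : R[i])).
  have -> : psum a z n.+1 - psum a w n.+1
      = \sum_(0 <= i < n) ((z : R[i]) ^+ i.+1 - (w : R[i]) ^+ i.+1) *: a i.+1.
    rewrite /psum -sumrB big_ord_recl !expr0 subrr add0r big_mkord.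
    by apply: eq_bigr => i _; rewrite scalerBl.
  apply: le_trans (hn_sum _ _) _; rewrite big_mkord.
  apply: (@le_trans _ _ (\sum_(i < n) cmod ((z : R[i]) - (w : R[i])) * (c / s) * (i.+1%:R * (r / s) ^+ i))).
    apply: ler_sum => i _; rewrite hnZ.
    apply: (@le_trans _ _ (cmod ((z : R[i]) - (w : R[i])) * (i.+1%:R * r ^+ i) * (c / s ^+ i.+1))).
      apply: ler_pM; rewrite ?cmod_ge0 ?hn_ge0 ?cmod_subXX_le//.
      by rewrite ler_pdivlMr ?exprn_gt0// hc.
    apply: le_of_eq.
    rewrite exprS [(r / s) ^+ i]expr_div_n.
    by rewrite invfM; ring.
  rewrite -mulr_sumr /C [leRHS]mulrAC [c / s * cmod _]mulrC.
  apply: ler_wpM2l; last exact: sum_succ_geo.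
  by rewrite mulr_ge0 ?cmod_ge0 ?divr_ge0 ?(ltW s0).
have : (fun n => C * cmod ((z : R[i]) - (w : R[i])) + (hnorm (psum a z n - f z) + hnorm (psum a w n - f w)))
    @ \oo --> C * cmod ((z : R[i]) - (w : R[i])) + (0 + 0).
  apply: cvgD; first exact: cvg_cst.
  by move/has_taylorP : hf => hf; apply: cvgD.
rewrite !addr0 => lim; apply: (cvgr_to_ge lim); near=> n.
have n0 : (0 < n)%N by near: n; exists 1%N.
rewrite -(prednK n0); set m := n.-1.
have -> : f z - f w = (psum a z m.+1 - psum a w m.+1) - ((psum a z m.+1 - f z) - (psum a w m.+1 - f w)).
  by rewrite !opprB addrA subrKA addrC subrKA.
apply: le_trans (hnB _ _) _; apply: lerD; first exact: part.
exact: hnB.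
Unshelve. all: by end_near. Qed.

End PowerSeries.

(** * Uniqueness and calculus of Taylor coefficients; difference quotients *)

Section TaylorCoefficients.
Variables (R : realType) (X : hilbertType R).
Implicit Types (f g : disk R -> X) (a b : nat -> X) (z w : disk R).

Lemma real_disk (t : R) : 0 <= t < 1 -> exists z : disk R, (z : R[i]) = t%:C.
Proof.
move=> /andP[t0 t1]; have zP : `|t%:C| < 1 by rewrite cmodE cmodR ltcR ger0_norm.
by exists (Disk zP).
Qed.

Lemma taylor_shift f a : has_taylor f a ->
  exists2 g, has_taylor g (fun k => a k.+1) & forall z, f z = a 0%N + (z : R[i]) *: g z.
Proof.
move=> hf; pose g z := if (z : R[i]) == 0 then a 1%N else (z : R[i])^-1 *: (f z - a 0%N).
exists g => [|z]; last first.
  rewrite /g; case: eqP => [z0|/eqP z0].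
    have -> : z = disk0 R by apply: val_inj.
    by rewrite /= scale0r addr0 (taylor_at0 hf).
  by rewrite scalerA divff// scale1r addrC subrK.
apply/has_taylorP => z; move/has_taylorP : hf => /(_ z); rewrite -cvg_shiftS => h.
rewrite /g; case: eqP => [->|/eqP z0].
  rewrite -cvg_shiftS; under eq_fun do rewrite /= psum0 subrr hn0.
  exact: cvg_cst.
have -> : (fun n => hnorm (psum (fun k => a k.+1) z n - (z : R[i])^-1 *: (f z - a 0%N)))
   = (fun n => (cmod z)^-1 * hnorm (psum a z n.+1 - f z)).
  apply/funext => n; rewrite psumS -cmodV -hnZ; congr hnorm.
  rewrite -[psum _ _ _ in LHS]scale1r -(mulVf z0) -scalerA -scalerBr; congr (_ *: _).
  by rewrite opprB addrCA addrA.
exact: cvg0Ml.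
Qed.

(** Lipschitz continuity along [w + e] with [e] real and small. This recovers the value at the one
    point that division by [z] leaves undetermined. *)
Lemma analytic_eq_at f g w : analytic f -> analytic g ->
  (forall z, (z : R[i]) != (w : R[i]) -> f z = g z) -> f w = g w.
Proof.
move=> [a hf] [b hg] fg.
have w1 := disk_cmod w; have w0 := cmod_ge0 (w : R[i]).
pose r := (1 + cmod w) / 2.
have r1 : 0 <= r < 1 by rewrite /r; lra.
have [c c0 hc] := taylor_lipschitz hf r1; have [d d0 hd] := taylor_lipschitz hg r1.
apply/eqP; rewrite -subr_eq0; apply/eqP; apply: hn_eq0.
have key (e : R) : 0 < e -> e <= r - cmod w -> hnorm (f w - g w) <= (c + d) * e.
  move=> e0 er; have er1 : cmod ((w : R[i]) + e%:C) <= r.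
    by apply: le_trans (cmod_le_add _ _) _; rewrite cmodR gtr0_norm//; lra.
  have zP : `|(w : R[i]) + e%:C| < 1.
    by rewrite cmodE ltcR; apply: le_lt_trans er1 _; case/andP: r1.
  have wr : cmod w <= r by rewrite /r; lra.
  have zw : (Disk zP : R[i]) - (w : R[i]) = e%:C by rewrite /= addrC addKr.
  have zw' : (w : R[i]) - (Disk zP : R[i]) = - e%:C by rewrite /= opprD addNKr.
  have zneq : (Disk zP : R[i]) != (w : R[i]) by rewrite -subr_eq0 zw -cmod_eq0 cmodR normr_eq0 gt_eqF.
  have := hc w (Disk zP) wr er1; have := hd (Disk zP) w er1 wr.
  rewrite zw zw' cmodN cmodR gtr0_norm// (fg (Disk zP) zneq) => h1 h2.
  rewrite -(subrKA (g (Disk zP))); apply: le_trans (hnD _ _) _.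
  rewrite mulrDl; exact: lerD.
apply/eqP; rewrite eq_le hn_ge0 andbT; apply/ler_addgt0Pl => e e0; rewrite addr0.
pose t := Num.min (r - cmod w) (e / (c + d + 1)).
have cd : 0 < c + d + 1 by rewrite ltr_wpDl// addr_ge0.
have t0 : 0 < t by rewrite lt_min divr_gt0// andbT /r; lra.
have tr : t <= r - cmod w by rewrite ge_min lexx.
apply: le_trans (key t t0 tr) _.
have : t * (c + d + 1) <= e by rewrite -ler_pdivlMr// ge_min lexx orbT.
nra.
Qed.

(** Compare the values at 0, divide the remainders by [z], and induct on the index. *)
Lemma taylor_unique f a b : has_taylor f a -> has_taylor f b -> a = b.
Proof.
move=> hfa hfb; apply/funext => n; elim: n f a b hfa hfb => [|n IH] f a b hfa hfb.
  by rewrite -(taylor_at0 hfa) -(taylor_at0 hfb).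
have [g hg fg] := taylor_shift hfa; have [k hk fk] := taylor_shift hfb.
have gk z : (z : R[i]) != 0 -> g z = k z.
  move=> z0; apply: (scalerI z0); apply: (addrI (a 0%N)); rewrite -fg fk.
  by rewrite -(taylor_at0 hfa) -(taylor_at0 hfb).
have E : g = k.
  apply/funext => z; have [z0|/gk//] := eqVneq (z : R[i]) 0.
  have -> : z = disk0 R by apply: val_inj.
  by apply: analytic_eq_at => //; [exists (fun k => a k.+1)|exists (fun k => b k.+1)].
by apply: (IH g (fun k => a k.+1) (fun k => b k.+1)) => //; rewrite E.
Qed.

Lemma taylorE f a : has_taylor f a -> taylor f = a.
Proof.
move=> hf; have h : has_taylor f (taylor f).
  exact: (@xgetPex _ (fun=> 0) [set a | has_taylor f a] (ex_intro _ a hf)).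
exact: taylor_unique h hf.
Qed.

Lemma analytic_taylor f : analytic f -> has_taylor f (taylor f).
Proof. by case=> a hf; rewrite (taylorE hf). Qed.

Lemma taylor_inj f g a : has_taylor f a -> has_taylor g a -> f = g.
Proof.
move=> /has_taylorP hf /has_taylorP hg; apply/funext => z.
exact: (ip_limit_unique (hilbert_onT X) _ _ _ (hf z) (hg z)).
Qed.

Lemma has_taylorD f g a b : has_taylor f a -> has_taylor g b ->
  has_taylor (fun z => f z + g z) (fun k => a k + b k).
Proof.
move=> /has_taylorP hf /has_taylorP hg; apply/has_taylorP => z.
apply: squeeze0 (cvg0D (hf z) (hg z)) => n; rewrite hn_ge0/=; apply: le_trans (hnD _ _).
rewrite addrACA -opprD /psum -big_split /=.
by under eq_bigr do rewrite scalerDr.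
Qed.

Lemma has_taylorZ c f a : has_taylor f a ->
  has_taylor (fun z => c *: f z) (fun k => c *: a k).
Proof.
move=> /has_taylorP hf; apply/has_taylorP => z.
have -> : (fun n => hnorm (psum (fun k => c *: a k) z n - c *: f z))
    = (fun n => cmod c * hnorm (psum a z n - f z)).
  apply/funext => n; rewrite -hnZ scalerBr scaler_sumr; congr (hnorm (_ - _)).
  by apply: eq_bigr => i _; rewrite !scalerA mulrC.
exact: cvg0Ml.
Qed.

Lemma has_taylorB f g a b : has_taylor f a -> has_taylor g b ->
  has_taylor (fun z => f z - g z) (fun k => a k - b k).
Proof.
move=> hf hg; have := has_taylorD hf (@has_taylorZ (-1) _ _ hg).
rewrite (_ : (fun z => _) = fun z => f z - g z); last first.
  by apply/funext => z; rewrite scaleN1r.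
by rewrite (_ : (fun k => _) = fun k => a k - b k)//; apply/funext => z; rewrite scaleN1r.
Qed.

Definition shiftup a k : X := if k is k'.+1 then a k' else 0.

Lemma has_taylor_mulz f a : has_taylor f a ->
  has_taylor (fun z => (z : R[i]) *: f z) (shiftup a).
Proof.
move=> /has_taylorP hf; apply/has_taylorP => z; rewrite -cvg_shiftS.
have -> : (fun n => hnorm (psum (shiftup a) z n.+1 - (z : R[i]) *: f z))
    = (fun n => cmod z * hnorm (psum a z n - f z)).
  by apply/funext => n; rewrite psumS /= add0r -scalerBr hnZ.
exact: cvg0Ml.
Qed.

Lemma has_taylor_poly a N : (forall k, (N <= k)%N -> a k = 0) ->
  has_taylor (fun z => psum a z N) a.
Proof.
move=> a0; apply/has_taylorP => z; rewrite -(cvg_shiftn N).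
under eq_fun => n.
  rewrite /psum -(big_mkord xpredT (fun k => (z : R[i]) ^+ k *: a k)).
  rewrite (@big_cat_nat _ _ _ N)//= ?leq_addl// big_mkord addrAC subrr add0r.
  rewrite big_nat_cond big1 ?hn0; first over.
  by move=> i /andP[/andP[Ni _] _]; rewrite a0// scaler0.
exact: cvg_cst.
Qed.

(** Off the diagonal this is a division; on it, the increment of [f] is [h] times [g (w + h)] and
    [g] is Lipschitz. An algebraic factorization thus evaluates every difference quotient without
    computing a derivative. *)
Lemma diffqE f g w : analytic g ->
  (forall z, f z - f w = ((z : R[i]) - (w : R[i])) *: g z) -> forall z, diffq f z w = g z.
Proof.
move=> [a hg] fg z; rewrite /diffq; case: eqP => [zw|/eqP zw]; last first.
  by rewrite fg scalerA mulVf ?scale1r// subr_eq0.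
have {zw} -> : z = w by apply: val_inj.
have w1 := disk_cmod w; have w0 := cmod_ge0 (w : R[i]).
pose r := (1 + cmod w) / 2.
have r1 : 0 <= r < 1 by rewrite /r; lra.
have [c c0 hc] := taylor_lipschitz hg r1.
rewrite /disk_derive /derive; apply/cvg_lim => //.
apply/cvgrPdist_lt => e e0.
have [d d0 E] : exists2 d : R, 0 < d & e = d%:C.
  by move: e0; case: e => x y; rewrite ltcE /= => /andP[/eqP-> x0]; exists x.
pose t := Num.min (r - cmod w) (d / (c + 1)).
have c1 : 0 < c + 1 by rewrite ltr_wpDl.
have t0 : 0 < t by rewrite lt_min divr_gt0// andbT /r; lra.
near=> h.
have h0 : h != 0 :> R[i] by near: h; exact: nbhs_dnbhs_neq.
have ht : `|h : R[i]| < t%:C by near: h; apply: dnbhs0_lt; rewrite ltcR.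
rewrite cmodE ltcR in ht.
have hr : cmod ((h : R[i]) + (w : R[i])) <= r.
  apply: le_trans (cmod_le_add _ _) _; have : t <= r - cmod w by rewrite ge_min lexx.
  lra.
have zP : `|(h : R[i]) + (w : R[i])| < 1.
  by rewrite cmodE ltcR; apply: le_lt_trans hr _; case/andP: r1.
have -> : (extend0 f \o shift (w : R[i]^o)) (h *: (1 : R[i]^o)) = f (Disk zP).
  rewrite /= /extend0 [h *: _]mulr1.
  by rewrite (insubT (fun x : R[i] => `|x| < 1) zP).
have -> : extend0 f (w : R[i]) = f w by rewrite /extend0 valK.
rewrite fg /= addrK scalerA mulVf// scale1r normE_hnorm E ltcR.
have wr : cmod w <= r by rewrite /r; lra.
apply: le_lt_trans (hc w (Disk zP) wr hr) _; rewrite /= opprD addrCA subrr addr0 cmodN.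
have : t * (c + 1) <= d by rewrite -ler_pdivlMr// ge_min lexx orbT.
have := cmod_ge0 h; nra.
Unshelve. all: by end_near. Qed.

Lemma diffq0_taylor f a : has_taylor f a ->
  has_taylor (fun z => diffq f z (disk0 R)) (fun k => a k.+1).
Proof.
move=> hf; have [g hg fg] := taylor_shift hf.
have -> : (fun z => diffq f z (disk0 R)) = g; last by [].
apply/funext; apply: diffqE; first by exists (fun k => a k.+1).
by move=> z; rewrite !fg /= scale0r addr0 subr0 addrC addKr.
Qed.

Lemma diffq0_mulz f z : analytic f -> (z : R[i]) *: diffq f z (disk0 R) = f z - f (disk0 R).
Proof.
move=> [a hf]; have [g hg fg] := taylor_shift hf.
have -> : diffq f z (disk0 R) = g z.
  apply: diffqE; first by exists (fun k => a k.+1).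
  by move=> w; rewrite !fg /= scale0r addr0 subr0 addrC addKr.
by rewrite !fg /= scale0r addr0 addrC addKr.
Qed.

End TaylorCoefficients.

Arguments has_taylorZ {R X} c [f a].

(** * Operator-valued power series and their action on vector-valued ones *)

Section OperatorSeries.
Variables (R : realType) (U Y : hilbertType R).
Implicit Types (z : disk R) (u : U).

Lemma geo_sum_le (q : R) n : 0 <= q < 1 -> \sum_(k < n) q ^+ k <= (1 - q)^-1.
Proof.
move=> /andP[q0 q1]; have d0 : 0 < 1 - q by rewrite subr_gt0.
rewrite -[leRHS]mul1r ler_pdivlMr// mulrC -opprB mulNr -subrX1 opprB.
by rewrite gerBl exprn_ge0.
Qed.

Lemma cvg_natM_geo (q : R) : 0 <= q < 1 -> (fun n => n%:R * q ^+ n) @ \oo --> (0 : R).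
Proof.
move=> /andP[q0 q1].
have [s qs s_lt1] : exists2 s : R, q < s & s < 1 by exists ((1 + q) / 2); lra.
have s0 : 0 < s by exact: le_lt_trans qs.
have t1 : 0 <= q / s < 1 by rewrite divr_ge0 ?(ltW s0)//= ltr_pdivrMr// mul1r.
apply: (squeeze0 (v := fun n => (1 - q / s) ^- 2 * s ^+ n)) => [n|].
- rewrite mulr_ge0 ?exprn_ge0//=.
  have -> : q ^+ n = (q / s) ^+ n * s ^+ n by rewrite -exprMn divfK// gt_eqF.
  rewrite mulrA ler_wpM2r ?exprn_ge0 ?(ltW s0)//.
  apply: le_trans (sum_succ_geo n.+1 t1); rewrite big_ord_recr /=.
  have t0 : 0 <= q / s by case/andP: t1.
  rewrite -[leLHS]add0r lerD ?sumr_ge0// => [i _|]; first by rewrite mulr_ge0 ?exprn_ge0.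
  by rewrite ler_wpM2r ?exprn_ge0// ler_nat.
- by apply: cvg0Ml; apply: cvg_expr; rewrite ger0_norm// ltW.
Qed.

Variables (S : disk R -> U -> Y) (Sn : nat -> U -> Y).
Hypothesis Sn_bd : forall n, bounded_op (Sn n).
Hypothesis S_sum : forall z (e : R), 0 < e -> \forall n \near \oo, forall u,
    hnorm (S z u - \sum_(k < n) (z : R[i]) ^+ k *: Sn k u) <= e * hnorm u.

Lemma op_taylor u : has_taylor (fun z => S z u) (fun k => Sn k u).
Proof.
apply/has_taylorP => z; apply/cvgrPdist_lt => e e0.
have d0 : 0 < hnorm u + 1 by rewrite ltr_wpDl ?hn_ge0.
have h := S_sum z (divr_gt0 e0 d0).
near=> n; rewrite sub0r normrN ger0_norm ?hn_ge0// hn_distC.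
have /le_lt_trans : hnorm (S z u - psum (fun k => Sn k u) z n) <= e / (hnorm u + 1) * hnorm u.
  by near: n; apply: filterS h => n.
by apply; rewrite mulrAC ltr_pdivrMr// ltr_pM2l// ltrDl.
Unshelve. all: by end_near. Qed.

(** Convergence in operator norm bounds the late terms by [2 * hnorm u] uniformly in [u]; each of
    the finitely many early coefficients is bounded by assumption. *)
Lemma op_geo_bound (r : R) : 0 <= r < 1 ->
  exists2 c, 0 <= c & forall k u, hnorm (Sn k u) * r ^+ k <= c * hnorm u.
Proof.
move=> r01; have [z zr] := real_disk r01; case/andP: r01 => r0 r1.
have [K _ hK] := S_sum z ltr01.
have /choice[M hM] : forall n, exists M, forall u, hnorm (Sn n u) <= M * hnorm u.
  by move=> n; case: (Sn_bd n) => _ [M hM]; exists M => u; exact: hM.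
pose b k := if (k < K)%N then `|M k| * r ^+ k else 2.
have [||c c0 hc] := @bounded_of_eventually R b 2 K.
- by move=> n; rewrite /b; case: ifP => // _; rewrite mulr_ge0 ?exprn_ge0.
- by move=> n Kn; rewrite /b ltnNge Kn.
exists c => // k u; apply: le_trans (_ : b k * hnorm u <= _); last first.
  by rewrite ler_wpM2r ?hn_ge0.
rewrite /b; case: ltnP => kK.
  rewrite mulrAC ler_wpM2r ?exprn_ge0//.
  by apply: le_trans (hM k u) _; rewrite ler_wpM2r ?hn_ge0// ler_norm.
have := hK k kK u; have := hK k.+1 (leq_trans kK (leqnSn k)) u.
rewrite big_ord_recr /= !mul1r; set P := \sum_(_ < _) _ => h1 h2.
have -> : hnorm (Sn k u) * r ^+ k = hnorm ((S z u - P) - (S z u - (P + (z : R[i]) ^+ k *: Sn k u))).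
  rewrite opprB addrC subrKA addrAC subrr add0r hnZ cmodX zr cmodR.
  by rewrite ger0_norm// mulrC.
by apply: le_trans (hnB _ _) _; rewrite mulrDl mul1r lerD.
Qed.

Definition op_psum (z : R[i]) m u : Y := \sum_(i < m) z ^+ i *: Sn i u.

Lemma op_tail (r : R) : 0 <= r < 1 ->
  exists c q : R, [/\ 0 <= c, 0 <= q < 1 & forall z, cmod z <= r ->
    forall m u, hnorm (S z u - op_psum z m u) <= c * q ^+ m * hnorm u].
Proof.
move=> /andP[r0 r1].
have [s rs s_lt1] : exists2 s : R, r < s & s < 1 by exists ((1 + r) / 2); lra.
have s0 : 0 < s by exact: le_lt_trans rs.
have s1 : 0 <= s < 1 by rewrite ltW.
have [c c0 hc] := op_geo_bound s1.
have q1 : 0 <= r / s < 1 by rewrite divr_ge0 ?(ltW s0)//= ltr_pdivrMr// mul1r.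
have q0 : 0 <= r / s by case/andP: q1.
exists (c / (1 - r / s)), (r / s); split=> // [|z zr m u].
  by rewrite divr_ge0// subr_ge0 ltW//; case/andP: q1.
have term k : hnorm ((z : R[i]) ^+ k *: Sn k u) <= c * hnorm u * (r / s) ^+ k.
  rewrite hnZ cmodX expr_div_n mulrA ler_pdivlMr ?exprn_gt0// -[leLHS]mulrA [leLHS]mulrC.
  by apply: ler_pM; rewrite ?mulr_ge0 ?hn_ge0 ?exprn_ge0 ?cmod_ge0 ?(ltW s0)// lerXn2r ?nnegrE ?cmod_ge0.
have part n : hnorm (op_psum z (m + n) u - op_psum z m u) <= c / (1 - r / s) * (r / s) ^+ m * hnorm u.
  rewrite /op_psum big_split_ord /= addrAC subrr add0r.
  rewrite -(big_mkord xpredT (fun i => (z : R[i]) ^+ (m + i) *: Sn (m + i) u)).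
  apply: le_trans (hn_sum _ _) _; rewrite big_mkord.
  apply: (@le_trans _ _ (\sum_(i < n) c * hnorm u * (r / s) ^+ m * (r / s) ^+ i)).
    by apply: ler_sum => i _; apply: le_trans (term _) _; rewrite exprD mulrA.
  have -> : c / (1 - r / s) * (r / s) ^+ m * hnorm u
      = c * hnorm u * (r / s) ^+ m * (1 - r / s)^-1 by ring.
  rewrite -mulr_sumr; apply: ler_wpM2l; last exact: geo_sum_le.
  by rewrite !mulr_ge0 ?hn_ge0 ?exprn_ge0.
have lim := (has_taylorP _ _).1 (@op_taylor u) z.
have lim' : (fun n => c / (1 - r / s) * (r / s) ^+ m * hnorm u + hnorm (psum (fun k => Sn k u) z n - S z u))
    @ \oo --> c / (1 - r / s) * (r / s) ^+ m * hnorm u + 0 by apply: cvgD; [exact: cvg_cst|].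
rewrite addr0 in lim'; apply: (cvgr_to_ge lim'); near=> n.
have mn : (m <= n)%N by near: n; exists m.
rewrite [leRHS]addrC [hnorm (psum _ _ _ - _)]hn_distC -(subrKA (psum (fun k => Sn k u) z n)).
apply: le_trans (hnD _ _) _; rewrite lerD2l.
by have := part (n - m)%N; rewrite subnKC.
Unshelve. all: by end_near. Qed.

Definition conv (a : nat -> U) n : Y := \sum_(j < n.+1) Sn (n - j) (a j).

(** The Cauchy product summed by input index: each input term meets a partial sum of [S] of
    complementary length, which [op_tail] compares with [S] itself. *)
Lemma psum_conv (a : nat -> U) (z : R[i]) n :
  psum (conv a) z n = \sum_(j < n) z ^+ j *: op_psum z (n - j) (a j).
Proof.
elim: n => [|n IH]; first by rewrite /psum !big_ord0.
rewrite /psum big_ord_recr /= -/(psum _ _ _) IH.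
have -> : \sum_(j < n) z ^+ j *: op_psum z (n - j) (a j)
    = \sum_(j < n.+1) z ^+ j *: op_psum z (n - j) (a j).
  by rewrite big_ord_recr /= subnn /op_psum big_ord0 scaler0 addr0.
rewrite /conv scaler_sumr -big_split /=; apply: eq_bigr => j _.
have jn : (j <= n)%N by rewrite -ltnS.
rewrite subSn// /op_psum big_ord_recr /= scalerDr; congr (_ + _).
by rewrite scalerA -exprD subnKC.
Qed.

Hypothesis S_contr : forall z, contractive_op (S z).

Let S_lin z : linear_on setT (S z). Proof. by case: (S_contr z). Qed.

(** Each of the [n] error terms is at most a constant times [Q ^+ n], whence a bound of order
    [n * Q ^+ n]. It is uniform on the disk of radius [r], so it can be averaged over arbitrarily
    many points. *)
Lemma conv_tail (r c1 q1 : R) (a : nat -> U) : 0 <= r < 1 -> 0 <= c1 -> 0 <= q1 < 1 ->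
  (forall j, hnorm (a j) * r ^+ j <= c1 * q1 ^+ j) ->
  exists2 d : nat -> R, d @ \oo --> (0 : R) & forall z, cmod z <= r ->
    forall n, hnorm (psum (conv a) z n - S z (psum a z n)) <= d n.
Proof.
move=> r01 c10 q101 ha; have [c [q [c0 q01 hc]]] := op_tail r01.
pose Q := Num.max q q1.
have Q0 : 0 <= Q by rewrite le_max; case/andP: q01 => ->.
have Q1 : 0 <= Q < 1 by rewrite Q0 /= gt_max; case/andP: q01 => _ ->; case/andP: q101.
exists (fun n => c * c1 * (n%:R * Q ^+ n)); first by apply: cvg0Ml; exact: cvg_natM_geo.
move=> z zr n; rewrite hn_distC /psum (lin_sum (S_lin z)) -/(psum _ _ _) psum_conv -sumrB.
rewrite -(big_mkord xpredT (fun i => S z ((z : R[i]) ^+ i *: a i) - (z : R[i]) ^+ i *: op_psum z (n - i) (a i))).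
apply: le_trans (hn_sum _ _) _; rewrite big_mkord.
have -> : c * c1 * (n%:R * Q ^+ n) = \sum_(i < n) c * c1 * Q ^+ n.
  by rewrite sumr_const card_ord -mulr_natl; ring.
apply: ler_sum => i _; rewrite (linZ (S_lin z)) -scalerBr hnZ cmodX.
apply: le_trans (ler_wpM2l _ (hc z zr (n - i)%N (a i))) _; first by rewrite exprn_ge0 ?cmod_ge0.
have -> : Q ^+ n = Q ^+ (n - i) * Q ^+ i by rewrite -exprD subnK// ltnW.
have h1 : hnorm (a i) * cmod z ^+ i <= c1 * Q ^+ i.
  apply: le_trans (_ : hnorm (a i) * r ^+ i <= _).
    by rewrite ler_wpM2l ?hn_ge0// lerXn2r ?nnegrE ?cmod_ge0//; case/andP: r01.
  apply: le_trans (ha i) _; rewrite ler_wpM2l// lerXn2r ?nnegrE//.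
    by case/andP: q101.
  by rewrite le_max lexx orbT.
have h2 : c * q ^+ (n - i) <= c * Q ^+ (n - i).
  rewrite ler_wpM2l// lerXn2r ?nnegrE//; first by case/andP: q01.
  by rewrite le_max lexx.
have := ler_pM _ _ h2 h1; rewrite !mulr_ge0 ?exprn_ge0 ?hn_ge0 ?cmod_ge0//; last by case/andP: q01.
move=> /(_ isT isT) h3; apply: le_trans (le_trans h3 _).
  by apply: le_of_eq; ring.
by apply: le_of_eq; ring.
Qed.

Lemma conv_taylor (g : disk R -> U) a : has_taylor g a ->
  has_taylor (fun z => S z (g z)) (conv a).
Proof.
move=> hg; apply/has_taylorP => z.
have z1 := disk_cmod z; have z0 := cmod_ge0 (z : R[i]).
pose r := cmod z; pose s := (1 + r) / 2.
have s0 : 0 < s by rewrite /s /r; lra.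
have s01 : 0 <= s < 1 by rewrite (ltW s0) /s /r; lra.
have [c c0 hc] := taylor_geo_bound hg s01.
have q01 : 0 <= r / s < 1 by rewrite divr_ge0 ?(ltW s0)//= ltr_pdivrMr// mul1r /s /r; lra.
have [||d d0 hd] := @conv_tail r c (r / s) a _ c0 q01.
- by rewrite /r z0.
- move=> j; rewrite expr_div_n mulrA ler_pdivlMr ?exprn_gt0// mulrAC.
  by rewrite ler_wpM2r// exprn_ge0.
move/has_taylorP : hg => /(_ z) hg; apply: squeeze0 (cvg0D d0 hg) => n.
rewrite hn_ge0/= -(subrKA (S z (psum a z n))).
apply: le_trans (hnD _ _) _; apply: lerD; first exact: hd.
by rewrite -(linB (S_lin z)); exact: contractive_hnorm.
Qed.

End OperatorSeries.

(** * A discrete Parseval identity over roots of unity *)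

Section RootsOfUnity.
Variable R : realType.

(** ['X^n - 1] splits with distinct roots, and [n] distinct [n]-th roots of unity include a
    primitive one. *)
Lemma prim_root_exists n : (0 < n)%N -> exists w : R[i], n.-primitive_root w.
Proof.
move=> n0; have [s Es] := closed_field_poly_normal ('X^n - 1 : {poly R[i]}).
rewrite (monicP _) ?monicXnsubC// scale1r in Es.
have us : uniq s.
  by rewrite -separable.separable_prod_XsubC -Es cyclotomic.separable_Xn_sub_1// pnatr_eq0 -lt0n.
have ns : all n.-unity_root s.
  by apply/allP => z; rewrite -root_prod_XsubC -Es.
have sn : (n <= size s)%N.
  by rewrite -ltnS -(size_prod_XsubC s id) -Es size_XnsubC.
by have /hasP[w _ hw] := cyclic.has_prim_root n0 ns us sn; exists w.
Qed.

Lemma cmod_prim_root n (w : R[i]) : n.-primitive_root w -> cmod w = 1.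
Proof.
move=> hw; have n0 := prim_order_gt0 hw.
have /eqP : cmod w ^+ n = 1 by rewrite -cmodX prim_expr_order// cmod1.
by rewrite pexpr_eq1 ?cmod_ge0// => /eqP.
Qed.

Lemma prim_root_orthogonal K (w : R[i]) (n m : nat) : K.-primitive_root w ->
  (n < K)%N -> (m < K)%N ->
  \sum_(i < K) (w ^+ i) ^+ n * ((w ^+ i) ^+ m)^* = (if n == m then K%:R else 0).
Proof.
move=> hw nK mK; pose v := w ^+ n * (w ^+ m)^*.
have wm : w ^+ m * (w ^+ m)^* = 1 by rewrite mulJ_cmod cmodX (cmod_prim_root hw) !expr1n.
have -> : \sum_(i < K) (w ^+ i) ^+ n * ((w ^+ i) ^+ m)^* = \sum_(i < K) v ^+ i.
  by apply: eq_bigr => i _; rewrite /v exprMn -rmorphXn /= -!exprM mulnC [(i * m)%N]mulnC.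
case: eqP => [nm|/eqP nm].
  by rewrite /v nm wm; under eq_bigr do rewrite expr1n; rewrite sumr_const card_ord.
have v1 : v != 1.
  apply: contra nm => /eqP v1; have : w ^+ n == w ^+ m.
    by rewrite -[w ^+ n]mulr1 -wm mulrCA -/v v1 mulr1.
  by rewrite (eq_prim_root_expr hw) !modn_small.
apply: (mulfI (_ : v - 1 != 0)); first by rewrite subr_eq0.
rewrite -subrX1 mulr0 /v exprMn -rmorphXn /= -!exprM mulnC exprM [(m * K)%N]mulnC exprM.
by rewrite (prim_expr_order hw) !expr1n rmorph1 mulr1 subrr.
Qed.

(** Replaces integration over the circle of radius [r]: averaging over [K] nodes is exact for
    polynomials with at most [K] coefficients. *)
Lemma parseval_roots (X : hilbertType R) (c : nat -> X) (r : R) (K N : nat) (w : R[i]) :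
  K.-primitive_root w -> (N <= K)%N ->
  \sum_(i < K) hnorm (psum c (r%:C * w ^+ i) N) ^+ 2
    = K%:R * \sum_(n < N) r ^+ n ^+ 2 * hnorm (c n) ^+ 2.
Proof.
move=> hw NK; apply: complexI; rewrite rmorph_sum rmorphM rmorph_nat /=.
have -> : \sum_(i < K) (hnorm (psum c (r%:C * w ^+ i) N) ^+ 2)%:C
    = \sum_(n < N) \sum_(m < N) (r%:C ^+ n * (r%:C ^+ m)^* * inner (c n) (c m)) *
        (\sum_(i < K) (w ^+ i) ^+ n * ((w ^+ i) ^+ m)^*).
  under [in RHS]eq_bigr => n _ do under eq_bigr => m _ do rewrite mulr_sumr.
  under [in RHS]eq_bigr => n _ do rewrite exchange_big /=.
  rewrite exchange_big /=; apply: eq_bigr => i _.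
  rewrite -in_self {1}/psum in_suml; apply: eq_bigr => n _.
  rewrite inZl in_sumr mulr_sumr; apply: eq_bigr => m _.
  by rewrite inZr !exprMn rmorphM /=; ring.
rewrite rmorph_sum /= mulr_sumr; apply: eq_bigr => n _.
have nK : (n < K)%N := leq_trans (ltn_ord n) NK.
rewrite (bigD1 n)//= (prim_root_orthogonal hw nK nK) eqxx big1 ?addr0; last first.
  move=> m mn; have mK : (m < K)%N := leq_trans (ltn_ord m) NK.
  rewrite (prim_root_orthogonal hw nK mK) eq_sym; case: eqP => [/val_inj mn'|]; last by rewrite mulr0.
  by rewrite mn' eqxx in mn.
rewrite in_self -rmorphXn /= conjRC mulrC; congr (_ * _).
by rewrite -!rmorphM /= expr2.
Qed.

End RootsOfUnity.

(** * The truncated Toeplitz operators of a Schur function are contractions *)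

Section SchurCoefficients.
Variables (R : realType) (U Y : hilbertType R).
Variables (S : disk R -> U -> Y) (Sn : nat -> U -> Y).
Hypothesis Sn_bd : forall n, bounded_op (Sn n).
Hypothesis S_sum : forall (z : disk R) (e : R), 0 < e -> \forall n \near \oo, forall u,
    hnorm (S z u - \sum_(k < n) (z : R[i]) ^+ k *: Sn k u) <= e * hnorm u.
Hypothesis S_contr : forall z, contractive_op (S z).

(* Average [|S p|^2 <= |p|^2] over roots of unity on circles of radius [r < 1],
   for a polynomial [p], and let [r] tend to [1]. *)
Lemma conv_contraction (u : nat -> U) N :
  \sum_(n < N) hnorm (conv Sn u n) ^+ 2 <= \sum_(n < N) hnorm (u n) ^+ 2.
Proof.
(* Convolution is causal: truncating the input leaves the outputs before [N] unchanged and makes the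
   input function a polynomial. *)
pose a k := if (k < N)%N then u k else 0.
have conva (n : 'I_N) : conv Sn u n = conv Sn a n.
  apply: eq_bigr => j _; rewrite /a (leq_trans (ltn_ord j))//.
pose A := \sum_(n < N) hnorm (u n) ^+ 2; pose C := \sum_(n < N) hnorm (u n).
have A0 : 0 <= A by rewrite sumr_ge0// => i _; rewrite sqr_ge0.
have C0 : 0 <= C by rewrite sumr_ge0// => i _; rewrite hn_ge0.
have circle (r : R) : 0 <= r < 1 ->
    \sum_(n < N) r ^+ n ^+ 2 * hnorm (conv Sn u n) ^+ 2 <= A.
  move=> /andP[r0 r1].
  have [s rs s_lt1] : exists2 s : R, r < s & s < 1 by exists ((1 + r) / 2); lra.
  have s0 : 0 < s by exact: le_lt_trans rs.
  have q01 : 0 <= r / s < 1 by rewrite divr_ge0 ?(ltW s0)//= ltr_pdivrMr// mul1r.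
  have r01 : 0 <= r < 1 by rewrite r0.
  have [||c c0 hc] := @bounded_of_eventually R (fun j => hnorm (a j) * s ^+ j) 0 N.
  - by move=> n; rewrite mulr_ge0 ?hn_ge0 ?exprn_ge0 ?(ltW s0).
  - by move=> n Nn; rewrite /a ltnNge Nn /= hn0 mul0r.
  have [|d d0 hd] := conv_tail Sn_bd S_sum S_contr r01 c0 q01 (a := a).
    move=> j; rewrite expr_div_n mulrA ler_pdivlMr ?exprn_gt0// mulrAC.
    by rewrite ler_wpM2r// exprn_ge0.
  have e2 : (fun n => 2 * (C * d n)) @ \oo --> (0 : R) by do 2 apply: cvg0Ml.
  have ee : (fun n => d n * d n) @ \oo --> (0 * 0 : R) by exact: cvgM.
  have lim : (fun n => A + (2 * (C * d n) + d n * d n)) @ \oo --> A + (0 + 0 * 0).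
    by apply: cvgD; [exact: cvg_cst|exact: cvgD].
  rewrite mulr0 !addr0 in lim; apply: (cvgr_to_ge lim); near=> K.
  have NK : (N <= K)%N by near: K; exists N.
  have [w hw] := prim_root_exists R (ltn0Sn K).
  have Kp : 0 < K.+1%:R :> R by [].
  rewrite -(ler_pM2l Kp).
  (* With [K.+1] nodes, Parseval is exact both for the [K] output coefficients kept and for the [N]
     input coefficients. *)
  apply: (@le_trans _ _ (\sum_(i < K.+1) hnorm (psum (conv Sn a) (r%:C * w ^+ i) K) ^+ 2)).
    rewrite (parseval_roots _ _ hw)//= ler_pM2l// -(subnKC NK) big_split_ord /=.
    rewrite -[leLHS]addr0; apply: lerD; last first.
      by rewrite sumr_ge0// => i _; rewrite mulr_ge0 ?sqr_ge0.
    by apply: ler_sum => i _; rewrite conva.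
  have zP i : cmod (r%:C * w ^+ i) = r.
    by rewrite cmodM cmodX (cmod_prim_root hw) expr1n mulr1 cmodR ger0_norm.
  have step i : hnorm (psum (conv Sn a) (r%:C * w ^+ i) K) ^+ 2
      <= hnorm (psum a (r%:C * w ^+ i) N) ^+ 2 + (2 * (C * d K) + d K * d K).
    have z1 : `|r%:C * w ^+ i| < 1 by rewrite cmodE zP ltcR.
    have E : psum a (r%:C * w ^+ i) K = psum a (r%:C * w ^+ i) N.
      rewrite /psum -(subnKC NK) big_split_ord /= [X in _ + X]big1 ?addr0// => j _.
      by rewrite /a ltnNge leq_addr /= scaler0.
    have h1 := hd (Disk z1) (eq_ind_r (fun x => x <= r) (lexx r) (zP i)) K.
    have h2 := contractive_hnorm (psum a (r%:C * w ^+ i) K) (S_contr (Disk z1)).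
    have h3 := hn_dist (psum (conv Sn a) (r%:C * w ^+ i) K) (S (Disk z1) (psum a (r%:C * w ^+ i) K)).
    have h5 : hnorm (psum a (r%:C * w ^+ i) N) <= C.
      rewrite /psum -(big_mkord xpredT (fun j => (r%:C * w ^+ i) ^+ j *: a j)).
      apply: le_trans (hn_sum _ _) _; rewrite big_mkord; apply: ler_sum => j _.
      by rewrite hnZ cmodX zP /a ltn_ord ler_piMl ?hn_ge0// exprn_ile1// ltW.
    rewrite /= in h1; rewrite E in h1 h2 h3.
    have h0 := hn_ge0 (psum (conv Sn a) (r%:C * w ^+ i) K).
    have h0' := hn_ge0 (psum a (r%:C * w ^+ i) N).
    have eK : 0 <= d K by exact: le_trans (hn_ge0 _) h1.
    have h6 : hnorm (psum (conv Sn a) (r%:C * w ^+ i) K) <= hnorm (psum a (r%:C * w ^+ i) N) + d K by lra.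
    apply: (@le_trans _ _ ((hnorm (psum a (r%:C * w ^+ i) N) + d K) ^+ 2)).
      by rewrite lerXn2r// nnegrE addr_ge0.
    rewrite sqrrD expr2; nra.
  apply: (@le_trans _ _ (\sum_(i < K.+1) (hnorm (psum a (r%:C * w ^+ i) N) ^+ 2 + (2 * (C * d K) + d K * d K)))).
    by apply: ler_sum => i _; exact: step.
  rewrite big_split /= sumr_const card_ord -[_ *+ _]mulr_natl (parseval_roots _ _ hw) ?(leqW NK)//.
  rewrite [leRHS]mulrDr lerD2r ler_pM2l//; apply: ler_sum => j _.
  by rewrite /a ltn_ord ler_piMl ?sqr_ge0// -exprM exprn_ile1// ltW.
pose X := \sum_(k < N) hnorm (conv Sn u k) ^+ 2.
have E : (fun n => (1 - n.+1%:R^-1 : R)) @ \oo --> (1 - 0 : R).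
  by apply: cvgB; [exact: cvg_cst|exact: cvg_harmonic].
(* All weights [r ^+ k ^+ 2] with [k < N] are at least [r ^+ (N * 2)], so a single power of the
   radius has to tend to 1. *)
have lim : (fun n => (1 - n.+1%:R^-1) ^+ (N * 2) * X) @ \oo --> (1 - 0) ^+ (N * 2) * X.
  by apply: cvgMl; apply: (continuous_cvg _ (@exprn_continuous R (N * 2) (1 - 0)) E).
rewrite subr0 expr1n mul1r in lim; apply: (cvgr_to_le lim); near=> n.
have r0 : 0 <= 1 - n.+1%:R^-1 :> R by rewrite subr_ge0 invf_le1// ler1n.
have r1 : 1 - n.+1%:R^-1 < 1 :> R by rewrite gtrBl invr_gt0.
apply: le_trans (circle (1 - n.+1%:R^-1) _); last by rewrite r0.
rewrite /X mulr_sumr; apply: ler_sum => k _; rewrite -exprM ler_wpM2r ?sqr_ge0//.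
by rewrite ler_wiXn2l ?(ltW r1)// leq_mul2r ltnW ?orbT.
Unshelve. all: by end_near. Qed.

(** An input concentrated at index 0 has [Sn k u] as its [k]-th output. *)
Lemma schur_coef_contr k : contractive_op (Sn k).
Proof.
split; first by case: (Sn_bd k).
move=> u; rewrite !normE_hnorm lecR.
rewrite -(@ler_pXn2r _ 2) ?nnegrE ?hn_ge0//.
have := conv_contraction (fun j => if j == 0%N then u else 0) k.+1.
have -> : \sum_(n < k.+1) hnorm (if (n : nat) == 0%N then u else 0) ^+ 2 = hnorm u ^+ 2.
  by rewrite big_ord_recl big1 ?addr0// => i _; rewrite /= hn0 expr0n.
apply: le_trans; rewrite big_ord_recr /= -[leLHS]add0r lerD//.
  by rewrite sumr_ge0// => i _; rewrite sqr_ge0.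
rewrite /conv big_ord_recl /= subn0 big1 ?addr0// => i _.
by rewrite (lin0 (proj1 (Sn_bd _))).
Qed.

End SchurCoefficients.

(** * Polarization of functions of a unimodular scalar *)

Section Polarization.
Variable R : realType.
Implicit Types (F G : R[i] -> R) (c : R[i]).

(** Meant for [F c] of the form [|x + c y|^2]. Taking an arbitrary [F] allows identities between
    squared norms to be polarized before an inner product is available. *)
Definition polar F : R[i] := 4^-1 * \sum_(j < 4) 'i ^+ j * (F ('i ^+ j))%:C.

Lemma polarE F : polar F = 4^-1 * ((F 1 - F (-1))%:C + 'i * (F 'i - F (- 'i))%:C).
Proof.
rewrite /polar !big_ord_recl big_ord0 /= /bump /= !addn0 !add1n.
rewrite expr0 expr1 sqrCi (_ : 'i ^+ 3 = - 'i); last by rewrite exprS sqrCi mulrN1.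
by rewrite !rmorphB /=; congr (_ * _); ring.
Qed.

Lemma polarD F G : polar (fun c => F c + G c) = polar F + polar G.
Proof. by rewrite !polarE !rmorphB !rmorphD /=; ring. Qed.

Lemma polar_cst (x : R) : polar (fun=> x) = 0.
Proof. by rewrite polarE !subrr mulr0 addr0 mulr0. Qed.

Lemma polar_lin a : polar (fun c => 2 * complex.Re (c^* * a)) = a.
Proof.
have E1 : (1 : R[i])^* * a = a by rewrite rmorph1 mul1r.
have E2 : (-1 : R[i])^* * a = - a by rewrite rmorphN rmorph1 mulN1r.
have E3 : ('i : R[i])^* * a = - 'i * a by rewrite conjCi.
have E4 : (- 'i : R[i])^* * a = - (- 'i * a) by rewrite rmorphN /= conjCi mulNr.
rewrite [RHS]complex_ReIm polarE E1 E2 E3 E4 !ReN.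
move: (complex.Re a) (complex.Re (- 'i * a)) => x y.
have -> : 2 * x - 2 * - x = 4 * x by ring.
have -> : 2 * y - 2 * - y = 4 * y by ring.
rewrite !rmorphM /= rmorph_nat mulrCA -mulrDr mulrA mulVf ?mul1r// pnatr_eq0//.
Qed.

Lemma eq_polar F G : (forall c, cmod c = 1 -> F c = G c) -> polar F = polar G.
Proof.
by move=> h; rewrite !polarE !h ?cmodN ?cmod_i ?cmod1.
Qed.

Lemma polar_conj F : polar (fun c => F c^*) = (polar F)^*.
Proof.
have E (x y : R) : (4^-1 * (x%:C + 'i * y%:C))^* = 4^-1 * (x%:C - 'i * y%:C) :> R[i].
  by rewrite rmorphM fmorphV rmorph_nat rmorphD rmorphM /= !conjRC conjCi mulNr.
have E2 : (-1 : R[i])^* = -1 by rewrite rmorphN rmorph1.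
have E4 : (- 'i : R[i])^* = 'i by rewrite rmorphN /= conjCi opprK.
rewrite !polarE E rmorph1 E2 conjCi E4 -mulrN.
by rewrite -[F (- _) - F _]opprB rmorphN.
Qed.

Lemma cmod_polar_le F (M : R) :
  `|F 1 - F (-1)| <= 2 * M -> `|F 'i - F (- 'i)| <= 2 * M -> cmod (polar F) <= M.
Proof.
move=> h1 h2; rewrite polarE cmodM cmodV.
have -> : cmod (4 : R[i]) = 4.
  by rewrite -(rmorph_nat (real_complex R)) /= cmodR ger0_norm.
rewrite mulrC ler_pdivrMr//; apply: le_trans (cmod_le_add _ _) _.
by rewrite cmodM cmod_i mul1r !cmodR; lra.
Qed.

End Polarization.

(** * The Hilbert space defined by the dual norm of a nonnegative hermitian form *)

Section DualForm.
Variables (R : realType) (Z : lmodType R[i]) (V : Type).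
Variables (pr : Z -> V -> R[i]) (Pi : V -> Z) (vlin : R[i] -> V -> V -> V) (v0 : V).
Hypothesis pr_lin : forall a x y v, pr (a *: x + y) v = a * pr x v + pr y v.
Hypothesis pr_vlin : forall z a v w, pr z (vlin a v w) = a^* * pr z v + pr z w.
Hypothesis Pi_vlin : forall a v w, Pi (vlin a v w) = a *: Pi v + Pi w.
Hypothesis pr_v0 : forall z, pr z v0 = 0.
Hypothesis Pi_v0 : Pi v0 = 0.
Hypothesis pr_herm : forall v w, pr (Pi w) v = (pr (Pi v) w)^*.
Hypothesis pr_pos : forall v, 0 <= complex.Re (pr (Pi v) v).
Hypothesis pr_sep : forall z, (forall v, pr z v = 0) -> z = 0.
Implicit Types (x y z : Z) (v w : V) (a c : R[i]).

Definition dform v := complex.Re (pr (Pi v) v).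
Definition dquad z v := 2 * complex.Re (pr z v) - dform v.
Definition dspace : set Z := [set z | exists M : R, forall v, dquad z v <= M].
Definition denergy z : R := sup (range (dquad z)).
Definition dip x y : R[i] := polar (fun c => denergy (x + c *: y)).
Definition dnorm z : R := Num.sqrt (denergy z).

Let pr0 v : pr 0 v = 0.
Proof.
have := pr_lin 1 0 0 v; rewrite scale1r addr0 mul1r => /eqP.
by rewrite -subr_eq subrr => /eqP.
Qed.

Let prZ a z v : pr (a *: z) v = a * pr z v.
Proof. by rewrite -[a *: z]addr0 pr_lin pr0 addr0. Qed.

Let prD x y v : pr (x + y) v = pr x v + pr y v.
Proof. by rewrite -[x]scale1r pr_lin mul1r scale1r. Qed.

Let vscale a v := vlin a v v0.

Let pr_vscale z a v : pr z (vscale a v) = a^* * pr z v.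
Proof. by rewrite pr_vlin pr_v0 addr0. Qed.

Let Pi_vscale a v : Pi (vscale a v) = a *: Pi v.
Proof. by rewrite Pi_vlin Pi_v0 addr0. Qed.

Let dform_vscale a v : dform (vscale a v) = cmod a ^+ 2 * dform v.
Proof. by rewrite /dform Pi_vscale pr_vscale prZ mulrA [_^* * a]mulrC mulJ_cmod ReZ. Qed.

Lemma dquad_le z v : dspace z -> dquad z v <= denergy z.
Proof.
by move=> [M hM]; apply: ub_le_sup; [exists M => _ [w _ <-]|exists v].
Qed.

Lemma denergy_le z (M : R) : (forall v, dquad z v <= M) -> denergy z <= M.
Proof. by move=> hM; apply: ge_sup => [|_ [v _ <-]//]; exists (dquad z v0), v0. Qed.

Let dform0 : dform v0 = 0.
Proof. by rewrite /dform pr_v0. Qed.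

Lemma denergy_ge0 z : dspace z -> 0 <= denergy z.
Proof.
move=> hz; apply: le_trans (dquad_le v0 hz).
by rewrite /dquad dform0 pr_v0 subr0 mulr0.
Qed.

(** Completing the square: by hermitian symmetry the new cross terms are those of [dform] at
    [v - w], so only the test vector gets translated. *)
Lemma dquad_addPi z v w :
  dquad (z + Pi w) v = dquad z (vlin (-1) w v) + (2 * complex.Re (pr z w) + dform w).
Proof.
rewrite /dquad /dform Pi_vlin !pr_vlin pr_lin prD pr_lin rmorphN rmorph1.
rewrite (pr_herm w v) !mulN1r !ReD !ReN !ReD !ReN ReJ; ring.
Qed.

Lemma dspace_addPi z w : dspace z -> dspace (z + Pi w).
Proof.
by move=> [M hM]; exists (M + (2 * complex.Re (pr z w) + dform w)) => v; rewrite dquad_addPi lerD2r.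
Qed.

Lemma denergy_addPi z w : dspace z ->
  denergy (z + Pi w) = denergy z + (2 * complex.Re (pr z w) + dform w).
Proof.
have le x u : dspace x -> denergy (x + Pi u) <= denergy x + (2 * complex.Re (pr x u) + dform u).
  by move=> hx; apply: denergy_le => v; rewrite dquad_addPi lerD2r dquad_le.
move=> hz; apply/eqP; rewrite eq_le le//=.
(* The reverse inequality is the same bound with [-w], started from [z + Pi w]. *)
have := le _ (vscale (-1) w) (dspace_addPi w hz).
rewrite Pi_vscale scaleN1r addrK dform_vscale pr_vscale cmodN cmod1 expr1n mul1r.
rewrite rmorphN rmorph1 mulN1r ReN prD ReD -/(dform w); lra.
Qed.

Let dquadZ a z v : a != 0 -> dquad (a *: z) v = cmod a ^+ 2 * dquad z (vscale a^-1 v).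
Proof.
move=> a0; have ca : cmod a != 0 by rewrite cmod_eq0.
have E : complex.Re (a * pr z v) = cmod a ^+ 2 * complex.Re (a^-1^* * pr z v).
  by rewrite -ReZ -mulJ_cmod fmorphV -mulrA [a^* * _]mulrA divff ?mul1r// conjC_eq0.
by rewrite /dquad dform_vscale pr_vscale prZ cmodV E; field.
Qed.

Lemma dspaceZ a z : dspace z -> dspace (a *: z).
Proof.
move=> [M hM]; have [->|a0] := eqVneq a 0.
  by exists 0 => v; rewrite scale0r /dquad pr0 mulr0 sub0r oppr_le0 pr_pos.
by exists (cmod a ^+ 2 * M) => v; rewrite dquadZ// ler_wpM2l ?sqr_ge0.
Qed.

Lemma dspace0 : dspace 0.
Proof. by exists 0 => v; rewrite /dquad pr0 mulr0 sub0r oppr_le0 pr_pos. Qed.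

Lemma denergy0 : denergy 0 = 0.
Proof.
apply/eqP; rewrite eq_le denergy_ge0 ?andbT; last exact: dspace0.
by apply: denergy_le => v; rewrite /dquad pr0 mulr0 sub0r oppr_le0 pr_pos.
Qed.

Lemma denergyZ a z : dspace z -> denergy (a *: z) = cmod a ^+ 2 * denergy z.
Proof.
have [->|a0 hz] := eqVneq a 0; first by rewrite scale0r denergy0 cmod0 expr0n mul0r.
have le b x : b != 0 -> dspace x -> denergy (b *: x) <= cmod b ^+ 2 * denergy x.
  by move=> b0 hx; apply: denergy_le => v; rewrite dquadZ// ler_wpM2l ?sqr_ge0// dquad_le.
apply/eqP; rewrite eq_le le//=.
have := le _ _ (invr_neq0 a0) (dspaceZ a hz).
rewrite scalerA mulVf// scale1r cmodV exprVn ler_pdivlMl//.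
by rewrite exprn_gt0// cmod_gt0.
Qed.

(** The triangle inequality of the dual norm: [dform v] is shared between [x] and [y] in the ratio
    [p : q]. The weights divide by [p] and [q], which must therefore be strictly larger than 0;
    hence the added 1 or [e / 2] where this is applied. *)
Let dquadD x y v (p q : R) : 0 < p -> 0 < q -> dspace x -> dspace y ->
  denergy x <= p ^+ 2 -> denergy y <= q ^+ 2 -> dquad (x + y) v <= (p + q) ^+ 2.
Proof.
move=> p0 q0 hx hy hp hq; have pq : 0 < p + q by rewrite addr_gt0.
have split_le z (t : R) : 0 < t -> dspace z ->
    2 * complex.Re (pr z v) - t * dform v <= t^-1 * denergy z.
  move=> t0 hz; rewrite -(ler_pM2l t0) mulrA divff ?gt_eqF// mul1r.
  apply: le_trans (dquad_le (vscale t%:C v) hz).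
  rewrite /dquad dform_vscale pr_vscale conjRC ReZ cmodR gtr0_norm//.
  by apply: le_of_eq; ring.
have hx' := split_le x (p / (p + q)) (divr_gt0 p0 pq) hx.
have hy' := split_le y (q / (p + q)) (divr_gt0 q0 pq) hy.
have -> : dquad (x + y) v = (2 * complex.Re (pr x v) - p / (p + q) * dform v)
    + (2 * complex.Re (pr y v) - q / (p + q) * dform v).
  by rewrite /dquad prD ReD; field; rewrite gt_eqF.
apply: le_trans (lerD hx' hy') _; rewrite !invf_div.
have hx2 : (p + q) / p * denergy x <= (p + q) / p * p ^+ 2 by rewrite ler_pM2l// divr_gt0.
have hy2 : (p + q) / q * denergy y <= (p + q) / q * q ^+ 2 by rewrite ler_pM2l// divr_gt0.
apply: le_trans (lerD hx2 hy2) _; apply: le_of_eq.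
by field; rewrite !gt_eqF.
Qed.

Let dnorm2 z : dspace z -> dnorm z ^+ 2 = denergy z.
Proof. by move=> hz; rewrite sqr_sqrtr// denergy_ge0. Qed.

Let dnorm_lt z (e : R) : 0 < e -> dspace z -> denergy z <= (dnorm z + e) ^+ 2.
Proof.
move=> e0 hz; rewrite -dnorm2// lerXn2r ?nnegrE ?sqrtr_ge0 ?addr_ge0 ?sqrtr_ge0 ?ltW//.
by rewrite ltrDl.
Qed.

Lemma dspaceD x y : dspace x -> dspace y -> dspace (x + y).
Proof.
move=> hx hy; exists ((dnorm x + 1 + (dnorm y + 1)) ^+ 2) => v.
by apply: dquadD; rewrite ?dnorm_lt// ltr_wpDl ?sqrtr_ge0.
Qed.

Lemma dspaceDZ a x y : dspace x -> dspace y -> dspace (a *: x + y).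
Proof. by move=> hx hy; apply: dspaceD => //; exact: dspaceZ. Qed.

Lemma dspaceB x y : dspace x -> dspace y -> dspace (x - y).
Proof. by move=> hx hy; rewrite -scaleN1r addrC; exact: dspaceDZ. Qed.

Lemma dnormD x y : dspace x -> dspace y -> dnorm (x + y) <= dnorm x + dnorm y.
Proof.
move=> hx hy; apply/ler_addgt0Pl => e e0.
have s0 : 0 <= e + (dnorm x + dnorm y) by rewrite !addr_ge0 ?sqrtr_ge0// ltW.
rewrite -(ler_pXn2r (ltn0Sn 1)) ?nnegrE ?sqrtr_ge0// dnorm2; last exact: dspaceD.
have -> : e + (dnorm x + dnorm y) = (dnorm x + e / 2) + (dnorm y + e / 2) by field.
have e2 : 0 < e / 2 by rewrite divr_gt0.
apply: denergy_le => v; apply: dquadD; rewrite ?dnorm_lt// ltr_wpDl ?sqrtr_ge0//.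
Qed.

Let dnormZ a x : dspace x -> dnorm (a *: x) = cmod a * dnorm x.
Proof.
by move=> hx; rewrite /dnorm denergyZ// sqrtrM ?sqr_ge0// sqrtr_sqr ger0_norm ?cmod_ge0.
Qed.

(** Against [x + c r], the energy of [x + c (Pi v + r)] gains a part linear in the conjugate of [c],
    which polarizes to [pr x v], and a part constant for unimodular [c], which polarizes to 0. *)
Lemma dip_Pi_add x v r : dspace x -> dspace r -> dip x (Pi v + r) = pr x v + dip x r.
Proof.
move=> hx hr; rewrite -[in RHS](polar_lin (pr x v)) -polarD.
rewrite -[RHS]addr0 -(polar_cst (2 * complex.Re (pr r v) + dform v)) -polarD.
apply: eq_polar => c c1.
have -> : x + c *: (Pi v + r) = (c *: r + x) + Pi (vscale c v).
  by rewrite Pi_vscale scalerDr addrCA addrC; congr (_ + _); rewrite addrC.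
rewrite denergy_addPi; last exact: dspaceDZ.
rewrite dform_vscale pr_vscale c1 expr1n mul1r pr_lin mulrDr mulrA [c^* * c]mulrC.
by rewrite mulJ_cmod c1 expr1n mul1r ReD [c *: r + x]addrC; ring.
Qed.

Lemma dip_Pi x v : dspace x -> dip x (Pi v) = pr x v.
Proof.
move=> hx; rewrite -[Pi v]addr0 dip_Pi_add//; last exact: dspace0.
by rewrite /dip; under eq_fun do rewrite scaler0; rewrite polar_cst addr0.
Qed.

(** Before linearity only the triangle inequality is at hand, which explains the factor 2; any
    constant serves the density argument. *)
Lemma dip_le x r : dspace x -> dspace r -> cmod (dip x r) <= 2 * (dnorm x * dnorm r).
Proof.
move=> hx hr.
have key c : cmod c = 1 -> `|denergy (x + c *: r) - denergy (x + (- c) *: r)| <= 4 * (dnorm x * dnorm r).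
  move=> c1; have hc : dspace (c *: r) by exact: dspaceZ.
  have hN : dspace (x - c *: r) by exact: dspaceB.
  have hD : dspace (x + c *: r) by exact: dspaceD.
  have nc : dnorm (c *: r) = dnorm r by rewrite dnormZ// c1 mul1r.
  have dN z : dspace z -> dnorm (- z) = dnorm z.
    by move=> hz; rewrite -scaleN1r dnormZ// cmodN cmod1 mul1r.
  have hcN : dspace (- (c *: r)) by rewrite -scaleN1r; exact: dspaceZ.
  have hxN : dspace (- x) by rewrite -scaleN1r; exact: dspaceZ.
  have h1 := dnormD hx hc; have h2 := dnormD hx hcN.
  have h3 := dnormD hD hcN; rewrite addrK in h3.
  have h4 := dnormD hN hc; rewrite subrK in h4.
  have h5 := dnormD hD hxN; rewrite addrAC subrr add0r in h5.
  have h6 := dnormD hN hxN; rewrite addrAC subrr add0r in h6.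
  rewrite scaleNr -!dnorm2// ?dN// nc in h1 h2 h3 h4 h5 h6 *.
  have n1 : 0 <= dnorm (x + c *: r) by exact: sqrtr_ge0.
  have n2 : 0 <= dnorm (x - c *: r) by exact: sqrtr_ge0.
  move: (dnorm (x + c *: r)) (dnorm (x - c *: r)) (dnorm x) (dnorm r) h1 h2 h3 h4 h5 h6 n1 n2.
  move=> p m X s h1 h2 h3 h4 h5 h6 n1 n2.
  (* [P <= X + s] and [|X - s| <= M] bound the left side by [(X + s) ^+ 2 - (X - s) ^+ 2]. *)
  have sq (P M : R) : 0 <= P -> P <= X + s -> X <= M + s -> s <= M + X -> P ^+ 2 - M ^+ 2 <= 4 * (X * s).
    move=> P0 hP hM hM'; have p1 : P ^+ 2 <= (X + s) ^+ 2 by nra.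
    have p2 : (X - s) ^+ 2 <= M ^+ 2 by nra.
    by nra.
  by rewrite ler_norml; apply/andP; split; [rewrite lerNl opprB|]; apply: sq.
apply: cmod_polar_le; rewrite mulrA -[2 * 2]natrM.
  by apply: key; rewrite cmod1.
by apply: key; exact: cmod_i.
Qed.

(** The energy of [z - Pi v] is [denergy z - dquad z v], so a near-maximizer [v] will do. *)
Lemma Pi_dense z (e : R) : dspace z -> 0 < e -> exists v, denergy (z - Pi v) < e.
Proof.
move=> hz e0; have hs : has_sup (range (dquad z)).
  by split; [exists (dquad z v0), v0|case: (hz) => M hM; exists M => _ [v _ <-]].
have [_ [v _ <-] hv] := sup_adherent e0 hs; exists v.
have -> : z - Pi v = z + Pi (vscale (-1) v) by rewrite Pi_vscale scaleN1r.
rewrite denergy_addPi// dform_vscale pr_vscale cmodN cmod1 expr1n mul1r.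
by move: hv; rewrite rmorphN rmorph1 mulN1r ReN -/(denergy z) /dquad; lra.
Qed.

Lemma dspace_Pi v : dspace (Pi v).
Proof. by rewrite -[Pi v]add0r; apply: dspace_addPi; exact: dspace0. Qed.

(* The defect of linearity of [dip] in its first argument does not change when
   [z] is corrected by [Pi v], and these corrections can be made arbitrarily small. *)
Lemma dip_linear a x y z : dspace x -> dspace y -> dspace z ->
  dip (a *: x + y) z = a * dip x z + dip y z.
Proof.
move=> hx hy hz; have hw := dspaceDZ a hx hy.
apply/eqP; rewrite -subr_eq0 -cmod_eq0 eq_le cmod_ge0 andbT.
pose C := 2 * (dnorm (a *: x + y) + cmod a * dnorm x + dnorm y) + 1.
have C0 : 0 < C by rewrite ltr_wpDl// mulr_ge0// !addr_ge0 ?mulr_ge0 ?sqrtr_ge0 ?cmod_ge0.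
apply/ler_addgt0Pl => e e0; rewrite addr0.
have [|v hv] := Pi_dense (e := (e / C) ^+ 2) hz; first by rewrite exprn_gt0// divr_gt0.
pose r := z - Pi v; have hr : dspace r by apply: dspaceB => //; exact: dspace_Pi.
have -> : z = Pi v + r by rewrite /r addrC subrK.
rewrite !dip_Pi_add// pr_lin.
have -> : a * pr x v + pr y v + dip (a *: x + y) r - (a * (pr x v + dip x r) + (pr y v + dip y r))
   = dip (a *: x + y) r - (a * dip x r + dip y r) by ring.
have nr : dnorm r < e / C.
  by rewrite -(ltr_pXn2r (ltn0Sn 1)) ?nnegrE ?sqrtr_ge0 ?ltW ?divr_gt0// dnorm2.
apply: le_trans (cmod_le_add _ _) _; rewrite cmodN.
have l1 := dip_le hw hr; have l2 := dip_le hx hr; have l3 := dip_le hy hr.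
have l4 := cmod_le_add (a * dip x r) (dip y r); rewrite cmodM in l4.
have l5 : cmod a * cmod (dip x r) <= cmod a * (2 * (dnorm x * dnorm r)).
  by rewrite ler_wpM2l ?cmod_ge0.
have l6 : dnorm r * C <= e by rewrite -ler_pdivlMr// ltW.
apply: le_trans l6; rewrite /C.
have : 0 <= dnorm r by exact: sqrtr_ge0.
lra.
Qed.

Lemma dip_conj x y : dspace x -> dspace y -> dip y x = (dip x y)^*.
Proof.
move=> hx hy; rewrite /dip -polar_conj; apply: eq_polar => c c1.
have -> : y + c *: x = c *: (x + c^* *: y).
  by rewrite scalerDr scalerA mulJ_cmod c1 expr1n scale1r addrC.
by rewrite denergyZ ?c1 ?expr1n ?mul1r// addrC; exact: dspaceDZ.
Qed.

Lemma dip_self x : dspace x -> dip x x = (denergy x)%:C.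
Proof.
move=> hx; have E c : x + c *: x = (1 + c) *: x by rewrite scalerDl scale1r.
rewrite /dip polarE !E !denergyZ// subrr cmod0 expr0n mul0r subr0.
have -> : cmod (1 - 'i : R[i]) = cmod (1 + 'i : R[i]).
  have <- : (1 + 'i : R[i])^* = 1 - 'i by rewrite rmorphD /= conjCi rmorph1.
  exact: cmodJ.
rewrite subrr mulr0 addr0.
have -> : (1 + 1 : R[i]) = (2 : R)%:C by rewrite rmorph_nat.
rewrite cmodR ger0_norm//.
by rewrite rmorphM rmorphXn /= rmorph_nat expr2 mulrA -natrM mulVf ?mul1r// pnatr_eq0.
Qed.

(** Zero energy gives [2 Re <x, v> <= dform v] for every [v]; small rotated multiples of [v] then
    kill the pairing, and pairings separate points. *)
Lemma denergy_eq0 x : dspace x -> denergy x = 0 -> x = 0.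
Proof.
move=> hx x0; apply: pr_sep => v.
apply/eqP; rewrite -cmod_eq0 eq_le cmod_ge0 andbT.
have [b b1 bE] := cmod_rot (pr x v).
apply/ler_addgt0Pl => e e0; rewrite addr0.
have B0 : 0 <= dform v by exact: pr_pos.
pose t := e / (dform v + 1).
have d0 : 0 < dform v + 1 by rewrite ltr_wpDl.
have t0 : 0 < t by rewrite divr_gt0.
have := dquad_le (vscale (t%:C * b^*) v) hx.
rewrite x0 /dquad dform_vscale pr_vscale rmorphM /= conjRC conjCK -mulrA bE -rmorphM /=.
rewrite cmodM cmodR cmodJ b1 mulr1 real_normK ?num_real// => h.
have h2 : 2 * cmod (pr x v) <= t * dform v by nra.
have : t * (dform v + 1) = e by rewrite /t divfK// gt_eqF.
have := cmod_ge0 (pr x v); nra.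
Qed.

Lemma dip_ipnorm x : dspace x -> ipnorm dip x = dnorm x.
Proof. by move=> hx; rewrite /ipnorm dip_self. Qed.

Hypothesis pr_complete : forall u : nat -> Z, (forall n, dspace (u n)) ->
  (forall e : R, 0 < e -> exists N, forall m n,
     (N <= m)%N -> (N <= n)%N -> denergy (u m - u n) < e) ->
  exists z, forall v, (fun n => cmod (pr (u n - z) v)) @ \oo --> (0 : R).

(** For completeness, the limit obtained for individual pairings is also the limit in energy: a
    supremum of functionals, each of which passes to the limit, is lower semicontinuous. *)
Lemma dspace_hilbert : hilbert_on dspace dip.
Proof.
split.
- by split; [exact: dspace0|exact: dspaceDZ].
- exact: dip_linear.
- by move=> x y hx hy; exact: dip_conj.
- move=> x hx x0; rewrite dip_self// ltcR lt_def denergy_ge0// andbT.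
  by apply: contra x0 => /eqP/(denergy_eq0 hx) ->.
- move=> u hu hC.
  have hE (e : R) : 0 < e -> exists N, forall m n,
      (N <= m)%N -> (N <= n)%N -> denergy (u m - u n) < e.
    move=> e0; have [|N hN] := hC (Num.sqrt e); first by rewrite sqrtr_gt0.
    exists N => m n Nm Nn; have := hN m n Nm Nn.
    by rewrite dip_ipnorm; [rewrite ltr_sqrt|exact: dspaceB].
  have [z hz] := pr_complete hu hE.
  have lim (e : R) : 0 < e -> exists N, forall n, (N <= n)%N -> forall v, dquad (u n - z) v <= e.
    move=> e0; have [N hN] := hE e e0; exists N => n Nn v.
    have lim : (fun m => e + 2 * cmod (pr (u m - z) v)) @ \oo --> e + 0.
      by apply: cvgD; [exact: cvg_cst|exact: cvg0Ml].
    rewrite addr0 in lim; apply: (cvgr_to_ge lim); near=> m.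
    have Nm : (N <= m)%N by near: m; exists N.
    have := le_trans (dquad_le v (dspaceB (hu n) (hu m))) (ltW (hN n m Nn Nm)).
    rewrite /dquad -[u n - z](subrKA (u m)) (prD (u n - u m) (u m - z)) ReD => h.
    have := Re_le_cmod (pr (u m - z) v).
    lra.
  have [N1 hN1] := lim 1 ltr01.
  have hzD : dspace z.
    rewrite -(subKr (u N1) z); apply: dspaceB => //.
    by exists 1 => v; apply: hN1.
  exists z => //; apply/cvgrPdist_lt => e e0.
  have [N hN] := lim (e ^+ 2 / 2) (divr_gt0 (exprn_gt0 2 e0) (ltr0n _ 2)).
  near=> n; rewrite sub0r normrN ger0_norm ?sqrtr_ge0//.
  have Nn : (N <= n)%N by near: n; exists N.
  rewrite dip_ipnorm; last exact: dspaceB.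
  rewrite -(ltr_pXn2r (ltn0Sn 1)) ?nnegrE ?sqrtr_ge0 ?ltW// dnorm2; last exact: dspaceB.
  apply: le_lt_trans (denergy_le (hN n Nn)) _.
  by rewrite ltr_pdivrMr// ltr_pMr ?exprn_gt0// ltr1n.
Unshelve. all: by end_near. Qed.

End DualForm.

(** * The Laurent form on bilateral sequences *)

Section BilateralModel.
Variables (R : realType) (U Y : hilbertType R) (Sn : nat -> U -> Y).
Hypothesis Sn_contr : forall n, contractive_op (Sn n).
Hypothesis conv_contr : forall (u : nat -> U) N,
  \sum_(n < N) hnorm (conv Sn u n) ^+ 2 <= \sum_(n < N) hnorm (u n) ^+ 2.

Local Notation E := (Y * U)%type.
Local Notation ipE := (dsum_ip (@inner R Y) (@inner R U)).
Local Notation ipY := (@inner R Y).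
Local Notation ipU := (@inner R U).

Let hE := dsum_hilbert U Y.

Let Sn_bd n : bounded_op (Sn n). Proof. exact: contractive_bounded. Qed.
Let Sn_lin n : linear_on setT (Sn n). Proof. by case: (Sn_bd n). Qed.

(* The Laurent coefficients of the Toeplitz symbol [[I, S], [S^*, I]]. *)
Definition coefZ (d : int) : U -> Y := if d is Posz k then Sn k else fun=> 0.
Definition coefZa (d : int) : Y -> U := if d is Posz k then adj (Sn k) else fun=> 0.
Definition blk (d : int) (e : E) : E :=
  ((if d == 0 then e.1 else 0) + coefZ d e.2, (if d == 0 then e.2 else 0) + coefZa (- d) e.1).

(** A finitely supported sequence is a list of positions with values. Positions may repeat, so that
    addition is concatenation; only the pairings of a list matter. *)
Definition zpr (z : int -> E) (l : seq (int * E)) : R[i] := \sum_(p <- l) ipE (z p.1) p.2.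
Definition zgen (l : seq (int * E)) : int -> E := fun i => \sum_(p <- l) blk (i - p.1) p.2.
Definition zlin (a : R[i]) (v w : seq (int * E)) := [seq (p.1, a *: p.2) | p <- v] ++ w.

Lemma coefZ_adj d u y : ipY (coefZ d u) y = ipU u (coefZa d y).
Proof. by case: d => k /=; rewrite ?in0l ?in0r// adjP. Qed.

Lemma coefZ_lin d : linear_on setT (coefZ d).
Proof. by case: d => k //= a x y _ _; rewrite scaler0 addr0. Qed.

Lemma coefZa_lin d : linear_on setT (coefZa d).
Proof.
case: d => k //=; first exact: adj_linear.
by move=> a x y _ _; rewrite scaler0 addr0.
Qed.

Lemma blk_lin d : linear_on setT (blk d).
Proof.
move=> a x y _ _; rewrite /blk /= coefZ_lin// coefZa_lin//.
have h (W : lmodType R[i]) (b : bool) (p q : W) :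
    (if b then a *: p + q else 0) = a *: (if b then p else 0) + (if b then q else 0).
  by case: b => //; rewrite scaler0 addr0.
rewrite !h; congr (_, _); rewrite /= !scalerDr !addrA; congr (_ + _).
  by rewrite -!addrA; congr (_ + _); rewrite addrC.
by rewrite -!addrA; congr (_ + _); rewrite addrC.
Qed.

Lemma blk_herm d e e' : ipE (blk (- d) e') e = (ipE (blk d e) e')^*.
Proof.
have h (X : hilbertType R) (x y : X) : @inner R X (if d == 0 then y else 0) x
    = @inner R X y (if d == 0 then x else 0) by case: ifP => _; rewrite ?in0l ?in0r.
rewrite /dsum_ip /blk /= opprK oppr_eq0 !inDl !coefZ_adj !rmorphD /= -!inner_conj !h.
ring.
Qed.

Lemma zpr_lin a x y v : zpr (a *: x + y) v = a * zpr x v + zpr y v.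
Proof.
rewrite /zpr mulr_sumr -big_split; apply: eq_bigr => p _.
by apply: (ipDZl hE).
Qed.

Lemma zpr_zlin z a v w : zpr z (zlin a v w) = a^* * zpr z v + zpr z w.
Proof.
rewrite /zpr /zlin big_cat big_map mulr_sumr; congr (_ + _).
by apply: eq_bigr => p _; rewrite (ipZr hE).
Qed.

Lemma zgen_zlin a v w : zgen (zlin a v w) = a *: zgen v + zgen w.
Proof.
apply/funext => i; rewrite /zgen /zlin big_cat big_map /=; congr (_ + _).
rewrite [RHS]scaler_sumr; apply: eq_bigr => p _.
exact: (linZ (blk_lin _)).
Qed.

Lemma zpr_nil z : zpr z [::] = 0. Proof. exact: big_nil. Qed.

Lemma zgen_nil : zgen [::] = 0.
Proof. by apply/funext => i; rewrite /zgen big_nil. Qed.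

Lemma zpr_herm v w : zpr (zgen w) v = (zpr (zgen v) w)^*.
Proof.
rewrite /zpr /zgen.
have E1 s t : \sum_(p <- s) ipE (\sum_(q <- t) blk (p.1 - q.1) q.2) p.2
    = \sum_(p <- s) \sum_(q <- t) ipE (blk (p.1 - q.1) q.2) p.2.
  apply: eq_bigr => p _; apply: (big_morph (fun x => ipE x p.2)) => [x y|].
    exact: (ipDl hE).
  exact: (ip0l hE).
rewrite !E1 rmorph_sum exchange_big /=; apply: eq_bigr => p _.
rewrite rmorph_sum; apply: eq_bigr => q _.
by rewrite /= -blk_herm opprB.
Qed.

Lemma zpr1 z i e : zpr z [:: (i, e)] = ipE (z i) e.
Proof. by rewrite /zpr big_seq1. Qed.

Lemma zpr_sep z : (forall v, zpr z v = 0) -> z = 0.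
Proof.
move=> h; apply/funext => i; apply: (ipn_eq0 hE) => //.
by rewrite /ipnorm -zpr1 h sqrtr0.
Qed.

Definition mklist (n M : nat) (c : nat -> E) : seq (int * E) :=
  [seq ((k%:Z - n%:Z)%R, c k) | k <- iota 0 M].

Lemma zpr_mklist z n M c : zpr z (mklist n M c) = \sum_(k < M) ipE (z (k%:Z - n%:Z)) (c k).
Proof. by rewrite /zpr big_map -(big_mkord xpredT (fun k => ipE (z (k%:Z - n%:Z)) (c k))) /index_iota subn0. Qed.

(** Collects a list into one value per position of an interval, where the form can be written with
    convolutions. *)
Lemma zpr_normal l : exists n M c, forall z, zpr z l = zpr z (mklist n M c).
Proof.
have [n [M hnM]] : exists n M : nat, forall p, p \in l -> exists2 k, (k < M)%N & p.1 = k%:Z - n%:Z.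
  elim: l => [|p l [n [M h]]]; first by exists 0%N, 0%N.
  (* Moving the origin by the absolute value of [p.1] makes the index of the new position
     nonnegative; the window length is generous, not sharp. *)
  exists (n + `|p.1|)%N, (M + `|p.1| + n + `|p.1| + 1)%N => q; rewrite inE => /orP[/eqP->|/h[k kM ->]].
    by move: (p.1) => t; exists (`|(t + (n + `|t|)%N%:Z)%R|)%N; clear; lia.
  by move: (p.1) => t; exists (k + `|t|)%N; move: kM; clear; lia.
exists n, M, (fun k => \sum_(p <- l | p.1 == k%:Z - n%:Z) p.2) => z.
rewrite zpr_mklist /zpr.
under [RHS]eq_bigr => k _.
  rewrite (big_morph (ipE (z (k%:Z - n%:Z))) (fun x y => ipDr hE (I : setT x) (I : setT y) I) (ip0r hE I)).
  over.
rewrite (exchange_big_dep xpredT)//= [LHS]big_seq [RHS]big_seq; apply: eq_bigr => p /hnM[k kM Ep].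
rewrite (bigD1 (Ordinal kM)) ?Ep//= big1 ?addr0// => j /andP[/eqP jE] /negP[].
by apply/eqP/val_inj => /=; lia.
Qed.

Local Notation zform := (dform zpr zgen).
Local Notation zquad := (dquad zpr zgen).

(** Hermitian symmetry moves [zgen] from one list to the other, so pairings alone determine the
    form. *)
Lemma zform_normal l l' : (forall z, zpr z l = zpr z l') -> zform l = zform l'.
Proof. by move=> h; rewrite /dform h zpr_herm h -zpr_herm. Qed.

(** The bridge to H(S). The entries [(c k).1] occur only in the first negative square and can be
    chosen to cancel it; substituting [g k] for [(z (k - n)).2 - (c k).2] then leaves
    [|z_1 - S z_2 + S g|^2 - |g|^2 + |z_2|^2]. *)
Lemma zquad_mklist z n M c : zquad z (mklist n M c) =
  \sum_(k < M) (hnorm ((z (k%:Z - n%:Z)).1 - conv Sn (fun j => (c j).2) k) ^+ 2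
    - hnorm ((z (k%:Z - n%:Z)).1 - conv Sn (fun j => (c j).2) k - (c k).1) ^+ 2
    + hnorm (z (k%:Z - n%:Z)).2 ^+ 2 - hnorm ((z (k%:Z - n%:Z)).2 - (c k).2) ^+ 2).
Proof.
(* The cross term of the form; the block with the adjoint coefficients contributes its conjugate. *)
pose T : R[i] := \sum_(k < M) ipY (conv Sn (fun j => (c j).2) k) (c k).1.
have T1 : T = \sum_(k < M) \sum_(j < M) ipY (coefZ (k%:Z - j%:Z) (c j).2) (c k).1.
  apply: eq_bigr => k _; rewrite /conv in_suml.
  rewrite (@big_ord_widen _ _ _ k.+1 M (fun j => ipY (Sn (k - j) (c j).2) (c k).1) (ltn_ord k)) big_mkcond.
  apply: eq_bigr => j _; rewrite ltnS; case: leqP => jk.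
    by rewrite subzn.
  by case E : (k%:Z - j%:Z) => [d|d] /=; [lia|rewrite in0l].
have T2 : \sum_(k < M) \sum_(j < M) ipU (coefZa (j%:Z - k%:Z) (c j).1) (c k).2 = T^*.
  rewrite T1 rmorph_sum exchange_big /=; apply: eq_bigr => k _.
  rewrite rmorph_sum; apply: eq_bigr => j _.
  by rewrite /= coefZ_adj -inner_conj.
have Ef : zpr (zgen (mklist n M c)) (mklist n M c)
    = \sum_(k < M) (ipY (c k).1 (c k).1 + ipU (c k).2 (c k).2) + (T + T^*).
  rewrite zpr_mklist -T2 T1 -!big_split /=; apply: eq_bigr => k _.
  rewrite /zgen /mklist big_map -/(index_iota 0 M).
  have -> : iota 0 M = index_iota 0 M by rewrite /index_iota subn0.
  rewrite big_mkord (big_morph (ipE^~ (c k)) (fun x y => ipDl hE (I : setT x) (I : setT y) I) (ip0l hE I)).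
  have -> : ipY (c k).1 (c k).1 + ipU (c k).2 (c k).2
      = \sum_(j < M) (if k == j then ipE (c k) (c k) else 0).
    by rewrite (bigD1 k)//= eqxx big1 ?addr0// => j; rewrite eq_sym => /negbTE->.
  rewrite -!big_split /=; apply: eq_bigr => j _.
  have -> : (k%:Z - n%:Z - (j%:Z - n%:Z) = k%:Z - j%:Z)%R by ring.
  rewrite /dsum_ip /blk /= opprB !inDl.
  have -> : (k%:Z - j%:Z == 0)%R = (k == j) by rewrite subr_eq0 eqz_nat.
  by case: eqP => [->|_]; rewrite ?in0l; ring.
have ReTT : complex.Re (T + T^*) = 2 * complex.Re T by rewrite ReD ReJ; ring.
rewrite /dquad /dform Ef zpr_mklist (ReD (\sum_(_ < _) _)) ReTT opprD addrA /T !Re_sum !mulr_sumr -!sumrB.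
apply: eq_bigr => k _.
by rewrite /dsum_ip !ReD !in_self /= !hn2B inBl ReB; ring.
Qed.

(** The form is [- zquad 0], in which the completed squares leave at least the input energy minus
    the output energy of a truncated Toeplitz operator. *)
Lemma zform_ge0 l : 0 <= complex.Re (zpr (zgen l) l).
Proof.
have [n [M [c hc]]] := zpr_normal l.
rewrite -/(zform l) (zform_normal hc).
have -> : zform (mklist n M c) = - zquad 0 (mklist n M c).
  have p0 : zpr 0 (mklist n M c) = 0.
    by rewrite zpr_mklist big1// => k _; exact: (ip0l hE).
  by rewrite /dquad p0 mulr0 sub0r opprK.
rewrite zquad_mklist -sumrN.
apply: (@le_trans _ _ (\sum_(k < M) hnorm (c k).2 ^+ 2 - \sum_(k < M) hnorm (conv Sn (fun j => (c j).2) k) ^+ 2)).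
  by rewrite subr_ge0; exact: (conv_contr (fun j => (c j).2)).
rewrite -sumrB; apply: ler_sum => k _.
rewrite /= !sub0r !hnN hn0.
by have := sqr_ge0 (hnorm (- conv Sn (fun j => (c j).2) k - (c k).1)); lra.
Qed.

Local Notation zspace := (dspace zpr zgen).
Local Notation zenergy := (denergy zpr zgen).

(** Test with the point mass [z i / 2] at [i]: the pairing yields [|z i|^2], and the diagonal block,
    of norm at most 2 since [Sn 0] is a contraction, takes back at most half of it. *)
Lemma zcoef_bound z i : zspace z -> ipnorm ipE (z i) ^+ 2 <= 2 * zenergy z.
Proof.
move=> hz; have := dquad_le [:: (i, (2^-1)%:C *: z i)] hz.
rewrite /dquad /dform !zpr1 /zgen big_seq1 /= subrr (ipZr hE)// conjRC ReZ (ip_self hE)//=.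
set e := z i.
have : complex.Re (ipE (blk 0 ((2^-1)%:C *: e)) ((2^-1)%:C *: e)) <= 2 * (4^-1 * ipnorm ipE e ^+ 2).
  rewrite (linZ (blk_lin 0)) (ipZl hE)// (ipZr hE)// conjRC !ReZ mulrA.
  have -> : 2^-1 * 2^-1 = 4^-1 :> R by field.
  rewrite mulrCA ler_wpM2l ?invr_ge0//.
  rewrite /dsum_ip /blk /= ?oppr0 !inDl /= adjP' // !ReD !in_self /=.
  rewrite (inner_conj (Sn 0 e.2) e.1) ReJ.
  have -> : ipnorm ipE e ^+ 2 = hnorm e.1 ^+ 2 + hnorm e.2 ^+ 2.
    by apply: complexI; rewrite -(ip_self hE)// /dsum_ip !in_self rmorphD.
  have h1 := le_trans (Re_le_cmod _) (in_CS (Sn 0 e.2) e.1).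
  have h2 := contractive_hnorm e.2 (Sn_contr 0).
  have h3 := hn_ge0 e.1; have h4 := hn_ge0 e.2; have h5 := hn_ge0 (Sn 0 e.2).
  have h6 : hnorm (Sn 0 e.2) * hnorm e.1 <= hnorm e.2 * hnorm e.1 by rewrite ler_wpM2r.
  have := sqr_ge0 (hnorm e.1 - hnorm e.2); rewrite sqrrB; lra.
lra.
Qed.

Lemma zspace_complete : forall u : nat -> int -> E, (forall n, zspace (u n)) ->
  (forall e : R, 0 < e -> exists N, forall m n,
     (N <= m)%N -> (N <= n)%N -> zenergy (u m - u n) < e) ->
  exists z, forall v, (fun n => cmod (zpr (u n - z) v)) @ \oo --> (0 : R).
Proof.
move=> u hu hC.
have hB m n : zspace (u m - u n).
  apply: (dspaceB zpr_lin zpr_zlin zgen_zlin zpr_nil zgen_nil zform_ge0) => //.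
have /choice[z hz] : forall i, exists l : E, (fun n => ipnorm ipE (u n i - l)) @ \oo --> (0 : R).
  move=> i; have [l _ hl] : exists2 l : E, setT l & (fun n => ipnorm ipE (u n i - l)) @ \oo --> (0 : R).
    case: hE => _ _ _ _; apply => // e e0.
    have [|N hN] := hC (e ^+ 2 / 2); first by rewrite divr_gt0// exprn_gt0.
    exists N => m n Nm Nn; rewrite -(ltr_pXn2r (ltn0Sn 1)) ?nnegrE ?sqrtr_ge0 ?ltW//.
    by apply: le_lt_trans (zcoef_bound i (hB m n)) _; rewrite mulrC -ltr_pdivlMr// hN.
  by exists l.
exists z; elim=> [|p v IH].
  by under eq_fun do rewrite zpr_nil cmod0; exact: cvg_cst.
apply: squeeze0 (cvg0D (cvg0Ml (ipnorm ipE p.2) (hz p.1)) IH) => n.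
rewrite cmod_ge0/= {1}/zpr big_cons; apply: le_trans (cmod_le_add _ _) _.
by rewrite lerD2r mulrC; exact: (ip_CS hE).
Qed.

End BilateralModel.

(** * The Hardy space in terms of Taylor coefficients *)

Section SquareSummable.
Variables (R : realType) (X : hilbertType R).
Implicit Types (f g : disk R -> X) (a b : nat -> X) (z w : disk R).

Lemma H2norm2_leP f a (M : R) : has_taylor f a ->
  (H2norm2 f <= M%:E)%E <-> (forall N, \sum_(k < N) hnorm (a k) ^+ 2 <= M).
Proof.
move=> hf; rewrite /H2norm2 (taylorE hf).
have p0 k : (0 <= (hnorm (a k) ^+ 2)%:E)%E by rewrite lee_fin sqr_ge0.
split=> [h N|h].
  rewrite -lee_fin; apply: le_trans h; rewrite -(big_mkord xpredT (fun k => hnorm (a k) ^+ 2)).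
  by rewrite -sumEFin; apply: nneseries_lim_ge => k _ _.
apply: lime_le; first by apply: is_cvg_nneseries => k _ _.
by near=> n; rewrite sumEFin lee_fin big_mkord.
Unshelve. all: by end_near. Qed.

Lemma H2norm2_fin f : H2 f -> exists r : R, H2norm2 f = r%:E.
Proof.
move=> [_ h]; exists (fine (H2norm2 f)); rewrite fineK// ge0_fin_numE//.
by apply: nneseries_ge0 => k _ _; rewrite lee_fin sqr_ge0.
Qed.

Lemma H2P f a : has_taylor f a -> (exists M : R, forall N, \sum_(k < N) hnorm (a k) ^+ 2 <= M) -> H2 f.
Proof.
move=> hf [M hM]; split; first by exists a.
by apply: (@le_lt_trans _ _ M%:E); [apply/(H2norm2_leP _ hf)|exact: ltry].
Qed.

Lemma has_taylor_exists a (c : R) : (forall k, hnorm (a k) <= c) ->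
  exists f, has_taylor f a.
Proof.
move=> hc; have c0 : 0 <= c by apply: le_trans (hc 0%N); exact: hn_ge0.
have /choice[f hf] : forall z : disk R, exists l : X, (fun n => hnorm (psum a z n - l)) @ \oo --> (0 : R).
  move=> z; pose q := cmod z.
  have q0 : 0 <= q by exact: cmod_ge0.
  have q1 : q < 1 by exact: disk_cmod.
  have q2 : 1 - q != 0 by rewrite gt_eqF// subr_gt0.
  have [//|||l _ hl] := ip_complete_incr (hilbert_onT X) (u := psum a z)
      (b := fun n => c * (1 - q ^+ n) / (1 - q)) (M := c / (1 - q)); last by exists l.
  - move=> n; rewrite /psum big_ord_recr /= addrAC subrr add0r -/(hnorm _) hnZ cmodX -/q.
    have -> : c * (1 - q ^+ n.+1) / (1 - q) - c * (1 - q ^+ n) / (1 - q) = q ^+ n * c.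
      by rewrite exprS; field.
    by rewrite ler_wpM2l// exprn_ge0.
  - move=> n; rewrite ler_pM2r ?invr_gt0 ?subr_gt0//.
    by rewrite ler_piMr// gerBl exprn_ge0.
by exists f; apply/has_taylorP.
Qed.

End SquareSummable.

(** * Taylor coefficients of a Schur function and of its reflection *)

Section SchurData.
Variables (R : realType) (U Y : hilbertType R) (S : disk R -> U -> Y).
Hypothesis hS : schur S.

Definition scoef k (u : U) : Y := taylor (fun z => S z u) k.

Lemma schur_contr z : contractive_op (S z).
Proof. by case: hS. Qed.

Lemma scoef_spec : (forall n, bounded_op (scoef n)) /\
  (forall (z : disk R) (e : R), 0 < e -> \forall n \near \oo, forall u,
    hnorm (S z u - \sum_(k < n) (z : R[i]) ^+ k *: scoef k u) <= e * hnorm u).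
Proof.
case: hS => _ [Sn Sn_bd S_sum].
have -> : scoef = Sn; last by [].
by apply/funext => k; apply/funext => u; rewrite /scoef (taylorE (@op_taylor _ _ _ _ _ S_sum u)).
Qed.

Lemma scoef_bounded n : bounded_op (scoef n).
Proof. by case: scoef_spec. Qed.

Lemma scoef_lin n : linear_on setT (scoef n).
Proof. by case: (scoef_bounded n). Qed.

Lemma schur_taylor u : has_taylor (fun z => S z u) (fun k => scoef k u).
Proof. by case: scoef_spec => h1 h2; exact: op_taylor. Qed.

Lemma schur_mul_taylor (g : disk R -> U) a : has_taylor g a ->
  has_taylor (fun z => S z (g z)) (conv scoef a).
Proof. by case: scoef_spec => h1 h2; apply: conv_taylor => // z; exact: schur_contr. Qed.

Lemma scoef_contr n : contractive_op (scoef n).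
Proof. by case: scoef_spec => h1 h2; apply: (schur_coef_contr h1 h2); exact: schur_contr. Qed.

Lemma scoef_conv (u : nat -> U) N :
  \sum_(n < N) hnorm (conv scoef u n) ^+ 2 <= \sum_(n < N) hnorm (u n) ^+ 2.
Proof. by case: scoef_spec => h1 h2; apply: (conv_contraction h1 h2); exact: schur_contr. Qed.

Lemma convB (a b : nat -> U) n : conv scoef (fun k => a k - b k) n = conv scoef a n - conv scoef b n.
Proof.
by rewrite /conv -sumrB; apply: eq_bigr => j _; rewrite (linB (scoef_lin _)).
Qed.

Lemma eq_conv (a b : nat -> U) n : (forall k, (k <= n)%N -> a k = b k) ->
  conv scoef a n = conv scoef b n.
Proof. by move=> h; apply: eq_bigr => j _; rewrite h// -ltnS. Qed.

(** This rests on convergence in operator norm, which passes to adjoints by [adj_bound]; convergence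
    vector by vector would not. *)
Lemma tilde_taylor y : has_taylor (fun z => tilde S z y) (fun k => adj (scoef k) y).
Proof.
case: scoef_spec => h1 h2; apply/has_taylorP => w; apply/cvgrPdist_lt => e e0.
have d0 : 0 < hnorm y + 1 by rewrite ltr_wpDl ?hn_ge0.
have h := h2 (diskJ w) _ (divr_gt0 e0 d0).
near=> n; rewrite sub0r normrN ger0_norm ?hn_ge0// hn_distC.
have h' : forall u, hnorm (S (diskJ w) u - \sum_(k < n) (diskJ w : R[i]) ^+ k *: scoef k u) <= e / (hnorm y + 1) * hnorm u.
  by near: n; exact: h.
pose T u := S (diskJ w) u - \sum_(k < n) (diskJ w : R[i]) ^+ k *: scoef k u.
have T_lin : linear_on setT T.
  move=> a u v _ _; rewrite /T (proj1 (schur_contr _))// scalerBr addrACA -opprD.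
  congr (_ - _); rewrite scaler_sumr -big_split /=; apply: eq_bigr => k _.
  by rewrite scoef_lin// scalerDr !scalerA mulrC.
have T_bd : bounded_op T by split => //; exists (e / (hnorm y + 1)) => u _; exact: h'.
have -> : tilde S w y - psum (fun k => adj (scoef k) y) w n = adj T y.
  apply: in_ext => u; rewrite -adjP// inBr /tilde -adjP; last exact: contractive_bounded (schur_contr _).
  rewrite /T inBl /psum in_sumr in_suml; congr (_ - _); apply: eq_bigr => k _.
  by rewrite inZr inZl -adjP// rmorphXn.
apply: le_lt_trans (adj_bound T_bd _ h' y) _; first by rewrite divr_ge0// ltW.
by rewrite mulrAC ltr_pdivrMr// ltr_pM2l// ltrDl.
Unshelve. all: by end_near. Qed.

End SchurData.

Arguments schur_taylor {R U Y S} hS u.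
Arguments tilde_taylor {R U Y S} hS y.

Lemma comp_ext (R : realType) (U Y : hilbertType R) (h k : disk R -> Y * U) :
  comp1 h = comp1 k -> comp2 h = comp2 k -> h = k.
Proof.
move=> e1 e2; apply/funext => z; rewrite [h z]surjective_pairing [k z]surjective_pairing.
by congr (_, _); [exact: (congr1 (fun f => f z) e1)|exact: (congr1 (fun f => f z) e2)].
Qed.

(** * Identification of the norm of D(S) with the energy of bilateral sequences *)

Section DSModel.
Variables (R : realType) (U Y : hilbertType R) (S : disk R -> U -> Y).
Hypothesis hS : schur S.
Implicit Types (h : disk R -> Y * U).

Local Notation Sn := (scoef S).
Local Notation E := (Y * U)%type.
Local Notation ipE := (dsum_ip (@inner R Y) (@inner R U)).
Local Notation zpr := (@zpr R U Y).
Local Notation zgen := (zgen Sn).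
Local Notation zquad := (dquad zpr zgen).
Local Notation zspace := (dspace zpr zgen).
Local Notation zform := (dform zpr zgen).
Local Notation zenergy := (denergy zpr zgen).
Local Notation zip := (dip zpr zgen).

(** The outputs before [N] depend only on the inputs before [N], and a truncated input is a
    polynomial, hence an admissible test function. *)
Lemma HSnorm2_leP f c (M : R) : has_taylor f c ->
  (HSnorm2 S f <= M%:E)%E <->
  forall (g : nat -> U) N, \sum_(k < N) (hnorm (c k + conv Sn g k) ^+ 2 - hnorm (g k) ^+ 2) <= M.
Proof.
move=> hf; split=> [hM g N|hM]; last first.
  apply: ge_ereal_sup => _ [g gH <-]; have [r gr] := H2norm2_fin gH.
  have tg := analytic_taylor gH.1; rewrite gr leeBlDr//.
  apply/(H2norm2_leP _ (has_taylorD hf (schur_mul_taylor hS tg))) => N.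
  have h1 := hM (taylor g) N; have h2 := (H2norm2_leP r tg).1 _ N.
  rewrite sumrB lerBlDr in h1; apply: le_trans h1 _; rewrite lerD2l; apply: h2.
  by rewrite gr.
pose a k := if (k < N)%N then g k else 0.
have a0 k : (N <= k)%N -> a k = 0 by rewrite /a ltnNge => ->.
pose G z := psum a z N.
have hG : has_taylor (fun z : disk R => G z) a by exact: has_taylor_poly.
have Ga n : \sum_(k < n) hnorm (a k) ^+ 2 <= \sum_(k < N) hnorm (g k) ^+ 2.
  apply: (@le_trans _ _ (\sum_(k < n + N) hnorm (a k) ^+ 2)).
    by rewrite big_split_ord /= lerDl sumr_ge0// => k _; rewrite sqr_ge0.
  rewrite addnC big_split_ord /= [X in _ + X]big1 ?addr0 => [|k _].
    by apply: ler_sum => k _; rewrite /a ltn_ord.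
  by rewrite a0 ?leq_addr// hn0 expr0n.
have GH : H2 (fun z : disk R => G z) by apply: (H2P hG); eexists; exact: Ga.
have := le_trans (ereal_sup_ubound (ex_intro2 _ _ _ GH erefl)) hM.
have [r Gr] := H2norm2_fin GH.
have rle : (r%:E <= (\sum_(k < N) hnorm (g k) ^+ 2)%:E)%E.
  by rewrite -Gr; apply/(H2norm2_leP _ hG).
rewrite Gr leeBlDr// -EFinD => /(H2norm2_leP _ (has_taylorD hf (schur_mul_taylor hS hG))) /(_ N) h.
rewrite lee_fin in rle.
rewrite sumrB; have <- : \sum_(k < N) hnorm (c k + conv Sn a k) ^+ 2 = \sum_(k < N) hnorm (c k + conv Sn g k) ^+ 2.
  apply: eq_bigr => k _; rewrite (@eq_conv _ _ _ _ a g)// => j jk.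
  by rewrite /a (leq_ltn_trans jk).
move: h rle; lra.
Qed.

Let Sn_lin n : linear_on setT (Sn n). Proof. exact: scoef_lin. Qed.

(* The Taylor coefficients of the first component sit at the positions [k >= 0]
   and those of the second one at [-1, -2, ...]. *)
Definition DSseq h : int -> E := fun i =>
  match i with Posz k => (taylor (comp1 h) k, 0) | Negz k => (0, taylor (comp2 h) k) end.

Lemma DSseq_fst h k n : (DSseq h (k%:Z - n%:Z)).1 = if (k < n)%N then 0 else taylor (comp1 h) (k - n).
Proof.
case: ltnP => kn; last by rewrite subzn.
by case E : (k%:Z - n%:Z) => [d|d] //=; lia.
Qed.

Lemma DSseq_snd h k n : (DSseq h (k%:Z - n%:Z)).2 = if (k < n)%N then taylor (comp2 h) (n.-1 - k) else 0.
Proof.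
case: ltnP => kn; last by rewrite subzn.
by case E : (k%:Z - n%:Z) => [d|d] /=; [lia|congr (taylor _ _); lia].
Qed.

Lemma has_taylor_mulXn (X : hilbertType R) (f : disk R -> X) a n : has_taylor f a ->
  has_taylor (fun z => (z : R[i]) ^+ n *: f z) (fun k => if (k < n)%N then 0 else a (k - n)%N).
Proof.
move=> hf; elim: n => [|n IH].
  rewrite (_ : (fun z : disk R => _) = f); last by apply/funext => z; rewrite expr0 scale1r.
  by rewrite (_ : (fun k => _) = a)//; apply/funext => k; rewrite subn0.
have := has_taylor_mulz IH; rewrite (_ : (fun z : disk R => _) = fun z : disk R => (z : R[i]) ^+ n.+1 *: f z); last first.
  by apply/funext => z; rewrite exprS scalerA.
by rewrite (_ : shiftup _ = fun k => if (k < n.+1)%N then 0 else a (k - n.+1)%N)//; apply/funext => -[].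
Qed.

Definition shift_coef h n k : Y :=
  (DSseq h (k%:Z - n%:Z)).1 - conv Sn (fun j => (DSseq h (j%:Z - n%:Z)).2) k.

Lemma DSshift_taylor h n : analytic (comp1 h) -> has_taylor (DSshift S h n) (shift_coef h n).
Proof.
move=> hf; apply: has_taylorB.
  rewrite (_ : (fun k => _) = (fun k => if (k < n)%N then 0 else taylor (comp1 h) (k - n)%N)).
    exact: has_taylor_mulXn (analytic_taylor hf).
  by apply/funext => k; rewrite DSseq_fst.
apply: (schur_mul_taylor hS).
pose b j := (DSseq h (j%:Z - n%:Z)).2.
have b0 k : (n <= k)%N -> b k = 0 by rewrite /b DSseq_snd ltnNge => ->.
have := has_taylor_poly b0; congr (has_taylor _ _).
apply/funext => z; rewrite /psum (reindex_inj rev_ord_inj) /=; apply: eq_bigr => k _.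
rewrite /b DSseq_snd; have kn := ltn_ord k.
have -> : (n - k.+1 < n)%N by lia.
congr (_ ^+ _ *: taylor _ _); lia.
Qed.

Definition DSval h n (g : nat -> U) N : R :=
  \sum_(k < N) (hnorm (shift_coef h n k + conv Sn g k) ^+ 2 - hnorm (g k) ^+ 2)
  + \sum_(k < n) hnorm (taylor (comp2 h) k) ^+ 2.

Lemma DSN_leP h n (M : R) : analytic (comp1 h) ->
  (DSN S h n <= M%:E)%E <-> forall g N, DSval h n g N <= M.
Proof.
move=> hf; rewrite /DSN -leeBrDr// -EFinB.
split=> [/(HSnorm2_leP _ (@DSshift_taylor h n hf)) H g N|H].
  by rewrite /DSval -lerBrDr; exact: H.
by apply/(HSnorm2_leP _ (@DSshift_taylor h n hf)) => g N; rewrite lerBrDr; exact: H.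
Qed.

Lemma DSseq_snd_sum h n M : \sum_(k < M) hnorm (DSseq h (k%:Z - n%:Z)).2 ^+ 2
  <= \sum_(k < n) hnorm (taylor (comp2 h) k) ^+ 2.
Proof.
have E : \sum_(k < n) hnorm (taylor (comp2 h) k) ^+ 2 = \sum_(k < n) hnorm (DSseq h (k%:Z - n%:Z)).2 ^+ 2.
  rewrite (reindex_inj rev_ord_inj) /=; apply: eq_bigr => k _; rewrite DSseq_snd ltn_ord.
  by rewrite (_ : (n - k.+1 = n.-1 - k)%N)//; lia.
rewrite E; apply: (@le_trans _ _ (\sum_(k < M + n) hnorm (DSseq h (k%:Z - n%:Z)).2 ^+ 2)).
  by rewrite big_split_ord /= lerDl sumr_ge0// => k _; rewrite sqr_ge0.
rewrite addnC big_split_ord /= [X in _ + X]big1 ?addr0// => k _.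
by rewrite DSseq_snd ltnNge leq_addr /= hn0 expr0n.
Qed.

(** Drop the negative square that contains the first entries of [c]. *)
Lemma zquad_le_DSval h n M c : zquad (DSseq h) (mklist n M c)
  <= DSval h n (fun k => (DSseq h (k%:Z - n%:Z)).2 - (c k).2) M.
Proof.
rewrite (zquad_mklist (scoef_contr hS)) /DSval.
have := DSseq_snd_sum h n M; set A := \sum_(k < n) _; set B := \sum_(k < M) _ => BA.
apply: (@le_trans _ _ (\sum_(k < M) (hnorm (shift_coef h n k
   + conv Sn (fun k => (DSseq h (k%:Z - n%:Z)).2 - (c k).2) k) ^+ 2
   - hnorm ((DSseq h (k%:Z - n%:Z)).2 - (c k).2) ^+ 2) + B)); last by rewrite lerD2l.
rewrite /B -big_split /=; apply: ler_sum => k _.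
rewrite (convB hS) /shift_coef addrA subrK.
have := sqr_ge0 (hnorm ((DSseq h (k%:Z - n%:Z)).1 - conv Sn (fun j => (c j).2) k - (c k).1)); lra.
Qed.

(** The equality case: the first entries are chosen to annihilate that square. With [n <= N] the
    window contains all the [n] coefficients of the second component counted in [DSval]. *)
Lemma DSval_eq_zquad h n g N : (n <= N)%N -> DSval h n g N = zquad (DSseq h)
  (mklist n N (fun k => (shift_coef h n k + conv Sn g k, (DSseq h (k%:Z - n%:Z)).2 - g k))).
Proof.
move=> nN; rewrite (zquad_mklist (scoef_contr hS)) /DSval /=.
have -> : \sum_(k < n) hnorm (taylor (comp2 h) k) ^+ 2 = \sum_(k < N) hnorm (DSseq h (k%:Z - n%:Z)).2 ^+ 2.
  rewrite -(subnKC nN) big_split_ord /= [X in _ = _ + X]big1 ?addr0; last first.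
    by move=> k _; rewrite DSseq_snd ltnNge leq_addr /= hn0 expr0n.
  rewrite (reindex_inj rev_ord_inj) /=; apply: eq_bigr => k _; rewrite DSseq_snd ltn_ord.
  by rewrite (_ : (n - k.+1 = n.-1 - k)%N)//; lia.
rewrite -big_split /=; apply: eq_bigr => k _.
rewrite (convB hS).
have -> : (DSseq h (k%:Z - n%:Z)).1 - (conv Sn (fun j => (DSseq h (j%:Z - n%:Z)).2) k - conv Sn g k)
    = shift_coef h n k + conv Sn g k by rewrite /shift_coef opprB addrA addrAC.
by rewrite subrr hn0 subKr expr0n /=; ring.
Qed.

(** Padding [g] by zeros widens the window to at least [n] positions and only adds nonnegative
    output terms. *)
Lemma DSval_le_zquad h n g N : exists N' c, DSval h n g N <= zquad (DSseq h) (mklist n N' c).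
Proof.
pose a k := if (k < N)%N then g k else 0.
exists (N + n)%N, (fun k => (shift_coef h n k + conv Sn a k, (DSseq h (k%:Z - n%:Z)).2 - a k)).
rewrite -DSval_eq_zquad ?leq_addl//.
rewrite /DSval lerD2r big_split_ord /= -[leLHS]addr0; apply: lerD.
  apply: ler_sum => k _; rewrite /a ltn_ord (@eq_conv _ _ _ _ _ g)// => j jk.
  by rewrite (leq_ltn_trans jk).
by rewrite sumr_ge0// => k _; rewrite /a ltnNge leq_addr /= hn0 expr0n subr0 sqr_ge0.
Qed.

Lemma DSN_all_leP h (M : R) : analytic (comp1 h) ->
  (forall n, (DSN S h n <= M%:E)%E) <-> (forall l, zquad (DSseq h) l <= M).
Proof.
move=> hf; split=> [H l|H n].
  have [n [N [c hc]]] := zpr_normal l.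
  rewrite /dquad hc (zform_normal (scoef_contr hS) hc) -/(zquad _ _).
  apply: le_trans (zquad_le_DSval _ _ _ _) _; exact: ((@DSN_leP h n M hf).1 (H n)).
by apply/DSN_leP => // g N; have [N' [c]] := DSval_le_zquad h n g N; move/le_trans; apply.
Qed.

(** Monotonicity of [DSN]: a test list on the window starting at [-n], padded by a zero, is one on
    the window starting one position earlier. *)
Lemma DSN_succ_le h n (M : R) : analytic (comp1 h) ->
  (DSN S h n.+1 <= M%:E)%E -> (DSN S h n <= M%:E)%E.
Proof.
move=> hf /DSN_leP-/(_ hf) H; apply/DSN_leP => // g N.
have [N' [c]] := DSval_le_zquad h n g N; move/le_trans; apply.
pose c' k := if k is k'.+1 then c k' else 0.
have hc z : zpr z (mklist n N' c) = zpr z (mklist n.+1 N'.+1 c').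
  rewrite !zpr_mklist big_ord_recl /= (ip0r (dsum_hilbert U Y))// add0r.
  by apply: eq_bigr => k _; congr (ipE (z _) _); rewrite /= /bump /=; lia.
rewrite /dquad hc (zform_normal (scoef_contr hS) hc) -/(zquad _ _).
by apply: le_trans (zquad_le_DSval _ _ _ _) _; exact: H.
Qed.

Lemma conv0 n : conv Sn (fun=> 0) n = 0.
Proof. by rewrite /conv big1// => j _; rewrite (lin0 (Sn_lin _)). Qed.

(** Square-summability is read off the energy bound with the test input 0: at [n = 0] for the first
    component, with an empty output window for the second. *)
Lemma DS_spec h : DS S h <->
  [/\ analytic (comp1 h), analytic (comp2 h) & zspace (DSseq h)].
Proof.
split=> [[H1 H2 [M hM]]|[h1 h2 [M hM]]].
  split; [by case: H1|by case: H2|exists M].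
  by apply/DSN_all_leP; [case: H1|move=> n; case: (hM n)].
have hN : forall n, (DSN S h n <= M%:E)%E by apply/DSN_all_leP.
have hV n := (@DSN_leP h n M h1).1 (hN n).
have shiftH n : H2 (DSshift S h n).
  apply: (H2P (@DSshift_taylor h n h1)); exists M => N.
  have := hV n (fun=> 0) N; rewrite /DSval => h3; apply: le_trans h3.
  rewrite -[leLHS]addr0 lerD// ?sumr_ge0// => [|k _]; last by rewrite sqr_ge0.
  by apply: ler_sum => k _; rewrite conv0 addr0 hn0 expr0n subr0.
split.
- have -> : comp1 h = DSshift S h 0; last exact: shiftH.
  apply/funext => z; rewrite /DSshift big_ord0 expr0 scale1r.
  by rewrite (lin0 (proj1 (schur_contr hS z))) subr0.
- apply: (H2P (analytic_taylor h2)); exists M => N.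
  by have := hV N (fun=> 0) 0%N; rewrite /DSval big_ord0 add0r.
- exists M => n; split=> //; split=> //.
  have := hN n; rewrite /DSN -leeBrDr// -EFinB => /le_lt_trans; apply.
  exact: ltry.
Qed.

Lemma DSnorm2E h : DS S h -> DSnorm2 S h = zenergy (DSseq h).
Proof.
move=> /[dup] hD /DS_spec[h1 h2 hz].
have hN : forall n, (DSN S h n <= (zenergy (DSseq h))%:E)%E.
  by apply/DSN_all_leP => // l; exact: dquad_le.
have DSN_ge0 n (M : R) : (DSN S h n <= M%:E)%E -> 0 <= M.
  move=> /DSN_leP-/(_ h1)/(_ (fun=> 0) 0%N); rewrite /DSval big_ord0 add0r.
  by apply: le_trans; rewrite sumr_ge0// => k _; rewrite sqr_ge0.
(* [DSN_succ_le] speaks of real bounds only; the value minus infinity is excluded because every real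
   bound is nonnegative. *)
have mono : {homo DSN S h : n m / (n <= m)%N >-> (n <= m)%E}.
  apply: homo_leq => [x|y x z|n]; [exact: lexx|exact: le_trans|].
  have := @DSN_succ_le h n ^~ h1; have := DSN_ge0 n.+1.
  case: (DSN S h n.+1) => [r _ H|_ _|H _]; [exact: H|exact: leey|].
  by have := H (-1) (leNye _); rewrite ler0N1.
have -> : DSnorm2 S h = fine (ereal_sup (range (DSN S h))).
  by rewrite /DSnorm2; congr fine; apply/cvg_lim => //; exact: ereal_nondecreasing_cvgn.
set s := ereal_sup _.
have sE : (s <= (zenergy (DSseq h))%:E)%E by apply: ge_ereal_sup => _ [n _ <-].
have hs n : (DSN S h n <= s)%E by apply: ereal_sup_ubound; exists n.
case: s sE hs => [r|//|] /= sE hs.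
- apply/eqP; rewrite eq_le -lee_fin sE /=.
  by apply: (denergy_le [::]) => l; move: l; apply/DSN_all_leP.
- by have := DSN_ge0 0%N (-1) (le_trans (hs 0%N) (leNye _)); rewrite ler0N1.
Qed.

Let Sc := scoef_contr hS.
Let h1 := @zpr_lin R U Y.
Let h2 := @zpr_zlin R U Y.
Let h3 := zgen_zlin Sc.
Let h4 := @zpr_nil R U Y.
Let h5 := zgen_nil (Y := Y) Sn.
Let h6 := zpr_herm Sc.
Let h7 := zform_ge0 Sc (scoef_conv hS).

Lemma zspace_hilbert : hilbert_on zspace zip.
Proof.
apply: (dspace_hilbert h1 h2 h3 h4 h5 h6 h7 (@zpr_sep R U Y)).
exact: zspace_complete Sc (scoef_conv hS).
Qed.

Lemma zspace_addgen z w : zspace z -> zspace (z + zgen w).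
Proof. exact: (dspace_addPi h1 h2 h3 h6). Qed.

Lemma zspace_gen w : zspace (zgen w).
Proof. exact: (dspace_Pi h1 h2 h3 h6 h7). Qed.

Lemma zenergy_addgen z w : zspace z ->
  zenergy (z + zgen w) = zenergy z + (2 * complex.Re (zpr z w) + zform w).
Proof. exact: (denergy_addPi h1 h2 h3 h4 h5 h6). Qed.

Lemma zip_gen z w : zspace z -> zip z (zgen w) = zpr z w.
Proof. exact: (dip_Pi h1 h2 h3 h4 h5 h6 h7). Qed.

Lemma zip_self z : zspace z -> zip z z = (zenergy z)%:C.
Proof. exact: (dip_self h1 h2 h3 h4 h5 h7). Qed.

Lemma zip_ipnorm z : zspace z -> ipnorm zip z = Num.sqrt (zenergy z).
Proof. by move=> hz; rewrite /ipnorm zip_self. Qed.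

(** * The bilateral shift, point masses, and the operators of D(S) on sequences *)

Definition zsh (t : int) z : int -> E := fun i => z (i + t).

(** The Laurent blocks depend only on differences of positions. This is why the shift preserves the
    energy. *)
Lemma zquad_sh t z l : zquad (zsh t z) l = zquad z [seq (p.1 + t, p.2) | p <- l].
Proof.
rewrite /dquad /dform /zpr !big_map; congr (_ - complex.Re _).
apply: eq_bigr => p _ /=; congr (ipE _ _); rewrite /zgen big_map.
by apply: eq_bigr => q _ /=; congr blk; ring.
Qed.

Lemma zspace_sh t z : zspace z -> zspace (zsh t z).
Proof. by move=> [M hM]; exists M => l; rewrite zquad_sh. Qed.

Lemma zenergy_sh t z : zspace z -> zenergy (zsh t z) = zenergy z.
Proof.
have le u w : zspace w -> zenergy (zsh u w) <= zenergy w.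
  by move=> hw; apply: (denergy_le [::]) => l; rewrite zquad_sh dquad_le.
move=> hz; apply/eqP; rewrite eq_le le//=.
have := le (- t) (zsh t z) (zspace_sh t hz); rewrite [zsh (- t) _](_ : _ = z)//.
by apply/funext => i; rewrite /zsh subrK.
Qed.

Lemma zip_sh t x y : zspace x -> zspace y -> zip (zsh t x) (zsh t y) = zip x y.
Proof.
move=> hx hy; apply: eq_polar => c _.
have hxy : zspace (x + c *: y).
  by apply: (subD zspace_hilbert) => //; exact: (subZ zspace_hilbert).
by rewrite -[RHS](zenergy_sh t hxy).
Qed.

Lemma blk_pos n (e : E) : blk Sn (Posz n.+1) e = (Sn n.+1 e.2, 0).
Proof. by rewrite /blk /= add0r addr0. Qed.

Lemma blk_zero (e : E) : blk Sn 0 e = (e.1 + Sn 0 e.2, e.2 + adj (Sn 0) e.1).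
Proof. by []. Qed.

Lemma blk_neg n (e : E) : blk Sn (Negz n) e = (0, adj (Sn n.+1) e.1).
Proof. by rewrite /blk /= addr0 add0r. Qed.

Lemma zgen1 j (e : E) i : zgen [:: (j, e)] i = blk Sn (i - j) e.
Proof. by rewrite /zgen big_seq1. Qed.

Lemma zgen_at0 (e : E) i : zgen [:: (0, e)] i = blk Sn i e.
Proof. by rewrite zgen1 subr0. Qed.

Lemma zgen_atN1 (e : E) i : zgen [:: (-1, e)] i = blk Sn (i + 1) e.
Proof. by rewrite zgen1 opprK. Qed.

Definition zseq (a : nat -> Y) (b : nat -> U) : int -> E :=
  fun i => match i with Posz k => (a k, 0) | Negz k => (0, b k) end.

Lemma DSseqE h a b : has_taylor (comp1 h) a -> has_taylor (comp2 h) b -> DSseq h = zseq a b.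
Proof. by move=> ha hb; rewrite /DSseq (taylorE ha) (taylorE hb). Qed.

Lemma DS_of_taylor h a b : has_taylor (comp1 h) a -> has_taylor (comp2 h) b ->
  zspace (zseq a b) -> DS S h.
Proof.
move=> ha hb hz; apply/DS_spec; split; [by exists a|by exists b|].
by rewrite (DSseqE ha hb).
Qed.

Lemma DS_taylor1 h : DS S h -> has_taylor (comp1 h) (taylor (comp1 h)).
Proof. by case=> -[h0 _] _ _; exact: analytic_taylor. Qed.

Lemma DS_taylor2 h : DS S h -> has_taylor (comp2 h) (taylor (comp2 h)).
Proof. by case=> _ [h0 _] _; exact: analytic_taylor. Qed.

Lemma DS_zspace h : DS S h -> zspace (DSseq h).
Proof. by move=> /DS_spec[]. Qed.

Lemma DSseq_inj h k : DS S h -> DS S k -> DSseq h = DSseq k -> h = k.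
Proof.
move=> hh hk e.
have e1 : taylor (comp1 h) = taylor (comp1 k).
  by apply/funext => n; have /(congr1 fst) := congr1 (fun z => z (Posz n)) e.
have e2 : taylor (comp2 h) = taylor (comp2 k).
  by apply/funext => n; have /(congr1 snd) := congr1 (fun z => z (Negz n)) e.
have hk1 := DS_taylor1 hk; have hk2 := DS_taylor2 hk; rewrite -e1 -e2 in hk1 hk2.
by apply: comp_ext; [exact: taylor_inj (DS_taylor1 hh) hk1|exact: taylor_inj (DS_taylor2 hh) hk2].
Qed.

Lemma DSseq_lin a h k : DS S h -> DS S k -> DSseq (a *: h + k) = a *: DSseq h + DSseq k.
Proof.
move=> hh hk.
rewrite (DSseqE (h := a *: h + k) (has_taylorD (has_taylorZ a (DS_taylor1 hh)) (DS_taylor1 hk))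
  (has_taylorD (has_taylorZ a (DS_taylor2 hh)) (DS_taylor2 hk))).
by apply/funext => -[] n; congr (_, _); rewrite /= scaler0 addr0.
Qed.

Lemma DS_lin a h k : DS S h -> DS S k -> DS S (a *: h + k).
Proof.
move=> hh hk; apply/DS_spec; split.
- by eexists; exact: (has_taylorD (has_taylorZ a (DS_taylor1 hh)) (DS_taylor1 hk)).
- by eexists; exact: (has_taylorD (has_taylorZ a (DS_taylor2 hh)) (DS_taylor2 hk)).
- by rewrite DSseq_lin//; apply: (subDZ zspace_hilbert); exact: DS_zspace.
Qed.

(** Finite energy bounds the coefficients, so both power series converge on the disk and the support
    conditions alone describe D(S). *)
Lemma DS_intro z : zspace z -> (forall n, (z (Posz n)).2 = 0) -> (forall n, (z (Negz n)).1 = 0) ->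
  exists2 h, DS S h & DSseq h = z.
Proof.
move=> hz z2 z1.
have bd i : ipnorm ipE (z i) <= Num.sqrt (2 * zenergy z).
  rewrite -[leLHS]ger0_norm ?ipn_ge0// -sqrtr_sqr ler_wsqrtr//.
  exact: (zcoef_bound Sc).
have [f hf] : exists f, has_taylor f (fun n => (z (Posz n)).1).
  by apply: has_taylor_exists => n; apply: le_trans (hnorm_fst_le (z (Posz n))) (bd _).
have [g hg] : exists g, has_taylor g (fun n => (z (Negz n)).2).
  by apply: has_taylor_exists => n; apply: le_trans (hnorm_snd_le (z (Negz n))) (bd _).
pose h w := (f w, g w).
have ez : zseq (fun n => (z (Posz n)).1) (fun n => (z (Negz n)).2) = z.
  by apply/funext => -[] n /=; rewrite [RHS]surjective_pairing ?z1 ?z2.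
exists h; first by apply: (DS_of_taylor (h := h) hf hg); rewrite ez.
by rewrite (DSseqE (h := h) hf hg).
Qed.

Lemma DS_0 : DS S 0 /\ DSseq (0 : disk R -> E) = 0.
Proof.
have [//|//|h hh e] := DS_intro (sub0 zspace_hilbert).
have e0 : h - h = 0 by rewrite subrr.
have -> : (0 : disk R -> E) = (-1) *: h + h by rewrite scaleN1r addrC e0.
split; first exact: DS_lin.
by rewrite DSseq_lin// e scaler0 addr0.
Qed.

Lemma DSip_seq h k : DS S h -> DS S k -> DSip S h k = zip (DSseq h) (DSseq k).
Proof.
move=> hh hk; rewrite -[DSip S h k]/(polar (fun c => DSnorm2 S (h + c *: k))).
apply: eq_polar => c _; rewrite addrC DSnorm2E; last exact: DS_lin.
by rewrite DSseq_lin// addrC.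
Qed.

Lemma DS_hilbert : hilbert_on (DS S) (DSip S).
Proof.
have sub : Defs.subspace (DS S).
  by split; [case: DS_0|exact: DS_lin].
have subB' h k : DS S h -> DS S k -> DS S (h - k).
  by move=> hh hk; rewrite addrC -scaleN1r; exact: DS_lin.
have seqB h k : DS S h -> DS S k -> DSseq (h - k) = DSseq h - DSseq k.
  by move=> hh hk; rewrite addrC -scaleN1r DSseq_lin// scaleN1r addrC.
have nrm h : DS S h -> ipnorm (DSip S) h = ipnorm zip (DSseq h).
  by move=> hh; rewrite /ipnorm DSip_seq.
split=> //.
- move=> a x y z hx hy hz; rewrite !DSip_seq//; last exact: DS_lin.
  by rewrite DSseq_lin//; apply: (ipDZl zspace_hilbert); exact: DS_zspace.
- move=> x y hx hy; rewrite !DSip_seq//; apply/esym/(ipJ zspace_hilbert); exact: DS_zspace.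
- move=> x hx x0; rewrite DSip_seq//; case: zspace_hilbert => _ _ _ h _; apply: h.
    exact: DS_zspace.
  apply: contra x0 => /eqP e; apply/eqP; apply: DSseq_inj => //; first by case: DS_0.
  by rewrite e; case: DS_0.
- move=> u hu hC.
  have [z hz cz] : exists2 z, zspace z & (fun n => ipnorm zip (DSseq (u n) - z)) @ \oo --> (0 : R).
    case: zspace_hilbert => _ _ _ _; apply; first by move=> n; exact: DS_zspace.
    move=> e /hC[N hN]; exists N => m n Nm Nn.
    by rewrite -seqB// -nrm; [exact: hN|exact: subB'].
  (* Coordinates are continuous, so the vanishing ones still vanish in the limit; 2 is a convenient
     bound for the square root of 2. *)
  have bd n i : ipnorm ipE (DSseq (u n) i - z i) <= 2 * ipnorm zip (DSseq (u n) - z).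
    have hd : zspace (DSseq (u n) - z) by apply: (subB zspace_hilbert) => //; exact: DS_zspace.
    rewrite -(ler_pXn2r (ltn0Sn 1)) ?nnegrE ?mulr_ge0 ?ipn_ge0//.
    apply: le_trans (zcoef_bound Sc i hd) _.
    rewrite zip_ipnorm// exprMn sqr_sqrtr ?(denergy_ge0 h4 hd)// expr2.
    have := denergy_ge0 h4 hd; lra.
  have lim0 : (fun n => 2 * ipnorm zip (DSseq (u n) - z)) @ \oo --> (0 : R) by exact: cvg0Ml.
  have z2 n : (z (Posz n)).2 = 0.
    apply: hn_eq0; apply/eqP; rewrite eq_le hn_ge0 andbT; apply: (cvgr_to_ge lim0).
    near=> m; apply: le_trans (bd m (Posz n)); apply: le_trans (hnorm_snd_le _).
    by rewrite /= sub0r hnN.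
  have z1 n : (z (Negz n)).1 = 0.
    apply: hn_eq0; apply/eqP; rewrite eq_le hn_ge0 andbT; apply: (cvgr_to_ge lim0).
    near=> m; apply: le_trans (bd m (Negz n)); apply: le_trans (hnorm_fst_le _).
    by rewrite /= sub0r hnN.
  have [h hh eh] := DS_intro hz z2 z1; exists h => //.
  rewrite (_ : (fun n => _) = (fun n => ipnorm zip (DSseq (u n) - z)))//.
  by apply/funext => n; rewrite nrm ?seqB ?eh//; exact: subB'.
Unshelve. all: by end_near. Qed.

Lemma DSip_self h : DS S h -> DSip S h h = (DSnorm2 S h)%:C.
Proof. by move=> hh; rewrite DSip_seq// zip_self ?DSnorm2E//; exact: DS_zspace. Qed.

Lemma DS_fst0 h : DS S h -> comp1 h (disk0 R) = (DSseq h 0).1.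
Proof. by move=> hh; rewrite (taylor_at0 (DS_taylor1 hh)). Qed.

Lemma DS_snd0 h : DS S h -> comp2 h (disk0 R) = (DSseq h (-1)).2.
Proof. by move=> hh; rewrite (taylor_at0 (DS_taylor2 hh)). Qed.

Lemma scoef0 u : S (disk0 R) u = Sn 0 u.
Proof. by have := taylor_at0 (schur_taylor hS u). Qed.

Let adjN n y : adj (Sn n) (- y) = - adj (Sn n) y.
Proof. exact: (linN (adj_linear (scoef_bounded hS n))). Qed.

(** Shifting carries [f(0)] to position -1, where a first component must vanish. The column of
    [- f(0)] there cancels it, and its second components are the coefficients of
    [- tilde S f(0)]. *)
Lemma DSseq_R0 h : DS S h -> DS S (R0 S h) /\
  DSseq (R0 S h) = zsh 1 (DSseq h) + zgen [:: (-1, (- (DSseq h 0).1, 0))].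
Proof.
move=> hh.
have t1 := diffq0_taylor (DS_taylor1 hh).
have t2 := has_taylorB (has_taylor_mulz (DS_taylor2 hh)) (tilde_taylor hS (comp1 h (disk0 R))).
have e : zseq (fun n => taylor (comp1 h) n.+1)
    (fun k => shiftup (taylor (comp2 h)) k - adj (Sn k) (comp1 h (disk0 R)))
    = zsh 1 (DSseq h) + zgen [:: (-1, (- (DSseq h 0).1, 0))].
  rewrite DS_fst0//; apply/funext => i; rewrite [RHS]/(_ + _) /= zgen_atN1 /zsh.
  case: i => [n|[|n]].
  - rewrite (_ : Posz n + 1 = Posz n.+1) ?blk_pos ?(lin0 (Sn_lin _)) /=; last lia.
    by congr (_, _); rewrite /= addr0.
  - rewrite (_ : Negz 0 + 1 = 0)// blk_zero /= (lin0 (Sn_lin _)) addr0 adjN.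
    by congr (_, _); rewrite /= ?subrr ?addr0 ?add0r ?sub0r.
  - rewrite (_ : Negz n.+1 + 1 = Negz n) ?blk_neg /= ?adjN; last lia.
    by congr (_, _); rewrite /= addr0.
split; last by rewrite (DSseqE (h := R0 S h) t1 t2).
apply: (DS_of_taylor (h := R0 S h) t1 t2); rewrite e.
by apply: zspace_addgen; apply: zspace_sh; exact: DS_zspace.
Qed.

Lemma DSseq_R0adj h : DS S h -> DS S (R0adj S h) /\
  DSseq (R0adj S h) = zsh (-1) (DSseq h) + zgen [:: (0, (0, - (DSseq h (-1)).2))].
Proof.
move=> hh.
have t1 := has_taylorB (has_taylor_mulz (DS_taylor1 hh)) (schur_taylor hS (comp2 h (disk0 R))).
have t2 := diffq0_taylor (DS_taylor2 hh).
have e : zseq (fun k => shiftup (taylor (comp1 h)) k - Sn k (comp2 h (disk0 R)))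
    (fun n => taylor (comp2 h) n.+1)
    = zsh (-1) (DSseq h) + zgen [:: (0, (0, - (DSseq h (-1)).2))].
  rewrite DS_snd0//; apply/funext => i; rewrite [RHS]/(_ + _) /= zgen_at0 /zsh.
  case: i => [[|n]|n].
  - rewrite blk_zero /= (lin0 (adj_linear (scoef_bounded hS 0))) (linN (Sn_lin _)).
    by congr (_, _); rewrite /= ?subn0 ?addr0 ?subrr ?add0r.
  - rewrite (_ : Posz n.+1 + (-1) = Posz n) ?blk_pos ?(linN (Sn_lin _)) /=; last lia.
    by congr (_, _); rewrite /= addr0.
  - rewrite (_ : Negz n + (-1) = Negz n.+1) ?blk_neg ?(lin0 (adj_linear (scoef_bounded hS _))) /=; last lia.
    by congr (_, _); rewrite /= addr0.
split; last by rewrite (DSseqE (h := R0adj S h) t1 t2).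
apply: (DS_of_taylor (h := R0adj S h) t1 t2); rewrite e.
by apply: zspace_addgen; apply: zspace_sh; exact: DS_zspace.
Qed.

(** The adjoint of [DS_C], that is, the kernel function at the origin in the direction [(y, 0)]. *)
Definition DS_Cadj (y : Y) : disk R -> E := fun z =>
  (dBRker S z (disk0 R) y, op_diffq (tilde S) z (disk0 R) y).

Lemma dBRker_at0 (V W : hilbertType R) (T : disk R -> V -> W) z y :
  dBRker T z (disk0 R) y = y - T z (adj (T (disk0 R)) y).
Proof. by rewrite /dBRker /= rmorph0 mulr0 subr0 invr1 scale1r. Qed.

Lemma has_taylor_cst (X : hilbertType R) (x : X) :
  has_taylor (fun=> x) (fun k => if k is 0 then x else 0).
Proof.
apply/has_taylorP => z; rewrite -cvg_shiftS.
under eq_fun => n.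
  rewrite psumS /psum big1 ?scaler0 ?addr0 ?subrr ?hn0; first over.
  by move=> i _; rewrite scaler0.
exact: cvg_cst.
Qed.

(** At position -1 the first component has to vanish, which dictates the entry [- Sn 0 u] next to
    [u]. *)
Lemma DSseq_B u : DS S (DS_B S u) /\ DSseq (DS_B S u) = zgen [:: (-1, (- Sn 0 u, u))].
Proof.
have t1 := diffq0_taylor (schur_taylor hS u).
have t2 : has_taylor (comp2 (DS_B S u))
    (fun k => (if k is 0 then u else 0) - adj (Sn k) (Sn 0 u)).
  have := has_taylorB (@has_taylor_cst _ u) (tilde_taylor hS (Sn 0 u)).
  congr (has_taylor _ _); apply/funext => z; rewrite /comp2 /= dBRker_at0.
  rewrite -scoef0 /tilde.
  have -> : diskJ (disk0 R) = disk0 R by apply: val_inj; rewrite /= rmorph0.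
  by rewrite adjK//; exact: contractive_bounded (schur_contr hS _).
have e : zseq (fun k => Sn k.+1 u) (fun k => (if k is 0 then u else 0) - adj (Sn k) (Sn 0 u))
    = zgen [:: (-1, (- Sn 0 u, u))].
  apply/funext => i; rewrite zgen_atN1; case: i => [n|[|n]].
  - by rewrite (_ : Posz n + 1 = Posz n.+1) ?blk_pos//; lia.
  - by rewrite (_ : Negz 0 + 1 = 0)// blk_zero /= adjN addNr.
  - by rewrite (_ : Negz n.+1 + 1 = Negz n) ?blk_neg /= ?adjN ?sub0r//; lia.
split; last by rewrite (DSseqE (h := DS_B S u) t1 t2).
by apply: (DS_of_taylor (h := DS_B S u) t1 t2); rewrite e; exact: zspace_gen.
Qed.

Lemma DSseq_Cadj y : DS S (DS_Cadj y) /\ DSseq (DS_Cadj y) = zgen [:: (0, (y, - adj (Sn 0) y))].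
Proof.
have t2 := diffq0_taylor (tilde_taylor hS y).
have t1 : has_taylor (comp1 (DS_Cadj y))
    (fun k => (if k is 0 then y else 0) - Sn k (adj (Sn 0) y)).
  have := has_taylorB (@has_taylor_cst _ y) (schur_taylor hS (adj (Sn 0) y)).
  congr (has_taylor _ _); apply/funext => z; rewrite /comp1 /= dBRker_at0.
  by rewrite (_ : S (disk0 R) = Sn 0)//; apply/funext => u; exact: scoef0.
have e : zseq (fun k => (if k is 0 then y else 0) - Sn k (adj (Sn 0) y)) (fun k => adj (Sn k.+1) y)
    = zgen [:: (0, (y, - adj (Sn 0) y))].
  apply/funext => i; rewrite zgen_at0; case: i => [[|n]|n].
  - by rewrite blk_zero /= (linN (Sn_lin _)) addNr.
  - by rewrite blk_pos /= (linN (Sn_lin _)) sub0r.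
  - by rewrite blk_neg.
split; last by rewrite (DSseqE (h := DS_Cadj y) t1 t2).
by apply: (DS_of_taylor (h := DS_Cadj y) t1 t2); rewrite e; exact: zspace_gen.
Qed.

End DSModel.

(** * Bounded invertibility of [x - z A x] on a Hilbert space carried by a subset *)

Section Resolvent.
Variables (R : realType) (V : lmodType R[i]) (H : set V) (ip : V -> V -> R[i]).
Hypothesis hH : hilbert_on H ip.
Variables (A : V -> V) (z : R[i]).
Hypotheses (AH : forall x, H x -> H (A x)) (A_lin : linear_on H A).
Hypotheses (A_contr : forall x, H x -> ipnorm ip (A x) <= ipnorm ip x).
Hypothesis z1 : cmod z < 1.
Local Notation N := (ipnorm ip).
Let Az x : V := x - z *: A x.

Let AzH x : H x -> H (Az x).
Proof. by move=> hx; apply: (subB hH) => //; apply: (subZ hH); exact: AH. Qed.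

Let Az_lin : linear_on H Az.
Proof.
move=> a x y hx hy; rewrite /Az A_lin// scalerBr scalerDr opprD addrACA.
by rewrite !scalerA [a * z]mulrC.
Qed.

Lemma resolvent_norm x : H x -> N x <= (1 - cmod z)^-1 * N (x - z *: A x).
Proof.
by move=> hx; rewrite ler_pdivlMl ?subr_gt0//; apply: (resolvent_lower_bound hH) => //.
Qed.

Lemma resolvent_inj x y : H x -> H y -> x - z *: A x = y - z *: A y -> x = y.
Proof.
move=> hx hy e; apply/eqP; rewrite -subr_eq0; apply/eqP.
have hxy : H (x - y) by exact: (subB hH).
apply: (ipn_eq0 hH) => //; apply/eqP; rewrite eq_le ipn_ge0 andbT.
apply: le_trans (resolvent_norm hxy) _; rewrite -[_ - _ *: _]/(Az (x - y)).
have -> : x - y = (-1) *: y + x by rewrite scaleN1r addrC.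
by rewrite Az_lin// /Az e scaleN1r addNr (ipn0 hH) mulr0.
Qed.

Lemma resolvent_set_bij : set_bij H H Az.
Proof.
split; [by move=> x; exact: AzH| |].
  by move=> x y /set_mem hx /set_mem hy; exact: resolvent_inj.
by move=> h /(neumann hH AH A_lin A_contr z1)[x hx e]; exists x.
Qed.

Lemma resolvent_pinv h : H h -> H ('pinv_(fun=> 0) H Az h) /\ Az ('pinv_(fun=> 0) H Az h) = h.
Proof.
move=> hh; split.
  have [hf _ _] := bijpinv_bij (fun=> 0) resolvent_set_bij; exact: hf.
apply: pinvK; rewrite inE.
by have [x hx <-] := neumann hH AH A_lin A_contr z1 hh; exists x.
Qed.

Lemma resolvent_invertible : invertible_on H ip Az.
Proof.
split; [|exact: resolvent_set_bij|].
- split=> //; exists (1 + cmod z) => x hx; have hAx := AH hx.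
  apply: le_trans (ipnB hH hx (subZ hH z hAx)) _; rewrite (ipnZ hH)// mulrDl mul1r lerD2l.
  by rewrite ler_wpM2l ?cmod_ge0// A_contr.
- split.
    move=> a x y hx hy; have [px ex] := resolvent_pinv hx; have [py ey] := resolvent_pinv hy.
    have [pxy exy] := resolvent_pinv (subDZ hH a hx hy).
    apply: resolvent_inj => //; first exact: (subDZ hH).
    by rewrite -[LHS]/(Az _) -[RHS]/(Az _) exy Az_lin// ex ey.
  exists (1 - cmod z)^-1 => x hx; have [px ex] := resolvent_pinv hx.
  by apply: le_trans (resolvent_norm px) _; rewrite -[X in N X]/(Az _) ex.
Qed.

End Resolvent.

Lemma le_of_sqr (R : realType) (x y a b : R) :
  0 <= y -> x ^+ 2 = a -> y ^+ 2 = b -> a <= b -> x <= y.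
Proof. by move=> y0 <- <- h; rewrite leNgt; apply/negP => yx; nra. Qed.

(** * Norm identities, adjointness and the unitary colligation on D(S) *)

Section DeBrangesRovnyak.
Variables (R : realType) (U Y : hilbertType R) (S : disk R -> U -> Y).
Hypothesis hS : schur S.
Implicit Types (h f : disk R -> Y * U) (z w : disk R).

Local Notation Sn := (scoef S).
Local Notation E := (Y * U)%type.
Local Notation zpr := (@zpr R U Y).
Local Notation zgen := (zgen Sn).
Local Notation zform := (dform zpr zgen).
Local Notation zip := (dip zpr zgen).
Local Notation ipE := (dsum_ip (@inner R Y) (@inner R U)).
Local Notation ip := (DSip S).

Let hE := dsum_hilbert U Y.
Let hD := DS_hilbert hS.
Let hZ := zspace_hilbert hS.
Let Sc := scoef_contr hS.
Let Sn_lin n : linear_on setT (Sn n). Proof. exact: scoef_lin. Qed.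

Lemma zform1 j (e : E) : zform [:: (j, e)] =
  hnorm e.1 ^+ 2 + hnorm e.2 ^+ 2 + 2 * complex.Re (inner (Sn 0 e.2) e.1).
Proof.
rewrite /dform zpr1 zgen1 subrr blk_zero /dsum_ip /= !inDl adjP'; last exact: scoef_bounded.
by rewrite (inner_conj (Sn 0 e.2)) !ReD ReJ !in_self /=; ring.
Qed.

Lemma zgen1_lin j a (e e' : E) :
  zgen [:: (j, a *: e + e')] = a *: zgen [:: (j, e)] + zgen [:: (j, e')].
Proof.
apply/funext => i; rewrite -[RHS]/(a *: zgen [:: (j, e)] i + zgen [:: (j, e')] i).
by rewrite !zgen1 (blk_lin Sc).
Qed.

Lemma zgen1D j (e e' : E) : zgen [:: (j, e)] + zgen [:: (j, e')] = zgen [:: (j, e + e')].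
Proof. by rewrite -[e in RHS]scale1r zgen1_lin scale1r. Qed.

Lemma zgen1_0 j : zgen [:: (j, 0)] = 0.
Proof.
by apply: (addrI (zgen [:: (j, 0)])); rewrite zgen1D !addr0.
Qed.

Lemma zsh_lin t a (x y : int -> E) : zsh t (a *: x + y) = a *: zsh t x + zsh t y.
Proof. by []. Qed.

Lemma zsh_gen t j (e : E) : zsh t (zgen [:: (j, e)]) = zgen [:: (j - t, e)].
Proof.
by apply/funext => i; rewrite /zsh !zgen1 opprB addrA addrAC.
Qed.

Lemma zshNK t (x : int -> E) : zsh t (zsh (- t) x) = x.
Proof. by apply/funext => i; rewrite /zsh addrK. Qed.

Lemma DS_R0 h : DS S h -> DS S (R0 S h).
Proof. by move=> /(DSseq_R0 hS)[]. Qed.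

Lemma DS_R0adj h : DS S h -> DS S (R0adj S h).
Proof. by move=> /(DSseq_R0adj hS)[]. Qed.

Lemma DSnorm2_ipnorm h : DS S h -> ipnorm ip h ^+ 2 = DSnorm2 S h.
Proof.
move=> hh; apply: complexI; rewrite -(ip_self hD hh); exact: DSip_self.
Qed.

(** The shift keeps the energy; the correction adds [-2 |f(0)|^2] through the pairing and [|f(0)|^2]
    through the form. *)
Lemma DSnorm2_R0 h : DS S h ->
  DSnorm2 S (R0 S h) = DSnorm2 S h - hnorm (comp1 h (disk0 R)) ^+ 2.
Proof.
move=> hh; have [hR eR] := DSseq_R0 hS hh.
rewrite !(DSnorm2E hS)// eR zenergy_addgen//; last by apply: zspace_sh; exact: DS_zspace.
rewrite zenergy_sh ?zform1 ?zpr1; last exact: DS_zspace.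
rewrite /zsh addNr (DS_fst0 hh) /dsum_ip /= in0r addr0 inNr ReN in_self /= hnN hn0.
by rewrite (lin0 (Sn_lin _)) in0l /=; ring.
Qed.

Lemma DSnorm2_R0adj h : DS S h ->
  DSnorm2 S (R0adj S h) = DSnorm2 S h - hnorm (comp2 h (disk0 R)) ^+ 2.
Proof.
move=> hh; have [hR eR] := DSseq_R0adj hS hh.
rewrite !(DSnorm2E hS)// eR zenergy_addgen//; last by apply: zspace_sh; exact: DS_zspace.
rewrite zenergy_sh ?zform1 ?zpr1; last exact: DS_zspace.
rewrite /zsh add0r (DS_snd0 hh) [(_, _).1]/= [(_, _).2]/= {1}/dsum_ip [(_, _).1]/= [(_, _).2]/=.
by rewrite !in0r add0r inNr ReN in_self [complex.Re _]/= hnN hn0 [complex.Re 0]/=; ring.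
Qed.

Lemma DSip_R0 x y : DS S x -> DS S y -> ip (R0 S x) y = ip x (R0adj S y).
Proof.
move=> hx hy; have [hR eR] := DSseq_R0 hS hx; have [hA eA] := DSseq_R0adj hS hy.
have zx := DS_zspace hS hx; have zy := DS_zspace hS hy.
rewrite (DSip_seq hS hR hy) (DSip_seq hS hx hA) eR eA.
rewrite (ipDl hZ (zspace_sh 1 zx) (zspace_gen hS _) zy).
rewrite (ipDr hZ (zspace_sh (-1) zy) (zspace_gen hS _) zx).
have -> : zip (zsh 1 (DSseq x)) (DSseq y) = zip (DSseq x) (zsh (-1) (DSseq y)).
  by rewrite -[in LHS](zshNK 1 (DSseq y)) (zip_sh hS 1 zx (zspace_sh (-1) zy)).
rewrite -(ipJ hZ zy (zspace_gen hS _)) !(zip_gen hS)// !zpr1 /dsum_ip /= !in0r in0l.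
by rewrite in0l addr0 rmorph0.
Qed.

Lemma R0_lin : linear_on (DS S) (R0 S).
Proof.
move=> a x y hx hy; have hxy := DS_lin hS a hx hy.
have [h1 e1] := DSseq_R0 hS hx; have [h2 e2] := DSseq_R0 hS hy; have [h3 e3] := DSseq_R0 hS hxy.
apply: (@DSseq_inj _ _ _ S) => //; first exact: DS_lin.
rewrite (@DSseq_lin _ _ _ S)// e1 e2 e3 (@DSseq_lin _ _ _ S)// zsh_lin scalerDr addrACA -zgen1_lin.
congr (_ + zgen [:: (_, _)]).
by congr (_, _); rewrite /= ?scaler0 ?addr0// opprD scalerN.
Qed.

Lemma R0adj_lin : linear_on (DS S) (R0adj S).
Proof.
move=> a x y hx hy; have hxy := DS_lin hS a hx hy.
have [h1 e1] := DSseq_R0adj hS hx; have [h2 e2] := DSseq_R0adj hS hy; have [h3 e3] := DSseq_R0adj hS hxy.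
apply: (@DSseq_inj _ _ _ S) => //; first exact: DS_lin.
rewrite (@DSseq_lin _ _ _ S)// e1 e2 e3 (@DSseq_lin _ _ _ S)// zsh_lin scalerDr addrACA -zgen1_lin.
congr (_ + zgen [:: (_, _)]).
by congr (_, _); rewrite /= ?scaler0 ?addr0// opprD scalerN.
Qed.

Lemma DS_B_lin : linear_on setT (DS_B S).
Proof.
move=> a x y _ _.
have [h1 e1] := DSseq_B hS x; have [h2 e2] := DSseq_B hS y; have [h3 e3] := DSseq_B hS (a *: x + y).
apply: (@DSseq_inj _ _ _ S) => //; first exact: DS_lin.
rewrite (@DSseq_lin _ _ _ S)// e1 e2 e3 -zgen1_lin; congr (zgen [:: (_, _)]).
by congr (_, _); rewrite /= Sn_lin// opprD scalerN.
Qed.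

Lemma R0_contr h : DS S h -> ipnorm ip (R0 S h) <= ipnorm ip h.
Proof.
move=> hh; apply: (le_of_sqr (ipn_ge0 _ _) (DSnorm2_ipnorm (DS_R0 hh)) (DSnorm2_ipnorm hh)).
by rewrite (DSnorm2_R0 hh) gerBl sqr_ge0.
Qed.

Lemma R0adj_contr h : DS S h -> ipnorm ip (R0adj S h) <= ipnorm ip h.
Proof.
move=> hh; apply: (le_of_sqr (ipn_ge0 _ _) (DSnorm2_ipnorm (DS_R0adj hh)) (DSnorm2_ipnorm hh)).
by rewrite (DSnorm2_R0adj hh) gerBl sqr_ge0.
Qed.

Lemma DSnorm2_ge0 h : DS S h -> 0 <= DSnorm2 S h.
Proof. by move=> hh; have := sqr_ge0 (ipnorm ip h); rewrite DSnorm2_ipnorm. Qed.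

Lemma fst0_le h : DS S h -> hnorm (comp1 h (disk0 R)) <= ipnorm ip h.
Proof.
move=> hh; apply: (le_of_sqr (ipn_ge0 _ _) erefl (DSnorm2_ipnorm hh)).
by rewrite -subr_ge0 -(DSnorm2_R0 hh) DSnorm2_ge0//; exact: DS_R0.
Qed.

Lemma snd0_le h : DS S h -> hnorm (comp2 h (disk0 R)) <= ipnorm ip h.
Proof.
move=> hh; apply: (le_of_sqr (ipn_ge0 _ _) erefl (DSnorm2_ipnorm hh)).
by rewrite -subr_ge0 -(DSnorm2_R0adj hh) DSnorm2_ge0//; exact: DS_R0adj.
Qed.

Lemma DS_analytic1 h : DS S h -> analytic (comp1 h).
Proof. by move=> /(DS_spec hS)[]. Qed.

Lemma DS_analytic2 h : DS S h -> analytic (comp2 h).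
Proof. by move=> /(DS_spec hS)[]. Qed.

Lemma DSseq_U h u : DS S h -> DS S (R0 S h + DS_B S u) /\
  DSseq (R0 S h + DS_B S u)
    = zsh 1 (DSseq h) + zgen [:: (-1, (- (comp1 h (disk0 R) + S (disk0 R) u), u))].
Proof.
move=> hh; have [h1 e1] := DSseq_R0 hS hh; have [h2 e2] := DSseq_B hS u.
have e : R0 S h + DS_B S u = 1 *: R0 S h + DS_B S u by rewrite scale1r.
rewrite e; split; first exact: DS_lin.
rewrite (@DSseq_lin _ _ _ S)// e1 e2 scale1r -addrA zgen1D (scoef0 hS) (DS_fst0 hh).
congr (_ + zgen [:: (_, _)]).
by congr (_, _); rewrite /= ?opprD ?add0r.
Qed.

(** With [y = f(0) + S(0) u], the correction by the mass [(- y, u)] changes the energy by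
    [|u|^2 - |y|^2]. *)
Lemma DS_U_norm h u : DS S h ->
  DSnorm2 S (R0 S h + DS_B S u) + hnorm (comp1 h (disk0 R) + S (disk0 R) u) ^+ 2
  = DSnorm2 S h + hnorm u ^+ 2.
Proof.
move=> hh; have [h1 e1] := DSseq_U u hh; have zh := DS_zspace hS hh.
rewrite !(DSnorm2E hS)// e1 zenergy_addgen//; last exact: zspace_sh.
rewrite zenergy_sh// zform1 zpr1 /zsh addNr (DS_fst0 hh) (scoef0 hS).
rewrite /dsum_ip [(_, _).1]/= [(_, _).2]/= in0l addr0 hnN !inNr !ReN.
have := congr1 (@complex.Re R) (in_self ((DSseq h 0).1 + Sn 0 u)).
rewrite {1}inDl ReD [in RHS]/=; lra.
Qed.

Lemma inner_polar (X : hilbertType R) (x y : X) :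
  inner x y = polar (fun c : R[i] => hnorm (x + c *: y) ^+ 2).
Proof.
rewrite -[LHS](polar_lin (inner x y)) -[LHS]addr0 -(polar_cst (hnorm x ^+ 2 + hnorm y ^+ 2)) -polarD.
apply: eq_polar => c c1; rewrite hn2D hnZ c1 mul1r inZr; ring.
Qed.

Lemma DS_U_lin : linear_on (DS S `*` setT) (DS_U S).
Proof.
move=> a [h u] [k v] [/= hh _] [/= hk _]; rewrite /DS_U /=; congr (_, _).
  by rewrite R0_lin// DS_B_lin// [RHS]/= scalerDr addrACA.
rewrite /DS_C /DS_D (proj1 (schur_contr hS _))//= scalerDr addrACA.
by congr (_ + _).
Qed.

Lemma DS_U_unitary : unitary_on (DS S `*` setT) (dsum_ip ip (@inner R U))
  (DS S `*` setT) (dsum_ip ip (@inner R Y)) (DS_U S).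
Proof.
split; first exact: DS_U_lin.
- apply/seteqP; split=> [_ [[h u] [/= hh _] <-]|[k y] [/= hk _]].
    by split=> //=; case: (DSseq_U u hh).
  (* The preimage [(x, v)] is the value of the adjoint colligation at [(k, y)]. *)
  pose v := comp2 k (disk0 R) + adj (Sn 0) y.
  have [h1 e1] := DSseq_R0adj hS hk; have [h2 e2] := DSseq_Cadj hS y.
  pose x := R0adj S k + DS_Cadj S y.
  have ex : x = 1 *: R0adj S k + DS_Cadj S y by rewrite scale1r.
  have hx : DS S x by rewrite ex; exact: DS_lin.
  have xE : DSseq x = zsh (-1) (DSseq k) + zgen [:: (0, (y, - v))].
    rewrite ex (@DSseq_lin _ _ _ S)// e1 e2 scale1r -addrA zgen1D.
    congr (_ + zgen [:: (_, _)]).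
    by congr (_, _); rewrite /= ?add0r// -opprD /v (DS_snd0 hk).
  have x0 : comp1 x (disk0 R) + S (disk0 R) v = y.
    rewrite (DS_fst0 hx) xE (scoef0 hS) [(_ + _) 0]/(_ + _) zgen1 blk_zero /=.
    by rewrite (linN (Sn_lin _)) add0r subrK.
  have [h3 e3] := DSseq_U v hx.
  exists (x, v) => //; rewrite /DS_U /=; congr (_, _); last exact: x0.
  apply: (@DSseq_inj _ _ _ S) => //; rewrite e3 x0 xE.
  rewrite -[zsh (-1) (DSseq k)]scale1r zsh_lin scale1r zshNK zsh_gen sub0r -addrA zgen1D.
  have -> : ((y, - v) + (- y, v) : E) = 0 by congr (_, _); rewrite /= ?subrr ?addNr.
  by rewrite zgen1_0 addr0.
- move=> [h u] [k v] [/= hh _] [/= hk _].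
  (* [DS_U_norm] at [(h + c k, u + c v)] gives [F1 c + F2 c = G1 c + G2 c]; polarizing both sides
     gives the identity for inner products. *)
  pose F1 c := DSnorm2 S (R0 S h + DS_B S u + c *: (R0 S k + DS_B S v)).
  pose F2 c := hnorm (DS_C h + DS_D S u + c *: (DS_C k + DS_D S v)) ^+ 2.
  pose G1 c := DSnorm2 S (h + c *: k).
  pose G2 c := hnorm (u + c *: v) ^+ 2.
  have eF : dsum_ip ip (@inner R Y) (DS_U S (h, u)) (DS_U S (k, v)) = polar F1 + polar F2.
    by congr (_ + _); exact: inner_polar.
  have eG : dsum_ip ip (@inner R U) (h, u) (k, v) = polar G1 + polar G2.
    by congr (_ + _); exact: inner_polar.
  rewrite eF eG; apply: (etrans (esym (polarD F1 F2))); apply: (etrans _ (polarD G1 G2)).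
  apply: eq_polar => c _.
  have hck : DS S (c *: k + h) by exact: DS_lin.
  have e := DS_U_lin c (x := (k, v)) (y := (h, u)) (conj hk I) (conj hh I).
  have e1 : R0 S (c *: k + h) + DS_B S (c *: v + u) = c *: (R0 S k + DS_B S v) + (R0 S h + DS_B S u).
    exact: (congr1 fst e).
  have e2 : comp1 (c *: k + h) (disk0 R) + S (disk0 R) (c *: v + u)
      = c *: (DS_C k + DS_D S v) + (DS_C h + DS_D S u) by exact: (congr1 snd e).
  have := DS_U_norm (c *: v + u) hck; rewrite e1 e2 /F1 /F2 /G1 /G2.
  by rewrite [c *: (R0 S k + _) + _]addrC [c *: (DS_C k + _) + _]addrC [c *: k + h]addrC [c *: v + u]addrC.
Qed.

(** * Point evaluations, the reproducing kernel and the transfer function *)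

Let S_lin z : linear_on setT (S z). Proof. by case: (schur_contr hS z). Qed.
Let S_bd z : bounded_op (S z). Proof. exact: contractive_bounded (schur_contr hS z). Qed.
Let tS_lin z : linear_on setT (tilde S z). Proof. exact: adj_linear (S_bd _). Qed.

Let diskJK z : diskJ (diskJ z) = z.
Proof. by apply: val_inj; rewrite /= conjCK. Qed.

Let diskJ0 : diskJ (disk0 R) = disk0 R.
Proof. by apply: val_inj; rewrite /= rmorph0. Qed.

(** At the point [w], [w R0 x] has first component [x_1(w) - x_1(0)]. Evaluation at [w] thus becomes
    evaluation at 0 of the resolvent, which the norm identities control. *)
Lemma resolvent_eval1 x h w : DS S x -> x - (w : R[i]) *: R0 S x = h ->
  comp1 h w = comp1 x (disk0 R).
Proof.
move=> hx <-; rewrite -[LHS]/(comp1 x w - (w : R[i]) *: diffq (comp1 x) w (disk0 R)).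
by rewrite (diffq0_mulz w (DS_analytic1 hx)) subKr.
Qed.

Lemma resolvent_eval2 x h w : DS S x -> x - (w : R[i]) *: R0adj S x = h ->
  comp2 h w = comp2 x (disk0 R).
Proof.
move=> hx <-; rewrite -[LHS]/(comp2 x w - (w : R[i]) *: diffq (comp2 x) w (disk0 R)).
by rewrite (diffq0_mulz w (DS_analytic2 hx)) subKr.
Qed.

Lemma R0_resolvent w h : DS S h -> exists2 x, DS S x & x - (w : R[i]) *: R0 S x = h.
Proof.
exact: (neumann hD DS_R0 R0_lin R0_contr (disk_cmod w)).
Qed.

Lemma R0adj_resolvent w h : DS S h -> exists2 x, DS S x & x - (w : R[i]) *: R0adj S x = h.
Proof.
exact: (neumann hD DS_R0adj R0adj_lin R0adj_contr (disk_cmod w)).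
Qed.

Lemma DS_eval_bound w h : DS S h ->
  ipnorm ipE (h w) <= 2 * (1 - cmod w)^-1 * ipnorm ip h.
Proof.
move=> hh; apply: (le_trans (dsum_le (h w))).
rewrite -[leRHS]mulrA mulr_natl mulr2n; apply: lerD.
  have [x hx e] := R0_resolvent w hh.
  rewrite -[(h w).1]/(comp1 h w) (resolvent_eval1 hx e).
  apply: (le_trans (fst0_le hx)).
  have := resolvent_norm hD DS_R0 R0_contr (disk_cmod w) hx.
  by rewrite e.
have [x hx e] := R0adj_resolvent w hh.
rewrite -[(h w).2]/(comp2 h w) (resolvent_eval2 hx e).
apply: (le_trans (snd0_le hx)).
have := resolvent_norm hD DS_R0adj R0adj_contr (disk_cmod w) hx.
by rewrite e.
Qed.

Lemma analytic_cst (V : hilbertType R) (v : V) : analytic (fun _ : disk R => v).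
Proof. by eexists; exact: (@has_taylor_cst _ V v). Qed.

Lemma diffq_cst (V : hilbertType R) (v : V) z w : diffq (fun _ : disk R => v) z w = 0.
Proof.
apply: (@diffqE _ _ (fun=> v) (fun=> 0)); first exact: analytic_cst.
by move=> t; rewrite subrr scaler0.
Qed.

Lemma op_diffq0 (V W : hilbertType R) (T : disk R -> V -> W) z w :
  (forall s, linear_on setT (T s)) -> op_diffq T z w 0 = 0.
Proof.
move=> hT; rewrite /op_diffq (_ : (fun s => T s 0) = fun=> 0) ?diffq_cst//.
by apply/funext => s; exact: (lin0 (hT s)).
Qed.

Lemma dBRker0 (V W : hilbertType R) (T : disk R -> V -> W) z w :
  (forall s, bounded_op (T s)) -> dBRker T z w 0 = 0.
Proof.
move=> hT; rewrite /dBRker (lin0 (adj_linear (hT w))) (lin0 (proj1 (hT z))).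
by rewrite subrr scaler0.
Qed.

(* The hypothesis reads [(I - c R_0) g = R_0 T]. *)
Lemma resolvent_diffq (V : hilbertType R) (T g : disk R -> V) (c : disk R) :
  analytic T -> analytic g ->
  (forall z, g z - (c : R[i]) *: diffq g z (disk0 R) = diffq T z (disk0 R)) ->
  (forall z, diffq T z c = g z) /\ (c : R[i]) *: g (disk0 R) = T c - T (disk0 R).
Proof.
move=> hT hg H.
(* Multiplying by [z] clears the quotients. Setting [z = c] gives the second claim, and subtracting
   it leaves [(z - c) g z = T z - T c], ready for [diffqE]. *)
have H2 z : (z : R[i]) *: g z - (c : R[i]) *: (g z - g (disk0 R)) = T z - T (disk0 R).
  rewrite -(diffq0_mulz z hT) -(diffq0_mulz z hg) -H [RHS]scalerBr; congr (_ - _).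
  by rewrite !scalerA mulrC.
have H3 : (c : R[i]) *: g (disk0 R) = T c - T (disk0 R) by rewrite -H2 -scalerBr subKr.
split=> //; apply: diffqE => // z.
rewrite -(subrKA (T (disk0 R))) -H2 -[T (disk0 R) - T c]opprB -H3 scalerBr opprB.
by rewrite addrA addrAC addrK scalerBl.
Qed.

(** Eliminate [a] and divide by [1 - z c], which is nonzero because [|z c| < 1]. *)
Lemma resolvent_dBRker (V : lmodType R[i]) (c z : disk R) (x y a b d : V) :
  x - (c : R[i]) *: ((z : R[i]) *: x - a) = y - b -> (c : R[i]) *: a = d - b ->
  x = (1 - (z : R[i]) * (c : R[i]))^-1 *: (y - d).
Proof.
move=> H1 H2; have nz : 1 - (z : R[i]) * (c : R[i]) != 0.
  rewrite subr_eq0 eq_sym; apply/negP => /eqP e.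
  have := congr1 (@cmod R) e; rewrite cmodM cmod1 => e2.
  have := disk_cmod z; have := disk_cmod c; have := cmod_ge0 (z : R[i]); have := cmod_ge0 (c : R[i]).
  by nra.
apply: (scalerI nz); rewrite scalerA divff// scale1r scalerBl scale1r.
move: H1; rewrite scalerBr H2 scalerA [(c : R[i]) * _]mulrC opprB addrCA => H1.
apply: (addrI (d - b)); rewrite H1.
by rewrite [RHS]addrC addrA subrK.
Qed.

(** The second component is solved first, since its value at 0 enters the equation for the first
    one. *)
Lemma DSker_fst w y : exists2 x, DS S x & x - ((w : R[i])^*) *: R0adj S x = DS_Cadj S y /\
  forall z, x z = DSker S z w (y, 0).
Proof.
have [hC _] := DSseq_Cadj hS y; have [x hx e] := R0adj_resolvent (diskJ w) hC.
exists x => //; split=> // z; pose c := diskJ w.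
have e2 t : comp2 x t - (c : R[i]) *: diffq (comp2 x) t (disk0 R) = op_diffq (tilde S) t (disk0 R) y.
  exact: (congr1 (fun f => (f t).2) e).
have hT : analytic (fun t => tilde S t y) by eexists; exact: (tilde_taylor hS y).
have [q2 q0] := resolvent_diffq hT (DS_analytic2 hx) e2.
have e1 : comp1 x z - (c : R[i]) *: ((z : R[i]) *: comp1 x z - S z (comp2 x (disk0 R)))
    = y - S z (adj (S (disk0 R)) y).
  by rewrite -dBRker_at0; exact: (congr1 (fun f => (f z).1) e).
have f1 : comp1 x z = dBRker S z w y.
  apply: (resolvent_dBRker e1); rewrite -(linZ (S_lin z)) q0 /tilde /c diskJK diskJ0.
  exact: (linB (S_lin z)).
rewrite [LHS]surjective_pairing; congr (_, _).
  by rewrite -[LHS]/(comp1 x z) f1 /= op_diffq0 ?addr0.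
rewrite -[LHS]/(comp2 x z) /= dBRker0 ?addr0; first by rewrite /op_diffq q2.
by move=> s; apply: adj_bounded.
Qed.

Lemma DSker_snd w u : exists2 x, DS S x & x - ((w : R[i])^*) *: R0 S x = DS_B S u /\
  forall z, x z = DSker S z w (0, u).
Proof.
have [hB _] := DSseq_B hS u; have [x hx e] := R0_resolvent (diskJ w) hB.
exists x => //; split=> // z; pose c := diskJ w.
have e1 t : comp1 x t - (c : R[i]) *: diffq (comp1 x) t (disk0 R) = op_diffq S t (disk0 R) u.
  exact: (congr1 (fun f => (f t).1) e).
have hT : analytic (fun t => S t u) by eexists; exact: (schur_taylor hS u).
have [q1 q0] := resolvent_diffq hT (DS_analytic1 hx) e1.
have tJ t : adj (tilde S t) = S (diskJ t) by rewrite /tilde adjK.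
have e2 : comp2 x z - (c : R[i]) *: ((z : R[i]) *: comp2 x z - tilde S z (comp1 x (disk0 R)))
    = u - tilde S z (adj (tilde S (disk0 R)) u).
  by rewrite -dBRker_at0; exact: (congr1 (fun f => (f z).2) e).
have f2 : comp2 x z = dBRker (tilde S) z w u.
  apply: (resolvent_dBRker e2); rewrite -(linZ (tS_lin z)) q0 !tJ diskJ0.
  exact: (linB (tS_lin z)).
rewrite [LHS]surjective_pairing; congr (_, _).
  by rewrite -[LHS]/(comp1 x z) /= dBRker0 ?add0r// /op_diffq q1.
by rewrite -[LHS]/(comp2 x z) f2 /= op_diffq0 ?add0r.
Qed.

Lemma DSker_split z w (e : E) : DSker S z w e = DSker S z w (e.1, 0) + DSker S z w (0, e.2).
Proof.
rewrite /DSker; congr (_, _); rewrite /= op_diffq0 ?dBRker0 ?addr0 ?add0r// => s.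
exact: adj_bounded.
Qed.

(** Write [f = p - w R0 p]. Then [f_1(w) = p_1(0)] is the product of [p] with [DS_Cadj S e.1], hence
    with [x - conj w R0adj x]; moving [R0adj] across makes it the product of [f] with [x]. The
    second component is symmetric. *)
Lemma DSker_DS w (e : E) : DS S (fun z => DSker S z w e) /\
  forall f, DS S f -> ip f (fun z => DSker S z w e) = ipE (f w) e.
Proof.
have [x hx [ex xE]] := DSker_fst w e.1; have [y hy [ey yE]] := DSker_snd w e.2.
have -> : (fun z => DSker S z w e) = x + y.
  by apply/funext => z; rewrite DSker_split -xE -yE.
split=> [|f hf]; first exact: (subD hD).
rewrite (ipDr hD hx hy hf) /dsum_ip; congr (_ + _).
- have [p hp ep] := R0_resolvent w hf; rewrite -[(f w).1]/(comp1 f w) (resolvent_eval1 hp ep) -ep.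
  have [hC eC] := DSseq_Cadj hS e.1; have hRp := DS_R0 hp; have hRx := DS_R0adj hx.
  rewrite (ipBl hD hp (subZ hD (w : R[i]) hRp) hx) (ipZl hD (w : R[i]) hRp hx) (DSip_R0 hp hx).
  have -> : (w : R[i]) * ip p (R0adj S x) = ip p ((w : R[i])^* *: R0adj S x).
    by rewrite (ipZr hD _ hRx hp) conjCK.
  rewrite -(ipBr hD hx (subZ hD _ hRx) hp) ex (DSip_seq hS hp hC) eC (zip_gen hS _ (DS_zspace hS hp)) zpr1.
  by rewrite /dsum_ip /= in0l addr0 (DS_fst0 hp).
- have [p hp ep] := R0adj_resolvent w hf; rewrite -[(f w).2]/(comp2 f w) (resolvent_eval2 hp ep) -ep.
  have [hB eB] := DSseq_B hS e.2; have hRp := DS_R0adj hp; have hRy := DS_R0 hy.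
  rewrite (ipBl hD hp (subZ hD (w : R[i]) hRp) hy) (ipZl hD (w : R[i]) hRp hy).
  have -> : ip (R0adj S p) y = ip p (R0 S y).
    by rewrite -(ipJ hD hy hRp) -(DSip_R0 hy hp) (ipJ hD hRy hp).
  have -> : (w : R[i]) * ip p (R0 S y) = ip p ((w : R[i])^* *: R0 S y).
    by rewrite (ipZr hD _ hRy hp) conjCK.
  rewrite -(ipBr hD hy (subZ hD _ hRy) hp) ey (DSip_seq hS hp hB) eB (zip_gen hS _ (DS_zspace hS hp)) zpr1.
  by rewrite /dsum_ip /= in0l add0r (DS_snd0 hp).
Qed.

Lemma DS_rkhs : is_rkhs ipE (DSker S) (DS S) ip.
Proof.
split; [exact: hE|exact: hD| |by move=> w e; case: (DSker_DS w e)|].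
  move=> z w; pose k e : disk R -> E := fun t => DSker S t w e.
  have hk e : DS S (k e) by case: (DSker_DS w e).
  have rep e f : DS S f -> ip f (k e) = ipE (f w) e by case: (DSker_DS w e) => _; apply.
  (* Linearity comes from the reproducing property: the defect is orthogonal to D(S), itself
     included. *)
  have k_lin a e e' : k (a *: e + e') = a *: k e + k e'.
    have hs : DS S (a *: k e + k e') by exact: (subDZ hD).
    have hs' : DS S (k (a *: e + e') - (a *: k e + k e')) by exact: (subB hD).
    apply/eqP; rewrite -subr_eq0; apply/eqP; apply: (ipn_eq0 hD hs').
    suff h0 f : DS S f -> ip f (k (a *: e + e') - (a *: k e + k e')) = 0.
      by rewrite /ipnorm (h0 _ hs') sqrtr0.
    move=> hf; rewrite (ipBr hD (hk _) hs hf) (ipDr hD (subZ hD a (hk e)) (hk e') hf).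
    rewrite (ipZr hD a (hk e) hf) !(rep _ _ hf).
    by rewrite (ipDr hE)// (ipZr hE)// subrr.
  split; first by move=> a e e' _ _; exact: (congr1 (fun f => f z) (k_lin a e e')).
  pose C (t : disk R) := 2 * (1 - cmod t)^-1.
  have C0 t : 0 <= C t by rewrite mulr_ge0// invr_ge0 subr_ge0 ltW// disk_cmod.
  exists (C z * C w) => e _; apply: (le_trans (DS_eval_bound z (hk e))).
  rewrite -[leRHS]mulrA; apply: (@ler_wpM2l _ (C z)) => //.
  have h2 : ipnorm ip (k e) ^+ 2 = complex.Re (ip (k e) (k e)) by rewrite (ip_self hD (hk e)).
  have h3 := DS_eval_bound w (hk e).
  (* [|k e|^2] is the product of [k e w] with [e]; with the bound on evaluation at [w] this gives
     [|k e| <= C w * |e|]. *)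
  have h4 : ipnorm ip (k e) ^+ 2 <= ipnorm ipE (k e w) * ipnorm ipE e.
    rewrite h2 (rep _ _ (hk e)).
    by apply: le_trans (Re_le_cmod _) (ip_CS hE _ _).
  have n1 := ipn_ge0 ip (k e); have n2 := ipn_ge0 ipE e; have n3 := C0 w.
  rewrite -/(C w) in h3; move: (ipnorm ip (k e)) (ipnorm ipE e) (ipnorm ipE (k e w)) (C w) h3 h4 n1 n2 n3.
  move=> p q s c h3 h4 n1 n2 n3.
  have [->|p0] := eqVneq p 0; first by rewrite mulr_ge0.
  have p1 : 0 < p by rewrite lt_def p0.
  rewrite -(ler_pM2l p1) -expr2; apply: (le_trans h4).
  have : s * q <= c * p * q by rewrite ler_wpM2r.
  by move/le_trans; apply; apply: le_of_eq; ring.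
by move=> f w e hf; case: (DSker_DS w e) => _; apply.
Qed.

Lemma transfer_realization z : let A_z := fun h => h - (z : R[i]) *: R0 S h in
  invertible_on (DS S) ip A_z /\ forall u : U, S z u
    = DS_D S u + (z : R[i]) *: DS_C ('pinv_(fun=> 0) (DS S) A_z (DS_B S u)).
Proof.
split; first exact: (resolvent_invertible hD DS_R0 R0_lin R0_contr (disk_cmod z)).
move=> u; have [hB _] := DSseq_B hS u.
have [hx ex] := resolvent_pinv hD DS_R0 R0_lin R0_contr (disk_cmod z) hB.
rewrite /DS_C -(resolvent_eval1 hx ex) -[comp1 (DS_B S u) z]/(diffq (fun t => S t u) z (disk0 R)).
rewrite diffq0_mulz; first by rewrite addrC subrK.
by eexists; exact: (schur_taylor hS u).
Qed.

End DeBrangesRovnyak.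

(** * Square roots of [I - G] for a selfadjoint contraction [G] *)

Section DefectSqrt.
Variables (R : realType) (X : hilbertType R).
Implicit Types (G : X -> X) (x y : X).
Local Notation ipX := (@inner R X).

Lemma hcvg_unique (u : nat -> X) (a b : X) :
  (fun n => hnorm (u n - a)) @ \oo --> (0 : R) ->
  (fun n => hnorm (u n - b)) @ \oo --> (0 : R) -> a = b.
Proof. exact: (ip_limit_unique (hilbert_onT X)). Qed.

(* [1 - sqrt_iter G n] converges to the square root of [1 - G]. *)
Fixpoint sqrt_iter G n x : X :=
  if n is m.+1 then (2^-1)%:C *: (G x + sqrt_iter G m (sqrt_iter G m x)) else 0.

(** The same iteration for the scalar [G = 1]; it majorizes the operator iteration and its
    increments. *)
Fixpoint sqrt_bound n : R := if n is m.+1 then (1 + sqrt_bound m ^+ 2) / 2 else 0.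

Lemma sqrt_bound_01 n : 0 <= sqrt_bound n <= 1.
Proof. by elim: n => [|n /andP[h0 h1]] /=; [rewrite lexx ler01|apply/andP; split; nra]. Qed.

Lemma sqrt_iter_lin G n : linear_on setT G -> linear_on setT (sqrt_iter G n).
Proof.
move=> hG; elim: n => [|n IH] a x y _ _ /=; first by rewrite scaler0 addr0.
rewrite hG// IH// IH// addrACA -scalerDr [LHS]scalerDr !scalerA; congr (_ *: _ + _).
by rewrite mulrC.
Qed.

Lemma sqrt_iter_bound G n x : (forall x, hnorm (G x) <= hnorm x) ->
  hnorm (sqrt_iter G n x) <= sqrt_bound n * hnorm x.
Proof.
move=> hG; elim: n x => [|n IH] x /=; first by rewrite hn0 mul0r.
have /andP[b0 _] := sqrt_bound_01 n.
rewrite hnZ cmodR ger0_norm ?invr_ge0//.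
have h1 := hnD (G x) (sqrt_iter G n (sqrt_iter G n x)).
have h2 := IH (sqrt_iter G n x).
have h3 : sqrt_bound n * hnorm (sqrt_iter G n x) <= sqrt_bound n * (sqrt_bound n * hnorm x).
  by rewrite ler_wpM2l.
have h4 := hG x; rewrite expr2; lra.
Qed.

(** With consecutive iterates [P] and [Q], write [P P - Q Q = P (P - Q) + (P - Q) Q]; the scalar
    bounds recombine into the difference of squares of [sqrt_bound]. *)
Lemma sqrt_iter_incr G n x : linear_on setT G -> (forall x, hnorm (G x) <= hnorm x) ->
  hnorm (sqrt_iter G n.+1 x - sqrt_iter G n x) <= (sqrt_bound n.+1 - sqrt_bound n) * hnorm x.
Proof.
move=> lG hG; elim: n x => [|n IH] x.
  by rewrite !subr0; exact: (sqrt_iter_bound 1 x hG).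
pose P := sqrt_iter G n.+1; pose Q := sqrt_iter G n.
have -> : sqrt_iter G n.+2 x - sqrt_iter G n.+1 x = (2^-1)%:C *: (P (P x - Q x) + (P (Q x) - Q (Q x))).
  have -> : P (P x - Q x) = P (P x) - P (Q x) by exact: (linB (sqrt_iter_lin n.+1 lG)).
  rewrite subrKA.
  rewrite -[LHS]/((2^-1)%:C *: (G x + P (P x)) - (2^-1)%:C *: (G x + Q (Q x))) -scalerBr.
  by rewrite opprD addrACA subrr add0r.
have /andP[b0 _] := sqrt_bound_01 n; have /andP[c0 _] := sqrt_bound_01 n.+1.
rewrite hnZ cmodR ger0_norm ?invr_ge0//.
have h1 := hnD (P (P x - Q x)) (P (Q x) - Q (Q x)).
have h2 := sqrt_iter_bound n.+1 (P x - Q x) hG.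
have h3 : sqrt_bound n.+1 * hnorm (P x - Q x)
    <= sqrt_bound n.+1 * ((sqrt_bound n.+1 - sqrt_bound n) * hnorm x) by rewrite ler_wpM2l.
have h4 := IH (Q x).
have inc : 0 <= sqrt_bound n.+1 - sqrt_bound n by have /= := sqr_ge0 (sqrt_bound n - 1); nra.
have h5 : (sqrt_bound n.+1 - sqrt_bound n) * hnorm (Q x)
    <= (sqrt_bound n.+1 - sqrt_bound n) * (sqrt_bound n * hnorm x).
  by rewrite ler_wpM2l// sqrt_iter_bound.
have -> : sqrt_bound n.+2 - sqrt_bound n.+1 = 2^-1 * (sqrt_bound n.+1 ^+ 2 - sqrt_bound n ^+ 2).
  have := erefl (sqrt_bound n.+1); rewrite {2}/sqrt_bound -/sqrt_bound => e.
  rewrite -[sqrt_bound n.+2]/((1 + sqrt_bound n.+1 ^+ 2) / 2).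
  by move: (sqrt_bound n.+1) (sqrt_bound n) e => p q e; rewrite {2}e; field.
rewrite -mulrA; apply: ler_wpM2l; first by rewrite invr_ge0.
apply: (le_trans h1); apply: (le_trans (lerD h2 h4)); apply: (le_trans (lerD h3 h5)).
by apply: le_of_eq; ring.
Qed.

(** The limit [L] of the iteration solves [2 L = G + L^2], that is, the square of [I - L] is
    [I - G]. The last conclusion keeps track of the approximation for the sake of intertwining
    relations. *)
Lemma defect_sqrt G : linear_on setT G -> (forall x, hnorm (G x) <= hnorm x) ->
  (forall x y, ipX (G x) y = ipX x (G y)) ->
  exists Q : X -> X, [/\ linear_on setT Q, forall x y, ipX (Q x) y = ipX x (Q y),
    forall x, Q (Q x) = x - G x
    & forall x, (fun n => hnorm (x - sqrt_iter G n x - Q x)) @ \oo --> (0 : R)].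
Proof.
move=> lG hG sG.
have /choice[L hL] : forall x, exists l, (fun n => hnorm (sqrt_iter G n x - l)) @ \oo --> (0 : R).
  move=> x; have [//|||l _ hl] := ip_complete_incr (hilbert_onT X) (u := fun n => sqrt_iter G n x)
    (b := fun n => sqrt_bound n * hnorm x) (M := hnorm x); last by exists l.
  - by move=> n; rewrite -mulrBl; exact: sqrt_iter_incr.
  - by move=> n; rewrite ler_piMl ?hn_ge0//; case/andP: (sqrt_bound_01 n).
have itB n := linB (sqrt_iter_lin n lG).
have itC n x : hnorm (sqrt_iter G n x) <= hnorm x.
  apply: le_trans (sqrt_iter_bound n x hG) _; rewrite ler_piMl ?hn_ge0//.
  by case/andP: (sqrt_bound_01 n).
have L_lin : linear_on setT L.
  move=> a x y _ _; apply: (hcvg_unique (hL _)).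
  apply: (squeeze0 (v := fun n => cmod a * hnorm (sqrt_iter G n x - L x) + hnorm (sqrt_iter G n y - L y))).
    move=> n; rewrite hn_ge0 -hnZ /=; apply: le_trans (hnD _ _).
    by rewrite (sqrt_iter_lin n lG)// scalerBr addrACA opprD.
  by apply: cvg0D => //; exact: cvg0Ml.
have L_sa x y : ipX (L x) y = ipX x (L y).
  have it_sa n u v : ipX (sqrt_iter G n u) v = ipX u (sqrt_iter G n v).
    elim: n u v => [|n IH] u v /=; first by rewrite in0l in0r.
    by rewrite inZl inZr conjRC inDl inDr sG !IH.
  apply/eqP; rewrite -subr_eq0 -cmod_eq0 eq_le cmod_ge0 andbT.
  have lim : (fun n => hnorm y * hnorm (sqrt_iter G n x - L x) + hnorm x * hnorm (sqrt_iter G n y - L y))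
      @ \oo --> (0 : R) by apply: cvg0D; exact: cvg0Ml.
  apply: (cvgr_to_ge lim); near=> n.
  have -> : ipX (L x) y - ipX x (L y)
      = ipX x (sqrt_iter G n y - L y) - ipX (sqrt_iter G n x - L x) y.
    by rewrite inBr inBl it_sa; ring.
  apply: le_trans (cmod_le_add _ _) _; rewrite cmodN addrC; apply: lerD; last exact: in_CS.
  by rewrite mulrC; exact: in_CS.
have L_sq x : L x = (2^-1)%:C *: (G x + L (L x)).
  apply: (hcvg_unique (u := fun n => sqrt_iter G n.+1 x)).
    by have := hL x; rewrite -cvg_shiftS.
  apply: (squeeze0 (v := fun n => hnorm (sqrt_iter G n x - L x) + hnorm (sqrt_iter G n (L x) - L (L x)))); last exact: cvg0D.
  move=> n; rewrite hn_ge0 /= -scalerBr hnZ cmodR ger0_norm ?invr_ge0//.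
  have -> : G x + sqrt_iter G n (sqrt_iter G n x) - (G x + L (L x))
      = sqrt_iter G n (sqrt_iter G n x - L x) + (sqrt_iter G n (L x) - L (L x)).
    by rewrite opprD addrACA subrr add0r itB subrKA.
  have h1 := hnD (sqrt_iter G n (sqrt_iter G n x - L x)) (sqrt_iter G n (L x) - L (L x)).
  have h2 := itC n (sqrt_iter G n x - L x).
  have h3 := hn_ge0 (sqrt_iter G n x - L x); have h4 := hn_ge0 (sqrt_iter G n (L x) - L (L x)); lra.
exists (fun x => x - L x); split.
- by move=> a x y _ _; rewrite L_lin// scalerBr addrACA opprD.
- by move=> x y; rewrite inBl inBr L_sa.
- move=> x; have e : L x + L x = G x + L (L x).
    rewrite -[L x]scale1r -scalerDl {1}L_sq scalerA (_ : _ * _ = 1) ?scale1r//.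
    by rewrite -(rmorph1 (real_complex R)) -rmorphD -rmorphM /=; congr (_%:C); field.
  by rewrite (linB L_lin) opprB addrACA -opprD e opprD addrACA subrr addr0.
- move=> x; rewrite (_ : (fun n => _) = fun n => hnorm (sqrt_iter G n x - L x)); first exact: hL.
  apply/funext => n; rewrite opprB addrC addrA subrK.
  by rewrite hn_distC.
Unshelve. all: by end_near. Qed.

End DefectSqrt.

(** The iterates are polynomials in [G], which [A] carries to the same polynomials in [G']; pass to
    the limit. *)
Lemma defect_intertwine (R : realType) (X : hilbertType R) (A G G' Q Q' : X -> X) :
  linear_on setT A -> (forall x, hnorm (A x) <= hnorm x) -> (forall x, A (G x) = G' (A x)) ->
  (forall x, (fun n => hnorm (x - sqrt_iter G n x - Q x)) @ \oo --> (0 : R)) ->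
  (forall x, (fun n => hnorm (x - sqrt_iter G' n x - Q' x)) @ \oo --> (0 : R)) ->
  forall x, A (Q x) = Q' (A x).
Proof.
move=> lA hA AG cQ cQ' x.
have it n y : A (sqrt_iter G n y) = sqrt_iter G' n (A y).
  elim: n y => [|n IH] y /=; first exact: (lin0 lA).
  by rewrite (linZ lA) (linD lA) AG !IH.
apply: (hcvg_unique (u := fun n => A x - sqrt_iter G' n (A x))); last exact: cQ'.
by apply: squeeze0 (cQ x) => n; rewrite hn_ge0 /= -it -!(linB lA) hA.
Qed.

Lemma iter_lin (R : realType) (V : lmodType R[i]) (A : V -> V) k :
  linear_on setT A -> linear_on setT (iter k A).
Proof. by move=> lA; elim: k => [|k IH] a x y _ _ //=; rewrite IH// lA. Qed.

Lemma iter_contr (R : realType) (X : hilbertType R) (A : X -> X) k x :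
  (forall x, hnorm (A x) <= hnorm x) -> hnorm (iter k A x) <= hnorm x.
Proof. by move=> hA; elim: k => [|k IH] //=; apply: le_trans (hA _) IH. Qed.

(** * The Julia operator of a contraction and its transfer function *)

Section Julia.
Variables (R : realType) (X : hilbertType R) (T : X -> X).
Hypotheses (T_lin : linear_on setT T) (T_contr : forall x, hnorm (T x) <= hnorm x).
Local Notation ipX := (@inner R X).
Local Notation Ta := (adj T).

Lemma T_contractive : contractive_op T.
Proof. by split=> // x; rewrite !normE_hnorm lecR. Qed.

Let T_bd : bounded_op T := contractive_bounded T_contractive.
Let Ta_lin : linear_on setT Ta := adj_linear T_bd.

Let Ta_contr x : hnorm (Ta x) <= hnorm x.
Proof. exact: (adj_contr x T_contractive). Qed.

Lemma julia_exists : exists C B : X -> X,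
  [/\ linear_on setT C /\ linear_on setT B,
      (forall x y, ipX (C x) y = ipX x (C y)) /\ (forall x y, ipX (B x) y = ipX x (B y)),
      (forall x, C (C x) = x - Ta (T x)) /\ (forall x, B (B x) = x - T (Ta x))
    & (forall x, T (C x) = B (T x)) /\ (forall x, Ta (B x) = C (Ta x))].
Proof.
have lG : linear_on setT (fun x => Ta (T x)) by move=> a x y _ _; rewrite T_lin// Ta_lin.
have lG' : linear_on setT (fun x => T (Ta x)) by move=> a x y _ _; rewrite Ta_lin// T_lin.
have bG x : hnorm (Ta (T x)) <= hnorm x := le_trans (Ta_contr _) (T_contr _).
have bG' x : hnorm (T (Ta x)) <= hnorm x := le_trans (T_contr _) (Ta_contr _).
have sG x y : ipX (Ta (T x)) y = ipX x (Ta (T y)) by rewrite (adjP' T_bd) (adjP T_bd).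
have sG' x y : ipX (T (Ta x)) y = ipX x (T (Ta y)) by rewrite (adjP T_bd) (adjP' T_bd).
have [C [lC sC CC cC]] := defect_sqrt lG bG sG; have [B [lB sB BB cB]] := defect_sqrt lG' bG' sG'.
exists C, B; split=> //; split=> x.
  exact: (defect_intertwine T_lin T_contr (G := fun x => Ta (T x)) (G' := fun x => T (Ta x))).
exact: (defect_intertwine Ta_lin Ta_contr (G := fun x => T (Ta x)) (G' := fun x => Ta (T x))).
Qed.

Variables C B : X -> X.
Hypotheses (C_lin : linear_on setT C) (B_lin : linear_on setT B).
Hypotheses (C_sa : forall x y, ipX (C x) y = ipX x (C y))
  (B_sa : forall x y, ipX (B x) y = ipX x (B y)).
Hypotheses (CC : forall x, C (C x) = x - Ta (T x)) (BB : forall x, B (B x) = x - T (Ta x)).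
Hypothesis TC : forall x, T (C x) = B (T x).

Lemma C_norm x : hnorm (C x) ^+ 2 = hnorm x ^+ 2 - hnorm (T x) ^+ 2.
Proof.
apply: complexI; rewrite rmorphB /= -!in_self C_sa CC inBr; congr (_ - _).
by rewrite -(adjP T_bd).
Qed.

Lemma B_norm x : hnorm (B x) ^+ 2 = hnorm x ^+ 2 - hnorm (Ta x) ^+ 2.
Proof.
apply: complexI; rewrite rmorphB /= -!in_self B_sa BB inBr; congr (_ - _).
by rewrite -(adjP' T_bd).
Qed.

(** The cross terms cancel: [<C p, Ta u> = <T C p, u> = <B T p, u>]. *)
Lemma julia_isometry p u : hnorm (T p + B u) ^+ 2 + hnorm (C p - Ta u) ^+ 2
  = hnorm p ^+ 2 + hnorm u ^+ 2.
Proof.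
rewrite hn2D hn2B C_norm B_norm.
have -> : ipX (C p) (Ta u) = ipX (T p) (B u) by rewrite -(adjP T_bd) TC B_sa.
ring.
Qed.

Let C_contr x : hnorm (C x) <= hnorm x.
Proof. by apply: (le_of_sqr (hn_ge0 _) (C_norm x) erefl); rewrite gerBl sqr_ge0. Qed.

Let B_contr x : hnorm (B x) <= hnorm x.
Proof. by apply: (le_of_sqr (hn_ge0 _) (B_norm x) erefl); rewrite gerBl sqr_ge0. Qed.

Definition julia_coef k (u : X) : X :=
  if k is j.+1 then C (iter j T (B u)) else - Ta u.

(* The transfer function of the Julia operator [[T, B], [C, -T^*]]. *)
Lemma julia_schur : exists2 S : disk R -> X -> X, schur S & forall k, scoef S k = julia_coef k.
Proof.
have res (z : disk R) h : exists r, r - (z : R[i]) *: T r = h.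
  have [//|//|//|r _ e] := neumann (hilbert_onT X) (A := T) (z := z) _ T_lin _ (disk_cmod z) (h := h).
    by move=> x _; exact: T_contr.
  by exists r.
have /choice[r hr] : forall p : disk R * X, exists r, r - (p.1 : R[i]) *: T r = B p.2.
  by move=> p; exact: res.
pose S (z : disk R) u := - Ta u + (z : R[i]) *: C (r (z, u)).
have rE (z : disk R) u : r (z, u) = T ((z : R[i]) *: r (z, u)) + B u.
  by rewrite (linZ T_lin) addrC -(hr (z, u)) /= subrK.
have res_inj (z : disk R) p q : p - (z : R[i]) *: T p = q - (z : R[i]) *: T q -> p = q.
  move=> e; apply: (resolvent_inj (hilbert_onT X) (A := T) _ T_lin _ (disk_cmod z) _ _ e) => //.
  by move=> x _; exact: T_contr.
have r_lin (z : disk R) : linear_on setT (fun u => r (z, u)).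
  move=> a u v _ _; apply: (res_inj z); rewrite (hr (z, _)) /= B_lin// -(hr (z, u)) -(hr (z, v)) /=.
  by rewrite T_lin// scalerBr scalerDr addrACA -opprD !scalerA mulrC.
have S_contr (z : disk R) : contractive_op (S z).
  split=> [a u v _ _|u].
    rewrite /S Ta_lin// (r_lin z a u v)// C_lin// opprD -scalerN scalerDr scalerDr addrACA.
    by rewrite !scalerA mulrC.
  rewrite !normE_hnorm lecR; apply: (le_of_sqr (hn_ge0 _) erefl erefl).
  (* At the state [z r] this reads [|r|^2 + |S z u|^2 = |z|^2 |r|^2 + |u|^2], so [S z] is
     contractive because [|z| < 1]. *)
  have := julia_isometry ((z : R[i]) *: r (z, u)) u; rewrite -rE (linZ C_lin) hnZ addrC.
  rewrite [_ - Ta u]addrC -/(S z u) exprMn.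
  have z1 := disk_cmod z; have z0 := cmod_ge0 (z : R[i]); have n0 := sqr_ge0 (hnorm (r (z, u))).
  have : cmod z ^+ 2 <= 1 by rewrite expr_le1// ltW.
  nra.
have r_norm (z : disk R) u : hnorm (r (z, u)) <= (1 - cmod z)^-1 * hnorm u.
  have h1 : hnorm (r (z, u)) <= (1 - cmod z)^-1 * hnorm (r (z, u) - (z : R[i]) *: T (r (z, u))).
    apply: (resolvent_norm (hilbert_onT X) (A := T) _ _ (disk_cmod z)) => //.
    by move=> x _; exact: T_contr.
  rewrite (hr (z, u)) /= in h1; apply: (le_trans h1).
  by rewrite ler_wpM2l// invr_ge0 subr_ge0 ltW// disk_cmod.
(* An exact remainder makes the error of the power series of [S] explicit and uniform in [u]. *)
have r_exp (z : disk R) u m : r (z, u) = \sum_(k < m) (z : R[i]) ^+ k *: iter k T (B u)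
    + (z : R[i]) ^+ m *: iter m T (r (z, u)).
  elim: m => [|m IH]; first by rewrite big_ord0 add0r expr0 scale1r.
  rewrite {1}IH big_ord_recr /= -addrA; congr (_ + _).
  rewrite {1}rE (linD (iter_lin m T_lin)) (linZ T_lin) (linZ (iter_lin m T_lin)) scalerDr addrC; congr (_ + _).
  by rewrite scalerA -exprSr -iterSr.
have Sn_contr k u : hnorm (julia_coef k u) <= hnorm u.
  case: k => [|k] /=; first by rewrite hnN.
  apply: le_trans (C_contr _) _; apply: le_trans (iter_contr _ _ T_contr) _; exact: B_contr.
have Sn_lin k : linear_on setT (julia_coef k).
  case: k => [|k] a x y _ _ /=; first by rewrite Ta_lin// opprD scalerN.
  by rewrite B_lin// (iter_lin k T_lin)// C_lin.
have Sn_bd k : bounded_op (julia_coef k).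
  by split=> //; exists 1 => u _; rewrite mul1r; exact: Sn_contr.
have S_sum (z : disk R) (e : R) : 0 < e -> \forall n \near \oo, forall u,
    hnorm (S z u - \sum_(k < n) (z : R[i]) ^+ k *: julia_coef k u) <= e * hnorm u.
  move=> e0; pose q := cmod z; have q0 : 0 <= q by exact: cmod_ge0.
  have q1 : q < 1 by exact: disk_cmod.
  have lim : (fun n => (1 - q)^-1 * q ^+ n) @ \oo --> (0 : R).
    by apply: cvg0Ml; apply: cvg_expr; rewrite ger0_norm.
  have [K hK] := cvg0_near lim e0; exists K.+1 => // -[//|n] Kn u.
  have -> : S z u - \sum_(k < n.+1) (z : R[i]) ^+ k *: julia_coef k u
      = (z : R[i]) ^+ n.+1 *: C (iter n T (r (z, u))).
    rewrite big_ord_recl expr0 scale1r /= opprD addrACA subrr add0r.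
    rewrite {1}(r_exp z u n) (linD C_lin) (linZ C_lin) (lin_sum C_lin) scalerDr scalerA -exprS.
    rewrite addrAC [X in X - _](_ : _ = \sum_(i < n) (z : R[i]) ^+ (lift ord0 i) *: C (iter i T (B u))).
      by rewrite subrr add0r.
    rewrite scaler_sumr; apply: eq_bigr => i _.
    by rewrite (linZ C_lin) scalerA -exprS.
  rewrite hnZ cmodX.
  have h1 : hnorm (C (iter n T (r (z, u)))) <= (1 - q)^-1 * hnorm u.
    by apply: le_trans (C_contr _) (le_trans (iter_contr _ _ T_contr) (r_norm z u)).
  apply: le_trans (ler_wpM2l (exprn_ge0 n.+1 q0) h1) _; rewrite mulrA ler_wpM2r ?hn_ge0// mulrC.
  by apply: ltW; apply: hK; exact: ltnW.
exists S; first by split=> //; exists julia_coef.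
by move=> k; apply/funext => u; rewrite /scoef (taylorE (@op_taylor _ _ _ _ _ S_sum u)).
Qed.

End Julia.

(** * The functional model of a contraction *)

Section FunctionalModel.
Variables (R : realType) (X : hilbertType R) (T C B : X -> X).
Local Notation ipX := (@inner R X).
Local Notation Ta := (adj T).
Hypotheses (T_lin : linear_on setT T) (T_contr : forall x, hnorm (T x) <= hnorm x).
Hypotheses (C_lin : linear_on setT C) (B_lin : linear_on setT B).
Hypotheses (C_sa : forall x y, ipX (C x) y = ipX x (C y))
  (B_sa : forall x y, ipX (B x) y = ipX x (B y)).
Hypotheses (CC : forall x, C (C x) = x - Ta (T x)) (BB : forall x, B (B x) = x - T (Ta x)).
Hypotheses (TC : forall x, T (C x) = B (T x)) (TaB : forall x, Ta (B x) = C (Ta x)).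
Variable S : disk R -> X -> X.
Hypotheses (hS : schur S) (S_coef : forall k, scoef S k = julia_coef T C B k).

Let T_bd : bounded_op T := contractive_bounded (T_contractive T_lin T_contr).
Let Ta_lin : linear_on setT Ta := adj_linear T_bd.
Let Ta_contr x : hnorm (Ta x) <= hnorm x := adj_contr x (T_contractive T_lin T_contr).

Let C_norm := C_norm T_lin T_contr C_sa CC.
Let B_norm := B_norm T_lin T_contr B_sa BB.

Let C_contr x : hnorm (C x) <= hnorm x.
Proof. by apply: (le_of_sqr (hn_ge0 _) (C_norm x) erefl); rewrite gerBl sqr_ge0. Qed.

Let B_contr x : hnorm (B x) <= hnorm x.
Proof. by apply: (le_of_sqr (hn_ge0 _) (B_norm x) erefl); rewrite gerBl sqr_ge0. Qed.

Lemma iter_adj k x y : ipX (iter k T x) y = ipX x (iter k Ta y).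
Proof. by elim: k x y => [|k IH] x y //; rewrite iterS (adjP T_bd) IH -iterSr. Qed.

Lemma scoef0E u : scoef S 0 u = - Ta u. Proof. by rewrite S_coef. Qed.

Lemma scoefSE k u : scoef S k.+1 u = C (iter k T (B u)). Proof. by rewrite S_coef. Qed.

Lemma adj_scoef0E y : adj (scoef S 0) y = - T y.
Proof.
have -> // : adj (scoef S 0) = fun y => - T y.
apply: adj_unique; first exact: scoef_bounded.
by move=> u v; rewrite scoef0E inNl inNr (adjP' T_bd).
Qed.

Lemma adj_scoefSE k y : adj (scoef S k.+1) y = B (iter k Ta (C y)).
Proof.
have -> // : adj (scoef S k.+1) = fun y => B (iter k Ta (C y)).
apply: adj_unique; first exact: scoef_bounded.
by move=> u v; rewrite scoefSE C_sa iter_adj B_sa.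
Qed.

(* [h] is the image of [x] in the model space. *)
Definition represents (h : disk R -> X * X) x :=
  has_taylor (comp1 h) (fun k => C (iter k T x)) /\
  has_taylor (comp2 h) (fun k => B (iter k Ta x)).

Lemma represents_exists x : exists h, represents h x.
Proof.
have [f hf] : exists f, has_taylor f (fun k => C (iter k T x)).
  by apply: (@has_taylor_exists _ _ _ (hnorm x)) => k; apply: le_trans (C_contr _) (iter_contr _ _ T_contr).
have [g hg] : exists g, has_taylor g (fun k => B (iter k Ta x)).
  by apply: (@has_taylor_exists _ _ _ (hnorm x)) => k; apply: le_trans (B_contr _) (iter_contr _ _ Ta_contr).
by exists (fun z => (f z, g z)); split.
Qed.

Lemma represents_unique h h' x : represents h x -> represents h' x -> h = h'.
Proof. by move=> [a1 a2] [b1 b2]; apply: comp_ext; [exact: taylor_inj a1 b1|exact: taylor_inj a2 b2]. Qed.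

Lemma represents_lin a h h' x y : represents h x -> represents h' y ->
  represents (a *: h + h') (a *: x + y).
Proof.
move=> [a1 a2] [b1 b2]; split.
  rewrite (_ : (fun k => _) = fun k => a *: C (iter k T x) + C (iter k T y)).
    exact: (has_taylorD (has_taylorZ a a1) b1).
  by apply/funext => k; rewrite (iter_lin k T_lin)// C_lin.
rewrite (_ : (fun k => _) = fun k => a *: B (iter k Ta x) + B (iter k Ta y)).
  exact: (has_taylorD (has_taylorZ a a2) b2).
by apply/funext => k; rewrite (iter_lin k Ta_lin)// B_lin.
Qed.

Lemma represents_R0 h x : represents h x -> represents (R0 S h) (T x).
Proof.
move=> [h1 h2]; split.
  have := diffq0_taylor h1; congr (has_taylor _ _).
  by apply/funext => k; rewrite -iterSr.
have := has_taylorB (has_taylor_mulz h2) (tilde_taylor hS (comp1 h (disk0 R))).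
congr (has_taylor _ _); apply/funext => k; rewrite (taylor_at0 h1).
case: k => [|k] /=; first by rewrite sub0r adj_scoef0E opprK TC.
rewrite adj_scoefSE CC (linB (iter_lin k Ta_lin)) (linB B_lin) opprB addrC subrK.
by rewrite -iterSr.
Qed.

Lemma represents_R0adj h x : represents h x -> represents (R0adj S h) (Ta x).
Proof.
move=> [h1 h2]; split.
  have := has_taylorB (has_taylor_mulz h1) (schur_taylor hS (comp2 h (disk0 R))).
  congr (has_taylor _ _); apply/funext => k; rewrite (taylor_at0 h2).
  case: k => [|k] /=; first by rewrite sub0r scoef0E opprK TaB.
  rewrite scoefSE BB (linB (iter_lin k T_lin)) (linB C_lin) opprB addrC subrK.
  by rewrite -iterSr.
have := diffq0_taylor h2; congr (has_taylor _ _).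
by apply/funext => k; rewrite -iterSr.
Qed.

Lemma represents_Cadj y : represents (DS_Cadj S y) (C y).
Proof.
split.
  have := has_taylorB (@has_taylor_cst _ _ y) (schur_taylor hS (adj (scoef S 0) y)).
  have -> : (fun z => y - S z (adj (scoef S 0) y)) = comp1 (DS_Cadj S y).
    apply/funext => z; rewrite /comp1 /= dBRker_at0.
    by rewrite (_ : S (disk0 R) = scoef S 0)//; apply/funext => u; exact: scoef0.
  congr (has_taylor _ _); apply/funext => -[|k]; rewrite adj_scoef0E.
    by rewrite scoef0E /= (linN Ta_lin) opprK CC.
  by rewrite scoefSE (linN B_lin) (linN (iter_lin k T_lin)) (linN C_lin) sub0r opprK -TC -iterSr.
have := diffq0_taylor (tilde_taylor hS y); congr (has_taylor _ _).
by apply/funext => k; rewrite adj_scoefSE.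
Qed.

Lemma represents_B u : represents (DS_B S u) (B u).
Proof.
split.
  have := diffq0_taylor (schur_taylor hS u); congr (has_taylor _ _).
  by apply/funext => k; rewrite scoefSE.
have := has_taylorB (@has_taylor_cst _ _ u) (tilde_taylor hS (scoef S 0 u)).
have -> : (fun z => u - tilde S z (scoef S 0 u)) = comp2 (DS_B S u).
  apply/funext => z; rewrite /comp2 /= dBRker_at0 -(scoef0 hS) /tilde.
  have -> : diskJ (disk0 R) = disk0 R by apply: val_inj; rewrite /= rmorph0.
  by rewrite adjK//; exact: contractive_bounded (schur_contr hS _).
congr (has_taylor _ _); apply/funext => -[|k]; rewrite scoef0E.
  by rewrite adj_scoef0E /= (linN T_lin) opprK BB.
by rewrite adj_scoefSE (linN C_lin) (linN (iter_lin k Ta_lin)) (linN B_lin) sub0r opprK -TaB -iterSr.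
Qed.

Lemma represents_taylor h x : represents h x ->
  taylor (comp1 h) = (fun k => C (iter k T x)) /\ taylor (comp2 h) = (fun k => B (iter k Ta x)).
Proof. by move=> [h1 h2]; rewrite (taylorE h1) (taylorE h2). Qed.

Lemma shift_coef0 h k : shift_coef S h 0 k = taylor (comp1 h) k.
Proof.
rewrite /shift_coef DSseq_fst subn0 /conv big1 ?subr0// => j _.
by rewrite DSseq_snd /= (lin0 (scoef_lin hS _)).
Qed.

Lemma shift_coefS h n k : shift_coef S h n.+1 k =
  (if k is j.+1 then shift_coef S h n j else 0) - scoef S k (taylor (comp2 h) n).
Proof.
rewrite /shift_coef /conv big_ord_recl subn0 DSseq_snd /= subn0 DSseq_fst; case: k => [|k] /=.
  by rewrite big_ord0 addr0.
rewrite DSseq_fst ltnS subSS opprD addrCA addrC; congr (_ - _ - _).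
by apply: eq_bigr => j _; rewrite /= /bump /= add1n subSS !DSseq_snd ltnS /=; case: n.
Qed.

(** The functions whose H(S) norms define the norm of D(S) are thus the free outputs of the
    colligation started at [Ta] iterated [n] times on [x]. *)
Lemma represents_shift h x n k : represents h x ->
  shift_coef S h n k = C (iter k T (iter n Ta x)).
Proof.
move=> /represents_taylor[e1 e2]; elim: n k => [|n IH] k; first by rewrite shift_coef0 e1.
rewrite shift_coefS e2; case: k => [|k].
  by rewrite sub0r scoef0E opprK TaB.
rewrite IH scoefSE BB (linB (iter_lin k T_lin)) (linB C_lin) opprB addrC subrK.
by rewrite -iterSr.
Qed.

(* The state trajectory of the colligation with initial state [xi] and input [g]. *)
Fixpoint state (xi : X) (g : nat -> X) k : X :=
  if k is j.+1 then T (state xi g j) + B (g j) else xi.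

Lemma stateE xi g k : state xi g k = iter k T xi + \sum_(j < k) iter (k.-1 - j) T (B (g j)).
Proof.
elim: k => [|k IH] /=; first by rewrite big_ord0 addr0.
rewrite IH (linD T_lin) (lin_sum T_lin) big_ord_recr /= subnn -addrA; congr (_ + (_ + _)).
apply: eq_bigr => j _; have jk := ltn_ord j.
by rewrite -iterS (_ : (k.-1 - j).+1 = k - j)%N//; lia.
Qed.

Lemma state_output xi g k :
  C (iter k T xi) + conv (scoef S) g k = C (state xi g k) - Ta (g k).
Proof.
rewrite stateE (linD C_lin) (lin_sum C_lin) /conv big_ord_recr /= subnn scoef0E addrA.
congr (_ + _ - _); apply: eq_bigr => j _; have jk := ltn_ord j.
by rewrite (_ : k - j = (k.-1 - j).+1)%N ?scoefSE//; lia.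
Qed.

(** Sum the Julia isometry along the trajectory; the norms of the states telescope. *)
Lemma energy_balance xi g N :
  \sum_(k < N) (hnorm (C (iter k T xi) + conv (scoef S) g k) ^+ 2 - hnorm (g k) ^+ 2)
  + hnorm (state xi g N) ^+ 2 = hnorm xi ^+ 2.
Proof.
elim: N => [|N IH] /=; first by rewrite big_ord0 add0r.
rewrite -[RHS]IH big_ord_recr /= state_output.
have := julia_isometry T_lin T_contr C_sa B_sa CC BB TC (state xi g N) (g N).
set s := \sum_(_ < _) _; lra.
Qed.

Lemma sum_B_norm n x :
  \sum_(k < n) hnorm (B (iter k Ta x)) ^+ 2 = hnorm x ^+ 2 - hnorm (iter n Ta x) ^+ 2.
Proof.
elim: n => [|n IH]; first by rewrite big_ord0 subrr.
by rewrite big_ord_recr IH B_norm /=; ring.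
Qed.

(** The H(S) part of the [n]-th term is at most the energy of the state [iter n Ta x], and by
    [sum_B_norm] the coefficients account for exactly what that state has lost against [x]. *)
Lemma represents_DS h x : represents h x -> DS S h /\ ipnorm (DSip S) h <= hnorm x.
Proof.
move=> hx; have a1 : analytic (comp1 h) by case: hx; eexists; eassumption.
have a2 : analytic (comp2 h) by case: hx; eexists; eassumption.
have [_ e2] := represents_taylor hx.
have hq : forall l, dquad (@zpr R X X) (zgen (scoef S)) (DSseq h) l <= hnorm x ^+ 2.
  apply/(@DSN_all_leP R X X S hS h (hnorm x ^+ 2) a1) => n.
  apply/(@DSN_leP R X X S hS h n (hnorm x ^+ 2) a1) => g N.
  rewrite /DSval e2 sum_B_norm.
  have <- := energy_balance (iter n Ta x) g N.
  under eq_bigr do rewrite (represents_shift _ _ hx).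
  set s := \sum_(_ < _) _; have := sqr_ge0 (hnorm (state (iter n Ta x) g N)); lra.
have hD : DS S h by apply/(DS_spec hS); split => //; exists (hnorm x ^+ 2).
split=> //; apply: (le_of_sqr (hn_ge0 _) (DSnorm2_ipnorm hS hD) erefl).
by rewrite (DSnorm2E hS hD); apply: (denergy_le [::]).
Qed.

Hypothesis T_cnu : cnu_contraction T.

(** If all coefficients vanish then so do all defects, and both orbits of [x] keep its norm. *)
Lemma represents0_eq0 x : represents 0 x -> x = 0.
Proof.
move=> /represents_taylor[e1 e2].
have z0 (a : nat -> X) : taylor (fun _ : disk R => 0 : X) = a -> forall k, a k = 0.
  move=> <- k; have h0 : has_taylor (fun _ : disk R => 0 : X) (fun=> 0).
    have := @has_taylor_cst R X 0; congr (has_taylor _ _).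
    by apply/funext => -[].
  by rewrite (taylorE h0).
have c0 k : C (iter k T x) = 0 by exact: (z0 _ e1 k).
have b0 k : B (iter k Ta x) = 0 by exact: (z0 _ e2 k).
have sq_eq (a b : R) : 0 <= a -> 0 <= b -> 0 = a ^+ 2 - b ^+ 2 -> b = a by move=> *; nra.
case: T_cnu => _ /seteqP[h _]; apply: h; split=> k _ /=; rewrite !normE_hnorm; congr (_%:C).
  elim: k => [//|k IH]; rewrite iterS -[RHS]IH; apply: sq_eq; rewrite ?hn_ge0//.
  by rewrite -B_norm b0 hn0 expr0n.
elim: k => [//|k IH]; rewrite iterS -[RHS]IH; apply: sq_eq; rewrite ?hn_ge0//.
by rewrite -C_norm c0 hn0 expr0n.
Qed.

Lemma ip_Cadj h y : DS S h -> DSip S h (DS_Cadj S y) = ipX (comp1 h (disk0 R)) y.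
Proof.
move=> hh; have [hC eC] := DSseq_Cadj hS y.
rewrite (DSip_seq hS hh hC) eC (zip_gen hS _ (DS_zspace hS hh)) zpr1.
by rewrite /dsum_ip /= in0l addr0 (DS_fst0 hh).
Qed.

Lemma ip_B h u : DS S h -> DSip S h (DS_B S u) = ipX (comp2 h (disk0 R)) u.
Proof.
move=> hh; have [hB eB] := DSseq_B hS u.
rewrite (DSip_seq hS hh hB) eB (zip_gen hS _ (DS_zspace hS hh)) zpr1.
by rewrite /dsum_ip /= in0l add0r (DS_snd0 hh).
Qed.

Lemma model_unitary : exists W : X -> (disk R -> X * X),
  unitary_on setT ipX (DS S) (DSip S) W /\ forall x, W (T x) = R0 S (W x).
Proof.
have /choice[W hW] := represents_exists.
have WD x : DS S (W x) by case: (represents_DS (hW x)).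
have Wn x : ipnorm (DSip S) (W x) <= hnorm x by case: (represents_DS (hW x)).
have W_lin : linear_on setT W.
  by move=> a x y _ _; exact: (represents_unique (hW _) (represents_lin a (hW x) (hW y))).
have WT x : W (T x) = R0 S (W x) := represents_unique (hW _) (represents_R0 (hW x)).
have WTa x : W (Ta x) = R0adj S (W x) := represents_unique (hW _) (represents_R0adj (hW x)).
have WC y : W (C y) = DS_Cadj S y := represents_unique (hW _) (represents_Cadj y).
have WB u : W (B u) = DS_B S u := represents_unique (hW _) (represents_B u).
have hD := DS_hilbert hS.
have iterD k h : DS S h -> DS S (iter k (R0 S) h).
  by move=> hh; elim: k => //= k IH; exact: DS_R0.
have iterDa k h : DS S h -> DS S (iter k (R0adj S) h).
  by move=> hh; elim: k => //= k IH; exact: DS_R0adj.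
have iter_ip k h x : DS S h -> DS S x -> DSip S (iter k (R0 S) h) x = DSip S h (iter k (R0adj S) x).
  move=> hh; elim: k x => [//|k IH] x hx.
  by rewrite iterS (DSip_R0 hS (iterD k _ hh) hx) (IH _ (DS_R0adj hS hx)) -iterSr.
have iter_ipa k h x : DS S h -> DS S x -> DSip S (iter k (R0adj S) h) x = DSip S h (iter k (R0 S) x).
  move=> hh hx; rewrite -(ipJ hD hx (iterDa k _ hh)) -(iter_ip k x h hx hh).
  exact: (ipJ hD (iterD k _ hx) hh).
have taylor1 k h : DS S h -> comp1 (iter k (R0 S) h) (disk0 R) = taylor (comp1 h) k.
  elim: k h => [|k IH] h hh; first exact: (taylor_at0 (DS_taylor1 hh)).
  by rewrite iterSr (IH _ (DS_R0 hS hh)) (taylorE (diffq0_taylor (DS_taylor1 hh))).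
have taylor2 k h : DS S h -> comp2 (iter k (R0adj S) h) (disk0 R) = taylor (comp2 h) k.
  elim: k h => [|k IH] h hh; first exact: (taylor_at0 (DS_taylor2 hh)).
  by rewrite iterSr (IH _ (DS_R0adj hS hh)) (taylorE (diffq0_taylor (DS_taylor2 hh))).
have W_iter k x : W (iter k T x) = iter k (R0 S) (W x) by elim: k => //= k <-; exact: WT.
have W_itera k x : W (iter k Ta x) = iter k (R0adj S) (W x) by elim: k => //= k <-; exact: WTa.
(* [g] is the adjoint of [W] applied to [h]. Testing the coefficients of [W g] against vectors moves
   [T], [C] and [B] across the product, where [W] turns them into the operators of D(S) and the
   coefficients of [h] appear. *)
have coadj h : DS S h -> exists2 g, W g = h & forall x, DSip S (W x) h = ipX x g.
  move=> hh.
  have [||g hg] := @riesz R X (fun x => DSip S (W x) h) (ipnorm (DSip S) h).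
  - by move=> a x y; rewrite W_lin// (ipDZl hD a (WD x) (WD y) hh).
  - move=> x; apply: (le_trans (ip_CS hD (WD x) hh)).
    rewrite [leRHS]mulrC; exact: (ler_wpM2r (ipn_ge0 _ _) (Wn x)).
  exists g => //; have hg' x : ipX g x = DSip S h (W x).
    by rewrite inner_conj -hg (ipJ hD (WD x) hh).
  apply: (@DSseq_inj _ _ _ S) => //; apply/funext => -[] k /=; congr (_, _).
  - apply: in_ext => y; have [-> _] := represents_taylor (hW g).
    rewrite inner_conj C_sa iter_adj hg' W_itera WC -(iter_ip k h _ hh (DSseq_Cadj hS y).1).
    by rewrite (ip_Cadj y (iterD k _ hh)) (taylor1 k h hh) -inner_conj.
  - apply: in_ext => u; have [_ ->] := represents_taylor (hW g).
    have e : ipX (iter k Ta g) (B u) = ipX g (iter k T (B u)).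
      by rewrite inner_conj -iter_adj -inner_conj.
    rewrite inner_conj B_sa e hg' W_iter WB -(iter_ipa k h _ hh (DSseq_B hS u).1).
    by rewrite (ip_B u (iterDa k _ hh)) (taylor2 k h hh) -inner_conj.
exists W; split=> //; split=> //.
- apply/seteqP; split=> [_ [x _ <-]|h /coadj[g <- _]]; first exact: WD.
  by exists g.
(* The adjoint is a section of [W]; as [W] is injective, [W g = W y] forces [g = y], so [W] is
   isometric. *)
- move=> x y _ _; have [g Wg hg] := coadj _ (WD y).
  have gy : g - y = 0.
    apply: represents0_eq0; have := hW (g - y).
    by rewrite (linB W_lin) Wg subrr.
  by rewrite hg; congr (ipX x _); apply/eqP; rewrite -subr_eq0 gy.
Qed.

End FunctionalModel.

(** * Completely non-unitary contractions and models on D(S) *)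

Section Characterization.
Variables (R : realType) (X : hilbertType R) (T : X -> X).
Hypothesis T_bd : bounded_op T.

Lemma cnu_of_model (U Y : hilbertType R) (S : disk R -> U -> Y) (W : X -> (disk R -> Y * U)) :
  schur S -> unitary_on setT (@inner R X) (DS S) (DSip S) W ->
  (forall x, W (T x) = R0 S (W x)) -> cnu_contraction T.
Proof.
move=> hS [W_lin W_im W_ip] WT; have hD := DS_hilbert hS.
have WD x : DS S (W x) by rewrite -W_im; exists x.
have Wn x : ipnorm (DSip S) (W x) = hnorm x by rewrite /hnorm /ipnorm W_ip.
have W_inj x y : W x = W y -> x = y.
  move=> e; apply/eqP; rewrite -subr_eq0; apply/eqP; apply: hn_eq0.
  by rewrite -Wn (linB W_lin) e subrr (ipn0 hD).
(* By surjectivity the right side is some [W v], and [v] is identified by its products with all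
   vectors. *)
have WTa x : W (adj T x) = R0adj S (W x).
  have hR := DS_R0adj hS (WD x); have : DS S (R0adj S (W x)) by [].
  rewrite -{1}W_im => -[v _ ev]; rewrite -ev; congr W; apply: in_ext => y.
  rewrite -(adjP T_bd) -(W_ip (T y) x I I) -(W_ip y v I I) WT ev.
  exact: (DSip_R0 hS (WD y) (WD x)).
have T_contr x : hnorm (T x) <= hnorm x by rewrite -!Wn WT; exact: (R0_contr hS (WD x)).
have norm2 x : DSnorm2 S (W x) = hnorm x ^+ 2 by rewrite -(DSnorm2_ipnorm hS (WD x)) Wn.
split=> [x|]; first by rewrite !normE_hnorm lecR.
have T_lin := proj1 T_bd; have Ta_lin := adj_linear T_bd.
apply/seteqP; split=> [x [hx1 hx2]|_ ->]; last first.
  have it0 (A : X -> X) k : linear_on setT A -> iter k A 0 = 0.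
    by move=> lA; elim: k => //= k ->; exact: (lin0 lA).
  by split=> k _ /=; rewrite it0.
have n1 k : hnorm (iter k T x) = hnorm x.
  by have := hx2 k I; rewrite /= !normE_hnorm => /complexI.
have n2 k : hnorm (iter k (adj T) x) = hnorm x.
  by have := hx1 k I; rewrite /= !normE_hnorm => /complexI.
have sq0 (X' : hilbertType R) (v : X') (a : R) : a = a - hnorm v ^+ 2 -> v = 0.
  move=> e; apply: hn_eq0; apply/eqP; rewrite -sqrf_eq0; apply/eqP; lra.
(* Equal norms along the orbit make the loss in the norm identity vanish. These values at 0 are the
   Taylor coefficients of the first component of [W x]. *)
have f0 k : comp1 (W (iter k T x)) (disk0 R) = 0.
  apply: (sq0 _ _ (hnorm x ^+ 2)); rewrite -{1}(n1 k.+1) -(n1 k) -!norm2 iterS WT.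
  exact: (DSnorm2_R0 hS (WD _)).
have g0 k : comp2 (W (iter k (adj T) x)) (disk0 R) = 0.
  apply: (sq0 _ _ (hnorm x ^+ 2)); rewrite -{1}(n2 k.+1) -(n2 k) -!norm2 iterS WTa.
  exact: (DSnorm2_R0adj hS (WD _)).
have t1 k : taylor (comp1 (W x)) k = 0.
  rewrite -(f0 k); elim: k x {hx1 hx2 n1 n2 f0 g0} => [|k IH] x.
    by rewrite (taylor_at0 (DS_taylor1 (WD x))).
  by rewrite iterSr -(IH (T x)) WT (taylorE (diffq0_taylor (DS_taylor1 (WD x)))).
have t2 k : taylor (comp2 (W x)) k = 0.
  rewrite -(g0 k); elim: k x {hx1 hx2 n1 n2 f0 g0 t1} => [|k IH] x.
    by rewrite (taylor_at0 (DS_taylor2 (WD x))).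
  by rewrite iterSr -(IH (adj T x)) WTa (taylorE (diffq0_taylor (DS_taylor2 (WD x)))).
apply: W_inj; rewrite (lin0 W_lin).
have [D0 e0] := DS_0 hS; apply: (DSseq_inj (WD x) D0); rewrite e0.
by apply/funext => -[] k /=; rewrite ?t1 ?t2.
Qed.

Lemma model_of_cnu : cnu_contraction T -> exists (U Y : hilbertType R)
  (S : disk R -> U -> Y) (W : X -> (disk R -> Y * U)),
  [/\ schur S, unitary_on setT (@inner R X) (DS S) (DSip S) W
    & forall x, W (T x) = R0 S (W x)].
Proof.
move=> hT; have T_lin := proj1 T_bd.
have T_contr x : hnorm (T x) <= hnorm x.
  by case: hT => /(_ x) + _; rewrite !normE_hnorm lecR.
have [C [B [[lC lB] [sC sB] [CC BB] [TC TaB]]]] := julia_exists T_lin T_contr.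
have [S hS S_coef] := julia_schur T_lin T_contr lC lB sC sB CC BB TC.
have [W [hW WT]] := model_unitary T_lin T_contr lC lB sC sB CC BB TC TaB hS S_coef hT.
by exists X, X, S, W.
Qed.

End Characterization.

Theorem theorem2p2 (R : realType) :
  (forall (U Y : hilbertType R) (S : disk R -> U -> Y), schur S ->
    [/\ (* (1) *)
        is_rkhs (dsum_ip (@inner R Y) (@inner R U)) (DSker S)
          (DS S) (DSip S)
        /\ (forall h, DS S h -> DSip S h h = (DSnorm2 S h)%:C),
        (* (2) and (3) *)
        adjoint_on (DS S) (DSip S) (R0 S) (R0adj S),
        (forall h, DS S h ->
           DSnorm2 S (R0 S h) = DSnorm2 S h - hnorm (comp1 h (disk0 R)) ^+ 2
           /\ DSnorm2 S (R0adj S h)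
              = DSnorm2 S h - hnorm (comp2 h (disk0 R)) ^+ 2),
        (* (4) *)
        unitary_on (DS S `*` setT) (dsum_ip (DSip S) (@inner R U))
          (DS S `*` setT) (dsum_ip (DSip S) (@inner R Y)) (DS_U S)
      & forall z : disk R, let A_z := fun h => h - (z : R[i]) *: R0 S h in
          invertible_on (DS S) (DSip S) A_z
          /\ forall u : U, S z u
               = DS_D S u
                 + (z : R[i]) *: DS_C ('pinv_(fun=> 0) (DS S) A_z (DS_B S u))])
  /\
  (* (5) *)
  (forall (X : hilbertType R) (T : X -> X), bounded_op T ->
    ((exists (U Y : hilbertType R) (S : disk R -> U -> Y)
         (W : X -> (disk R -> Y * U)),
        [/\ schur S,
            unitary_on setT (@inner R X) (DS S) (DSip S) W
          & forall x, W (T x) = R0 S (W x)])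
     <-> cnu_contraction T)).
Proof.
split=> [U Y S hS|X T T_bd]; last first.
  split=> [[U [Y [S [W [hS hW WT]]]]]|]; last exact: model_of_cnu.
  exact: (cnu_of_model T_bd hS hW WT).
split.
- by split; [exact: DS_rkhs|exact: (DSip_self hS)].
- by split; [exact: DS_R0|exact: DS_R0adj|exact: DSip_R0].
- by move=> h hh; split; [exact: DSnorm2_R0|exact: DSnorm2_R0adj].
- exact: DS_U_unitary.
- exact: transfer_realization.
Qed.
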